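(* Let $\Omega\subset\mathbb{R}^2$ be a bounded domain and let $$K(x)=\frac{x_2^2-x_1^2}{2\pi|x|^4}\qquad(x\in\mathbb{R}^2\setminus\{0\}).$$ Let $\mathcal{C}=[-\Lambda_+,\Lambda_+]$, where $\Lambda_+$ is the maximum of the numerical symbol $F$ of $K$ (see context). Let $\lambda\in\mathbb{C}\setminus\mathcal{C}$. Then for any $N$ (with $\omega^N\neq\emptyset$) the linear system $$\lambda u_m-N^{-2}\sum_{n\in\omega^N,\,n\neq m}K(x^N_m-x^N_n)\,u_n=f(x^N_m)\qquad(m\in\omega^N)$$ has a unique solution, and, writing the system as $(\lambda I-T^N)U=F$, there is the uniform resolvent estimate $$\|(\lambda I-T^N)^{-1}\|_{\mathcal{L}(\ell^2(\omega^N))}\le\operatorname{dist}(\lambda,\mathcal{C})^{-1}.$$ For $\lambda\in[-\Lambda_+,-\frac12)\cup(\frac12,\Lambda_+]$ the integral equation $(\lambda I-A_\Omega)u=f$ with kernel $K$ is well-posed in $L^2(\Omega)$ (i.e. $\lambda I-A_\Omega$ is boundedly invertible on $L^2(\Omega)$), but the corresponding approximation scheme $(\lambda I-T^N)U=F$ is unstable.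
   Context: $A_\Omega$ is the bounded operator on $L^2(\Omega)$ given by $A_\Omega u(x)=\mathrm{p.v.}\int_\Omega K(x-y)u(y)\,dy$. For each positive integer $N$ an origin $a^N\in\mathbb{R}^2$ is fixed, $x^N_m=a^N+\frac mN$ for $m\in\mathbb{Z}^2$, and $\omega^N=\{m\in\mathbb{Z}^2\mid x^N_m\in\Omega\}$. The right-hand side values $f(x^N_m)$ are arbitrary complex numbers. $T^N$ is the matrix with entries $N^{-2}K(x^N_m-x^N_n)$ for $m\neq n$ in $\omega^N$ and zero diagonal. The numerical symbol is the function on $Q=[-\pi,\pi]^2$ given by $F(\tau)=\sum_{m\in\mathbb{Z}^2,\,m\ne0}K(m)e^{im\cdot\tau}$ (convergent in $L^2(Q)$; $F$ denotes the representative continuous on $Q\setminus\{0\}$, with $F(0)=0$). Its range is a closed interval $F(Q)=[-\Lambda_+,\Lambda_+]$ with $\Lambda_+\ge\frac{\Gamma(1/4)^4}{32\pi^2}=0.5471\ldots$; this defines $\Lambda_+$. The scheme is called stable for a given $\lambda$ if there is a constant $C$ such that for all $N$ with $\omega^N\ne\emptyset$ the matrix $\lambda I-T^N$ is invertible with $\|(\lambda I-T^N)^{-1}\|_{\mathcal{L}(\ell^2(\omega^N))}\le C$; otherwise it is unstable. *)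

(* Defs.v *)
From HB Require Import structures.
From mathcomp Require Import all_boot all_order all_algebra finmap.
From mathcomp Require Import all_classical all_reals all_analysis.
From mathcomp Require Export complex.
Set Implicit Arguments.
Unset Strict Implicit.
Unset Printing Implicit Defensive.
Import Order.TTheory GRing.Theory Num.Theory.
Import numFieldNormedType.Exports.
Local Open Scope classical_set_scope.
Local Open Scope ring_scope.
Local Open Scope complex_scope.
Import ComplexField.Normc.

Section Plane.
Context {R : realType}.

Definition enorm (x : R * R) : R := Num.sqrt (x.1 ^+ 2 + x.2 ^+ 2).

Definition leb2 : {measure set (measurableTypeR R * measurableTypeR R) -> \bar R} :=
  (@lebesgue_measure R \x @lebesgue_measure R)%E.

Definition bounded_domain (Omega : set (R * R)) : Prop :=
  [/\ Omega !=set0, open Omega, connected Omega & bounded_set Omega].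

(* Only used away from the origin. *)
Definition cz_kernel (x : R * R) : R :=
  (x.2 ^+ 2 - x.1 ^+ 2) / (2 * pi * enorm x ^+ 4).

Definition Cint (D : set (R * R)) (u : R * R -> R[i]) : R[i] :=
  (\int[leb2]_(x in D) complex.Re (u x))
    +i* (\int[leb2]_(x in D) complex.Im (u x)).

Definition sqnorm2 (D : set (R * R)) (u : R * R -> R[i]) : \bar R :=
  (\int[leb2]_(x in D) (normc (u x) ^+ 2)%:E)%E.

Definition L2 (D : set (R * R)) (u : R * R -> R[i]) : Prop :=
  [/\ measurable_fun D (fun x => complex.Re (u x)),
      measurable_fun D (fun x => complex.Im (u x))
    & (sqnorm2 D u < +oo)%E].

Definition L2norm (D : set (R * R)) (u : R * R -> R[i]) : R :=
  Num.sqrt (fine (sqnorm2 D u)).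

Definition ae_eq_on (D : set (R * R)) (u v : R * R -> R[i]) : Prop :=
  {ae leb2, forall x, D x -> u x = v x}.

(* Operators act on representatives; linearity modulo null sets and the norm
   bound make them well defined on a.e.-classes. *)
Definition bounded_operator (D : set (R * R))
    (B : (R * R -> R[i]) -> (R * R -> R[i])) : Prop :=
  [/\ forall u, L2 D u -> L2 D (B u),
      forall (c : R[i]) u v, L2 D u -> L2 D v ->
        ae_eq_on D (B (fun x => c * u x + v x)) (fun x => c * B u x + B v x)
    & exists C : R, forall u, L2 D u -> L2norm D (B u) <= C * L2norm D u].

Definition boundedly_invertible (D : set (R * R))
    (B : (R * R -> R[i]) -> (R * R -> R[i])) : Prop :=
  exists2 S, bounded_operator D S &
    forall u, L2 D u -> ae_eq_on D (S (B u)) u /\ ae_eq_on D (B (S u)) u.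

Definition truncated (K : R * R -> R) (D : set (R * R))
    (u : R * R -> R[i]) (x : R * R) (e : R) : R[i] :=
  Cint (D `&` [set y | e < enorm (x - y)]) (fun y => (K (x - y))%:C * u y).

Definition is_pv (K : R * R -> R) (D : set (R * R))
    (u : R * R -> R[i]) (x : R * R) (z : R[i]) : Prop :=
  complex.Re (truncated K D u x e) @[e --> 0^'+] --> complex.Re z /\
  complex.Im (truncated K D u x e) @[e --> 0^'+] --> complex.Im z.

(* "A is the bounded operator on L2(D) given by A u(x) = p.v. int_D K(x-y)u(y)dy":
   this determines A u up to a null set. *)
Definition pv_operator (K : R * R -> R) (D : set (R * R))
    (A : (R * R -> R[i]) -> (R * R -> R[i])) : Prop :=
  bounded_operator D A /\
  forall u, L2 D u -> {ae leb2, forall x, D x -> is_pv K D u x (A u x)}.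

Definition Q : set (R * R) := `[- pi, pi] `*` `[- pi, pi].

Definition expi (t : R) : R[i] := cos t +i* sin t.

Definition symbol_sum (K : R * R -> R) (S : {fset int * int}) (t : R * R)
    : R[i] :=
  \sum_(m <- S | m != 0)
    (K (m.1%:~R, m.2%:~R))%:C * expi (m.1%:~R * t.1 + m.2%:~R * t.2).

(* The series over the unordered index set is summed along finite subsets. *)
Definition numerical_symbol (K : R * R -> R) (F : R * R -> R) : Prop :=
  [/\ forall e : R, 0 < e -> exists S0 : {fset int * int},
        forall S : {fset int * int}, (S0 `<=` S)%fset ->
          (sqnorm2 Q (fun t => (symbol_sum K S t - (F t)%:C)%R) < e%:E)%E,
      {within Q `\ (0 : R * R), continuous F}
    & F 0 = 0].

Definition Cinterval (L : R) : set R[i] := [set t%:C | t in `[- L, L]].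

Definition Cdist (z : R[i]) (A : set R[i]) : R :=
  inf [set normc (z - w) | w in A].

Definition gridpt (a : R * R) (N : nat) (m : int * int) : R * R :=
  (a.1 + m.1%:~R / N%:R, a.2 + m.2%:~R / N%:R).

(* [fset_set] is the given set when that set is finite (as it is for bounded
   Omega and N > 0), and is empty otherwise. *)
Definition omega (Omega : set (R * R)) (a : R * R) (N : nat)
    : {fset int * int} :=
  fset_set [set m | Omega (gridpt a N m)].

Definition Tmx (K : R * R -> R) (Omega : set (R * R)) (a : R * R) (N : nat)
    : 'M[R[i]]_#|{: omega Omega a N}| :=
  \matrix_(i, j) if i == j then 0 else
    (N%:R ^- 2 * K (gridpt a N (val (enum_val i)) -
                    gridpt a N (val (enum_val j))))%:C.

Definition l2norm n (v : 'cV[R[i]]_n) : R :=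
  Num.sqrt (\sum_i normc (v i 0) ^+ 2).

Definition opnorm n (M : 'M[R[i]]_n) : R :=
  sup [set l2norm (M *m v) | v in [set v : 'cV[R[i]]_n | l2norm v <= 1]].

Definition stable (K : R * R -> R) (Omega : set (R * R)) (a : nat -> R * R)
    (lam : R[i]) : Prop :=
  exists C : R, forall N, (0 < N)%N -> omega Omega (a N) N != fset0 ->
    let M := lam%:M - Tmx K Omega (a N) N in
    M \in unitmx /\ opnorm (invmx M) <= C.

End Plane.

(* Main.v *)
(** The values of [K] on the lattice are the Fourier coefficients of the real
    symbol [F], so by Parseval the quadratic form of the Hermitian matrix [T^N]
    is the mean of [F |u^|^2] over the torus and its Rayleigh quotients [rho] lie
    in [[-Lam, Lam]]; then [|(lam - T^N) u| >= |lam - rho| |u|].  Conversely let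
    [lam = F(tau)].  Since [Omega] is open, [omega^N] contains large square
    blocks for a suitable [N]; the plane wave of frequency [tau] on an [L x L]
    block has norm [L], while [(lam - T^N)] maps it to a vector of norm [o(L)],
    because [F] is close to [lam] where its Fourier transform, a product of
    Dirichlet kernels, concentrates.

    For the operator, [|A_Omega| <= 1/2] is proved without Fourier transforms.
    With [chi t = 1 - (1 + t) exp (- t)] and the Gaussian
    [G x = (M / pi) exp (- M |x|^2)], the kernel
    [K(x) chi(M |x|^2) + G(x) / 2
      = (2 pi)^-1 int_0^M (1 - 2 s x_1^2) exp (- s |x|^2) ds]
    is positive semidefinite, being a mixture of second derivatives of
    Gaussians.  Exchanging the coordinates changes the sign of [K], so
    [- K chi + G / 2] is positive semidefinite as well, and as [G] has mass 1 the
    smoothed operator has norm at most [1/2].  Its kernel is an average over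
    [r] of the truncations of [K] to [|x| > r], so it converges almost everywhere
    to the principal value as [M] grows, and Fatou's lemma transfers the bound.
    A Neumann series then inverts [lam - A_Omega] when [|lam| > 1/2]. *)
From HB Require Import structures.
Require Import Defs.
From mathcomp Require Import all_boot all_order all_algebra finmap.
From mathcomp Require Import all_classical all_reals all_analysis.
From mathcomp Require Import measurable_realfun ring lra zify.
Import Order.TTheory GRing.Theory Num.Theory.
Import numFieldNormedType.Exports.
Local Open Scope classical_set_scope.
Local Open Scope ring_scope.
Set Implicit Arguments.
Unset Strict Implicit.
Unset Printing Implicit Defensive.

(** The constant 1/2 comes from a distributional identity: [K] plus half the Dirac mass is
    [d_1^2 Delta^-1], whose multiplier [xi_1^2 / |xi|^2] lies in [0, 1], and [- K] plus half the
    Dirac mass is [d_2^2 Delta^-1]. The integral over [s] is the second derivative of the heat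
    representation of the logarithmic potential. Stopping it at [s = M] removes the small scales,
    turns the Dirac mass into a Gaussian and leaves bounded kernels, whose positivity is visible
    from sums of squares.

    On the matrix side, [K] is homogeneous of degree -2, so the factor [N^-2] cancels the mesh
    width: [T^N] is a section of one fixed Toeplitz matrix, and [N] and the origin enter only
    through the index set. This is why the resolvent bound is uniform in [N] and why instability
    asks only for large blocks in [omega^N]. The symbol is continuous off the origin, where its
    value is 0, so the plane waves are centred at points with [F] nonzero; [|lam| > 1/2] guarantees
    this. For such [lam] in the range of [F] the scheme fails because that range extends beyond the
    range [-1/2, 1/2] of the multiplier of [K]. *)

(* A separate name: for [\x] itself the sigma-finite structure found by unification
   is the one of products of subprobabilities. *)
Definition pmeas d1 d2 (T1 : measurableType d1) (T2 : measurableType d2)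
    (R : realType) (m1 : {sigma_finite_measure set T1 -> \bar R})
    (m2 : {sigma_finite_measure set T2 -> \bar R}) : set (T1 * T2) -> \bar R :=
  (m1 \x m2)%E.

Section PMeas.
Context d1 d2 (T1 : measurableType d1) (T2 : measurableType d2) (R : realType).
Variable m1 : {sigma_finite_measure set T1 -> \bar R}.
Variable m2 : {sigma_finite_measure set T2 -> \bar R}.

HB.instance Definition _ := Measure.on (pmeas m1 m2).

Let pmeas_sigma_finite : sigma_finite setT (pmeas m1 m2).
Proof.
have /sigma_finiteP[F [TF ndF Foo]] := sigma_finiteT m1.
have /sigma_finiteP[G [TG ndG Goo]] := sigma_finiteT m2.
exists (fun n => F n `*` G n).
  apply/esym/seteqP; split => // -[x y] _.
  have [n _ Fnx] : (\bigcup_i F i) x by rewrite -TF.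
  have [k _ Gky] : (\bigcup_i G i) y by rewrite -TG.
  exists (maxn n k) => //; split.
  - by move: x Fnx; exact/subsetPset/ndF/leq_maxl.
  - by move: y Gky; exact/subsetPset/ndG/leq_maxr.
move=> k; have [? ?] := Foo k; have [? ?] := Goo k.
split; first exact: measurableX.
by rewrite /pmeas product_measure1E// lte_mul_pinfty// ge0_fin_numE.
Qed.

HB.instance Definition _ :=
  Measure_isSigmaFinite.Build _ _ _ (pmeas m1 m2) pmeas_sigma_finite.
End PMeas.

Section PlaneMeasure.
Variable R : realType.
Definition mu1 : {sigma_finite_measure set (measurableTypeR R) -> \bar R} :=
  @lebesgue_measure R.
(** The measure [leb2] equipped with a sigma-finite structure. The two are convertible, and later
    proofs pass silently from one to the other. *)
Definition mu2 : {sigma_finite_measure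
    set (measurableTypeR R * measurableTypeR R)%type -> \bar R} := pmeas mu1 mu1.
End PlaneMeasure.

Ltac meas :=
  repeat match goal with
  | |- measurable_fun _ (fun x => ?c) => exact: measurable_cst
  | |- measurable_fun _ (fun x => x) => exact: measurable_id
  | |- measurable_fun _ (fun x => @?f x + @?g x) =>
      apply: (@measurable_funD _ _ _ _ f g)
  | |- measurable_fun _ (fun x => @?f x * @?g x) =>
      apply: (@measurable_funM _ _ _ _ f g)
  | |- measurable_fun _ (fun x => - @?f x) =>
      apply: (@measurable_funN _ _ _ _ f)
  | |- measurable_fun _ (fun x => @?f x ^+ ?n) =>
      apply: (@measurable_funX _ _ _ _ f n)
  | |- measurable_fun _ (fun x => expR (@?f x)) =>
      apply: (measurableT_comp (@measurable_expR _) (g := f))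
  | |- measurable_fun _ (fun x => ln (@?f x)) =>
      apply: (measurableT_comp (@measurable_ln _) (g := f))
  | |- measurable_fun _ (fun x => `| @?f x |) =>
      apply: (measurableT_comp (@normr_measurable _ setT) (g := f))
  | |- measurable_fun _ (fun x => fst (@?f x)) =>
      apply: (measurableT_comp measurable_fst (g := f))
  | |- measurable_fun _ (fun x => snd (@?f x)) =>
      apply: (measurableT_comp measurable_snd (g := f))
  | |- measurable_fun _ (fun x => (@?f x, @?g x)) =>
      apply: (@measurable_fun_pair _ _ _ _ _ _ f g)
  | |- measurable_fun _ fst => exact: measurable_fst
  | |- measurable_fun _ snd => exact: measurable_snd
  end.

(** * Real-valued integration and Fubini's theorem *)

Notation intg mu f := (integrable mu setT (EFin \o f)).

Section Integrable.
Context d (T : measurableType d) (R : realType).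
Variable mu : {measure set T -> \bar R}.
Implicit Types f g h : T -> R.

Lemma intg_meas f : intg mu f -> measurable_fun setT f.
Proof. by move=> /measurable_int /measurable_EFinP. Qed.

Lemma intg_le f g : measurable_fun setT f -> (forall x, `|f x| <= g x) ->
  intg mu g -> intg mu f.
Proof.
move=> mf fg; apply: le_integrable => //; first exact/measurable_EFinP.
by move=> x _ /=; rewrite lee_fin (le_trans (fg x)) ?ler_norm.
Qed.

Lemma intgD f g : intg mu f -> intg mu g -> intg mu (fun x => f x + g x).
Proof. by move=> mf mg; have := integrableD measurableT mf mg. Qed.

Lemma intgZ c f : intg mu f -> intg mu (fun x => c * f x).
Proof. by move=> mf; have := integrableZl measurableT c mf. Qed.

Lemma intgZr c f : intg mu f -> intg mu (fun x => f x * c).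
Proof. by move=> mf; have := integrableZr measurableT c mf. Qed.

Lemma intgN f : intg mu f -> intg mu (fun x => - f x).
Proof. by move=> /(intgZ (-1)); under eq_fun do rewrite mulN1r. Qed.

Lemma intgB f g : intg mu f -> intg mu g -> intg mu (fun x => f x - g x).
Proof. by move=> mf /intgN; exact: intgD. Qed.

Lemma intg_norm f : intg mu f -> intg mu (fun x => `|f x|).
Proof. by move=> /integrable_norm. Qed.

Lemma intg_bounded_mul (b f : T -> R) (c : R) : measurable_fun setT b ->
  (forall x, `|b x| <= c) -> intg mu f -> intg mu (fun x => b x * f x).
Proof.
move=> mb bc fi; apply: (@intg_le _ (fun x => c * `|f x|)).
- exact: measurable_funM mb (intg_meas fi).
- by move=> x; rewrite normrM ler_wpM2r.
- exact/intgZ/intg_norm.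
Qed.

Lemma intg0 : intg mu (fun=> 0).
Proof. exact: integrable0. Qed.

Lemma intg_sum (I : Type) (s : seq I) (f : I -> T -> R) :
  (forall i, intg mu (f i)) -> intg mu (fun x => \sum_(i <- s) f i x).
Proof.
move=> fi; elim: s => [|i s IH].
  by under eq_fun do rewrite big_nil; exact: intg0.
by under eq_fun do rewrite big_cons; exact: intgD.
Qed.

Lemma Rint_sum (I : Type) (s : seq I) (f : I -> T -> R) :
  (forall i, intg mu (f i)) ->
  \int[mu]_x (\sum_(i <- s) f i x) = \sum_(i <- s) \int[mu]_x f i x.
Proof.
move=> fi; elim: s => [|i s IH].
  rewrite big_nil /Rintegral.
  by under eq_integral do rewrite big_nil; rewrite integral0.
rewrite big_cons -IH -RintegralD//; last exact: intg_sum.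
by apply: eq_Rintegral => x _; rewrite big_cons.
Qed.

Lemma Rint_fin f : intg mu f -> (\int[mu]_x (f x)%:E)%E = (\int[mu]_x f x)%:E.
Proof. by move=> fi; rewrite /Rintegral fineK//; exact: integrable_fin_num. Qed.

Lemma intg_ge0 f : measurable_fun setT f -> (forall x, 0 <= f x) ->
  (\int[mu]_x (f x)%:E < +oo)%E -> intg mu f.
Proof.
move=> mf f0 fi; apply/integrableP; split; first exact/measurable_EFinP.
by under eq_integral do rewrite /= ger0_norm//.
Qed.

Lemma Rint_dominated (f_ : nat -> T -> R) f g :
  (forall n, measurable_fun setT (f_ n)) ->
  (forall x, f_ n x @[n --> \oo] --> f x) ->
  (forall n x, `|f_ n x| <= g x) -> intg mu g ->
  intg mu f /\ \int[mu]_x f_ n x @[n --> \oo] --> \int[mu]_x f x.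
Proof.
move=> mf_ f_f f_g gi.
have mf : measurable_fun setT f.
  by apply: measurable_fun_cvg mf_ _ => x _; exact: f_f.
have [|||||fi _ cv] := @dominated_convergence _ T R mu setT measurableT
   (fun n => EFin \o f_ n) (EFin \o f) (EFin \o g).
- by move=> n; exact/measurable_EFinP.
- exact/measurable_EFinP.
- by apply: aeW => x _; apply: cvg_EFin; [exact: nearW|exact: f_f].
- exact: gi.
- by apply: aeW => x n _ /=; rewrite lee_fin.
split=> //; apply: fine_cvg; rewrite /Rintegral fineK; first exact: cv.
exact: integrable_fin_num.
Qed.

Lemma Rint_indic (D : set T) f :
  \int[mu]_(x in D) f x = \int[mu]_x (\1_D x * f x).
Proof.
rewrite Rintegral_mkcond; apply: eq_Rintegral => x _.
by rewrite patch_indic/= mulrC.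
Qed.

Lemma intg_indicM (D : set T) f : measurable D -> intg mu f ->
  intg mu (fun x => \1_D x * f x).
Proof.
move=> mD fi; apply: (@intg_bounded_mul _ _ 1) => //.
by move=> x; rewrite indicE; case: (_ \in _); rewrite ?normr1 ?normr0.
Qed.

End Integrable.

Section FubiniR.
Context d1 d2 (T1 : measurableType d1) (T2 : measurableType d2) (R : realType).
Variable m1 : {sigma_finite_measure set T1 -> \bar R}.
Variable m2 : {sigma_finite_measure set T2 -> \bar R}.
Implicit Types F : T1 * T2 -> R.

Lemma Rint_fubini1 F : intg (pmeas m1 m2) F ->
  \int[pmeas m1 m2]_z F z = \int[m1]_x \int[m2]_y F (x, y).
Proof.
move=> Fi.
have := integral12_prod_meas1 Fi; rewrite {1}/Rintegral => <-.
have mF := measurable_fubini_F Fi.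
congr fine; apply: ae_eq_integral => //.
  by apply/measurable_EFinP; exact: measurableT_comp.
(* Sections of [F] are integrable only for almost every [x], so the extended inner integral agrees
   with the real one up to a null set. *)
apply: filterS (ae_integrable1 Fi) => x xi _.
exact: (Rint_fin (f := fun y => F (x, y))).
Qed.

Lemma Rint_fubini2 F : intg (pmeas m1 m2) F ->
  \int[pmeas m1 m2]_z F z = \int[m2]_y \int[m1]_x F (x, y).
Proof.
move=> Fi.
have := integral21_prod_meas1 Fi; rewrite {1}/Rintegral => <-.
have mF := measurable_fubini_G Fi.
congr fine; apply: ae_eq_integral => //.
  by apply/measurable_EFinP; exact: measurableT_comp.
apply: filterS (ae_integrable2 Fi) => x xi _.
exact: (Rint_fin (f := fun y => F (y, x))).
Qed.

Lemma intg_fubini1 F : intg (pmeas m1 m2) F ->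
  (forall x, intg m2 (fun y => F (x, y))) ->
  intg m1 (fun x => \int[m2]_y F (x, y)).
Proof.
move=> Fi Fx; have := integrable_fubini_F Fi.
rewrite (_ : fubini_F m2 (EFin \o F) = EFin \o (fun x => \int[m2]_y F (x, y)))//.
by apply/funext => x; exact: (Rint_fin (f := fun y => F (x, y))).
Qed.

Lemma intg_prod (f : T1 -> R) (g : T2 -> R) : intg m1 f -> intg m2 g ->
  intg (pmeas m1 m2) (fun z => f z.1 * g z.2).
Proof.
move=> fi gi.
have mf := intg_meas fi; have mg := intg_meas gi.
have mF : measurable_fun setT (fun z : T1 * T2 => f z.1 * g z.2).
  by apply: measurable_funM; apply: measurableT_comp.
apply/integrable12ltyP; first exact/measurable_EFinP.
rewrite (_ : (\int[m1]_x _)%E =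
  (\int[m1]_x (`|f x| * \int[m2]_y `|g y|)%:E)%E); last first.
  apply: eq_integral => x _.
  rewrite -RintegralZl//; last exact: intg_norm.
  rewrite -Rint_fin; last exact/intgZ/intg_norm.
  by apply: eq_integral => y _; rewrite /= normrM.
by rewrite Rint_fin ?ltry//; exact/intgZr/intg_norm.
Qed.

Lemma Rint_prod (f : T1 -> R) (g : T2 -> R) : intg m1 f -> intg m2 g ->
  \int[pmeas m1 m2]_z (f z.1 * g z.2) = \int[m1]_x f x * \int[m2]_y g y.
Proof.
move=> fi gi; rewrite Rint_fubini1; last exact: intg_prod.
rewrite -RintegralZr//; apply: eq_Rintegral => x _.
by rewrite -RintegralZl.
Qed.

End FubiniR.

(** * Positive semidefinite kernels *)

Section Psd.
Context d (X : measurableType d) (R : realType).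
Variable mu : {sigma_finite_measure set X -> \bar R}.
Implicit Types (k : X * X -> R) (f g : X -> R).

Definition kform k f g : R := \int[pmeas mu mu]_z (k z * (f z.1 * g z.2)).

Lemma kform_intg k (B : R) f g : measurable_fun setT k ->
  (forall z, `|k z| <= B) -> intg mu f -> intg mu g ->
  intg (pmeas mu mu) (fun z => k z * (f z.1 * g z.2)).
Proof.
by move=> mk kB fi gi; apply: intg_bounded_mul mk kB _; exact: intg_prod.
Qed.

(** The finite-rank case of Mercer's representation: the form becomes a sum of squares, which is the
    only source of positivity in the development. *)
Lemma kform_features (I : Type) (s : seq I) (phi : I -> X -> R) (B : R) f :
  (forall i, measurable_fun setT (phi i)) -> (forall i x, `|phi i x| <= B) ->
  intg mu f ->
  kform (fun z => \sum_(i <- s) phi i z.1 * phi i z.2) f f =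
    \sum_(i <- s) (\int[mu]_x (phi i x * f x)) ^+ 2.
Proof.
move=> mphi phiB fi.
have phif i : intg mu (fun x => phi i x * f x) by exact: intg_bounded_mul.
rewrite /kform (_ : \int[_]_z _ = \int[pmeas mu mu]_z
   \sum_(i <- s) ((phi i z.1 * f z.1) * (phi i z.2 * f z.2))); last first.
  apply: eq_Rintegral => z _; rewrite mulr_suml; apply: eq_bigr => i _; ring.
rewrite Rint_sum; last by move=> i; exact: (intg_prod (phif i) (phif i)).
by apply: eq_bigr => i _; rewrite (Rint_prod (phif i) (phif i)).
Qed.

Lemma kform_limit_ge0 (k_ : nat -> X * X -> R) k (B : R) f :
  (forall n, measurable_fun setT (k_ n)) -> (forall n z, `|k_ n z| <= B) ->
  (forall z, k_ n z @[n --> \oo] --> k z) -> intg mu f ->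
  (forall n, 0 <= kform (k_ n) f f) -> 0 <= kform k f f.
Proof.
move=> mk kB kk fi k0.
have [|||| _ cv] := @Rint_dominated _ _ _ (pmeas mu mu)
  (fun n z => k_ n z * (f z.1 * f z.2)) (fun z => k z * (f z.1 * f z.2))
  (fun z => B * `|f z.1 * f z.2|).
- by move=> n; exact: intg_meas (@kform_intg (k_ n) B f f (mk n) (kB n) fi fi).
- by move=> z; apply: cvgM; [exact: kk|exact: cvg_cst].
- by move=> n z; rewrite normrM ler_wpM2r.
- by apply/intgZ/intg_norm; exact: intg_prod.
rewrite /kform -(cvg_lim (@Rhausdorff R) cv).
by apply: limr_ge; [apply/cvg_ex; eexists; exact: cv | exact: nearW].
Qed.

(* The diagonal bound makes the partial sums uniformly bounded off the
   diagonal, by Cauchy-Schwarz. *)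
Lemma kform_psd (I : Type) (s_ : nat -> seq I) (phi : I -> X -> R) (B : R) k f :
  (forall i, measurable_fun setT (phi i)) ->
  (forall i x, phi i x ^+ 2 <= B) ->
  (forall n x, \sum_(i <- s_ n) phi i x ^+ 2 <= B) ->
  (forall z, \sum_(i <- s_ n) phi i z.1 * phi i z.2 @[n --> \oo] --> k z) ->
  intg mu f -> 0 <= kform k f f.
Proof.
move=> mphi phiB sB kk fi.
apply: (kform_limit_ge0 _ _ kk fi (B := B)) => [n|n z|n].
- by apply: measurable_sum => i; apply: measurable_funM;
    apply: measurableT_comp.
- apply: (@le_trans _ _
    (\sum_(i <- s_ n) (phi i z.1 ^+ 2 + phi i z.2 ^+ 2) / 2)).
    apply: le_trans (ler_norm_sum _ _ _) _; apply: ler_sum => i _.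
    rewrite normrM -(real_normK (num_real (phi i z.1))).
    rewrite -(real_normK (num_real (phi i z.2))).
    have := sqr_ge0 (`|phi i z.1| - `|phi i z.2|); nra.
  rewrite -mulr_suml big_split/=.
  by have := sB n z.1; have := sB n z.2; lra.
- rewrite (@kform_features _ _ _ (1 + B))//; last first.
    move=> i x; have := phiB i x; rewrite -(real_normK (num_real (phi i x))).
    by have := normr_ge0 (phi i x); have := sqr_ge0 (`|phi i x| - 1); nra.
  by apply: sumr_ge0 => i _; exact: sqr_ge0.
Qed.

Context d' (S : measurableType d').
Variable nu : {sigma_finite_measure set S -> \bar R}.

(** Domination by [b z.1], uniform in [y], makes every inner integral finite. The weight [h] is
    general because the lemma serves twice: for the positivity of mixtures, and for writing the
    smoothed operator as an average of truncations. *)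
Lemma Rint_mixture d2 (Y : measurableType d2)
    (m : {sigma_finite_measure set Y -> \bar R})
    (k : S * Y -> R) (b : S -> R) (h : Y -> R) :
  measurable_fun setT k -> (forall z, `|k z| <= b z.1) ->
  intg nu b -> intg m h ->
  \int[m]_y ((\int[nu]_s k (s, y)) * h y) =
  \int[nu]_s \int[m]_y (k (s, y) * h y).
Proof.
move=> mk kb bi hi.
have ki : intg (pmeas nu m) (fun z => k z * h z.2).
  apply: (@intg_le _ _ _ _ _ (fun z => b z.1 * `|h z.2|)).
  - by apply: measurable_funM => //; apply: measurableT_comp => //;
      exact: intg_meas hi.
  - by move=> z; rewrite normrM ler_wpM2r.
  - exact: (intg_prod bi (intg_norm hi)).
rewrite -(Rint_fubini1 ki) (Rint_fubini2 ki).
apply: eq_Rintegral => y _; rewrite -RintegralZr//.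
apply: (@intg_le _ _ _ nu (fun s => k (s, y)) b) bi.
- by apply: measurableT_comp => //; exact: measurable_pair2.
- by move=> s; exact: kb (s, y).
Qed.

Lemma kform_mixture_ge0 (k : S * (X * X) -> R) (b : S -> R) f :
  measurable_fun setT k -> (forall z, `|k z| <= b z.1) ->
  intg nu b -> intg mu f ->
  (forall s, 0 <= kform (fun z => k (s, z)) f f) ->
  0 <= kform (fun z => \int[nu]_s k (s, z)) f f.
Proof.
move=> mk kb bi fi k0.
rewrite /kform (Rint_mixture mk kb bi (intg_prod fi fi)).
by apply: Rintegral_ge0 => s _; exact: k0.
Qed.

End Psd.

(** * Feature expansions of Gaussian kernels *)

Section GaussianFeatures.
Variable R : realType.
Implicit Types (s t a b : R).

Definition exp_part (N : nat) t : R := \sum_(0 <= i < N) t ^+ i / i`!%:R.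

Lemma cvg_exp_part t : exp_part N t @[N --> \oo] --> expR t.
Proof. by have := is_cvg_series_exp_coeff t; rewrite /exp_part. Qed.

(** The feature map of the Gaussian kernel: in [exp (- s (a - b)^2) = exp (- s a^2) exp (- s b^2)
    exp (2 s a b)] the last factor is expanded in its Taylor series. *)
Definition gfeat s (n : nat) a : R :=
  Num.sqrt ((2 * s) ^+ n / n`!%:R) * (a ^+ n * expR (- (s * a ^+ 2))).

(* Up to the factor [sqrt (2 s)], the derivative of [gfeat s n]. *)
Definition dgfeat s (n : nat) a : R :=
  if n is m.+1 then
    Num.sqrt ((2 * s) ^+ m / m.+1`!%:R) *
      ((m.+1%:R * a ^+ m - 2 * s * a ^+ m.+2) * expR (- (s * a ^+ 2)))
  else Num.sqrt (2 * s) * (a * expR (- (s * a ^+ 2))).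

Lemma sum_gfeat s (N : nat) a b : 0 <= s ->
  \sum_(i <- iota 0 N) gfeat s i a * gfeat s i b =
  expR (- (s * a ^+ 2)) * expR (- (s * b ^+ 2)) * exp_part N (2 * s * a * b).
Proof.
move=> s0; rewrite /exp_part mulr_sumr /index_iota subn0.
apply: eq_bigr => i _; rewrite /gfeat.
have c0 : 0 <= (2 * s) ^+ i / i`!%:R.
  by rewrite divr_ge0// exprn_ge0// mulr_ge0.
rewrite mulrACA -expr2 sqr_sqrtr// !exprMn.
move: (expR _) (expR _) (i`!%:R^-1) => x y z.
by move: (a ^+ i) (b ^+ i) (2 ^+ i) (s ^+ i) => p q u v; ring.
Qed.

(** Expanding [(m + 1 - 2 s a^2) (m + 1 - 2 s b^2)] against [t^m / (m + 1)!] and cancelling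
    factorials splits the sum into exponential series of the three lengths [N], [N + 1] and [N + 2];
    the feature of index 0 supplies the term [m = -1]. An exact formula for the partial sums makes
    the limit immediate. *)
Lemma sum_dgfeat s (N : nat) a b : 0 <= s -> let t := 2 * s * a * b in
  \sum_(i <- iota 0 N.+2) dgfeat s i a * dgfeat s i b =
  expR (- (s * a ^+ 2)) * expR (- (s * b ^+ 2)) *
  (exp_part N.+1 t * (1 - 2 * s * (a ^+ 2 + b ^+ 2)) +
   t * exp_part N t + t * exp_part N.+2 t).
Proof.
move=> s0 t; set E := expR _ * expR _.
have step m : dgfeat s m.+1 a * dgfeat s m.+1 b =
  E * (t ^+ m / m.+1`!%:R * (m.+1%:R - 2 * s * a ^+ 2) *
                        (m.+1%:R - 2 * s * b ^+ 2)).
  have c0 : 0 <= (2 * s) ^+ m / m.+1`!%:R.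
    by rewrite divr_ge0// exprn_ge0// mulr_ge0.
  rewrite /dgfeat mulrACA -expr2 sqr_sqrtr// /t /E.
  move: (expR _) (expR _) (m.+1`!%:R^-1) (m.+1%:R) => x y z w.
  rewrite !exprS !exprMn.
  by move: (a ^+ m) (b ^+ m) (2 ^+ m) (s ^+ m) => p q u v; ring.
elim: N => [|N IH].
  rewrite /exp_part !big_nat_recr//= !big_geq//= !big_cons big_nil step.
  rewrite {1 2}/dgfeat mulrACA -expr2 sqr_sqrtr ?mulr_ge0//.
  rewrite !fact0 /E /t !factS !fact0 !muln1.
  move: (expR _) (expR _) => x y.
  by rewrite !expr0 !divr1 expr1; field.
rewrite -[in iota _ _]addn1 iotaD big_cat/= IH add0n big_cons big_nil step addr0 -mulrDr.
congr (E * _).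
rewrite /exp_part ![in RHS]big_nat_recr//= ![in LHS]big_nat_recr//=.
move: (\sum_(0 <= i < N) _) => e.
have f0 (n : nat) : n`!%:R != 0 :> R by rewrite pnatr_eq0 -lt0n fact_gt0.
have F0 := f0 N; rewrite !factS !natrM !exprS.
have n1 (n : nat) : n.+1%:R = n%:R + 1 :> R by rewrite -natr1.
have m1 (n : nat) : n%:R + 1 != 0 :> R by rewrite natr1 pnatr_eq0.
have := m1 N; have := m1 N.+1; have := m1 N.+2; rewrite !n1.
have : t = 2 * s * a * b by [].
move: (t) (t ^+ N) (N`!%:R) (N%:R) F0 => T p q n q0 -> n3 n2 n1'.
by field; rewrite ?q0 ?n2 ?n1'.
Qed.

Lemma cvg_sum_gfeat s a b : 0 <= s ->
  \sum_(i <- iota 0 N) gfeat s i a * gfeat s i b @[N --> \oo] -->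
  expR (- (s * (a - b) ^+ 2)).
Proof.
move=> s0; under eq_fun do rewrite sum_gfeat//.
rewrite (_ : expR _ = expR (- (s * a ^+ 2)) * expR (- (s * b ^+ 2)) *
                      expR (2 * s * a * b)); last first.
  by rewrite -!expRD; congr expR; ring.
by apply: cvgM; [exact: cvg_cst|exact: cvg_exp_part].
Qed.

Lemma cvg_sum_dgfeat s a b : 0 <= s ->
  \sum_(i <- iota 0 N) dgfeat s i a * dgfeat s i b @[N --> \oo] -->
  (1 - 2 * s * (a - b) ^+ 2) * expR (- (s * (a - b) ^+ 2)).
Proof.
move=> s0; rewrite -(cvg_shiftn 2).
under eq_fun do rewrite addn2 sum_dgfeat//.
rewrite (_ : (1 - 2 * s * (a - b) ^+ 2) * expR _ =
    expR (- (s * a ^+ 2)) * expR (- (s * b ^+ 2)) *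
    (expR (2 * s * a * b) * (1 - 2 * s * (a ^+ 2 + b ^+ 2)) +
     2 * s * a * b * expR (2 * s * a * b) +
     2 * s * a * b * expR (2 * s * a * b))); last first.
  rewrite (_ : expR (- (s * (a - b) ^+ 2)) = expR (- (s * a ^+ 2)) *
    expR (- (s * b ^+ 2)) * expR (2 * s * a * b)); last first.
    by rewrite -!expRD; congr expR; ring.
  by move: (expR _) (expR _) (expR _) => x y z; ring.
have e1 := @cvg_exp_part (2 * s * a * b).
have e2 : exp_part N.+1 (2 * s * a * b) @[N --> \oo] --> expR (2 * s * a * b).
  by have := e1; rewrite -(cvg_shiftn 1); under eq_fun do rewrite addn1.
have e3 : exp_part N.+2 (2 * s * a * b) @[N --> \oo] --> expR (2 * s * a * b).
  by have := e1; rewrite -(cvg_shiftn 2); under eq_fun do rewrite addn2.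
apply: cvgM; first exact: cvg_cst.
by apply: cvgD; [apply: cvgD|]; apply: cvgM => //; exact: cvg_cst.
Qed.

Lemma sum_sqr_le_cvg (u : nat -> R) (l : R) (N : nat) :
  \sum_(i <- iota 0 N) u i * u i @[N --> \oo] --> l ->
  \sum_(i <- iota 0 N) u i ^+ 2 <= l.
Proof.
move=> ul; rewrite -(cvg_lim (@Rhausdorff R) ul).
under eq_bigr do rewrite expr2.
apply: (@nondecreasing_cvgn_le _ (fun N => \sum_(i <- iota 0 N) u i * u i)).
  apply/nondecreasing_seqP => n.
  by rewrite -addn1 iotaD big_cat/= lerDl big_seq1 -expr2 sqr_ge0.
by apply/cvg_ex; exists l.
Qed.

Lemma sum_gfeat_le1 s a N : 0 <= s ->
  \sum_(i <- iota 0 N) gfeat s i a ^+ 2 <= 1.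
Proof.
move=> s0; apply: sum_sqr_le_cvg; have := @cvg_sum_gfeat s a a s0.
by rewrite subrr expr0n/= mulr0 oppr0 expR0.
Qed.

Lemma sum_dgfeat_le1 s a N : 0 <= s ->
  \sum_(i <- iota 0 N) dgfeat s i a ^+ 2 <= 1.
Proof.
move=> s0; apply: sum_sqr_le_cvg; have := @cvg_sum_dgfeat s a a s0.
by rewrite subrr expr0n/= !mulr0 oppr0 expR0 addr0 mulr1.
Qed.

Lemma le_sum_iota (u : nat -> R) i : (forall j, 0 <= u j) ->
  u i <= \sum_(j <- iota 0 i.+1) u j.
Proof.
move=> u0; rewrite -addn1 iotaD big_cat/= big_seq1 add0n lerDr.
exact: sumr_ge0.
Qed.

Lemma measurable_gfeat s i : measurable_fun setT (gfeat s i).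
Proof. by rewrite /gfeat; meas. Qed.

Lemma measurable_dgfeat s i : measurable_fun setT (dgfeat s i).
Proof. by case: i => [|i]; rewrite /dgfeat; meas. Qed.

End GaussianFeatures.

Section HatKernel.
Variable R : realType.

(* [-1 / (2 s)] times the second [a]-derivative of [exp (- s (a^2 + b^2))]. *)
Definition hat (s a b : R) : R :=
  (1 - 2 * s * a ^+ 2) * expR (- (s * a ^+ 2)) * expR (- (s * b ^+ 2)).

(** The kernel factors over the two coordinates, and products of features are features of the
    product. The coordinate maps [p] and [q] are left free so that they can later be exchanged. *)
Lemma hat_psd d (X : measurableType d)
    (mu : {sigma_finite_measure set X -> \bar R}) (p q f : X -> R) s :
  0 <= s -> measurable_fun setT p -> measurable_fun setT q -> intg mu f ->
  0 <= kform mu (fun z => hat s (p z.1 - p z.2) (q z.1 - q z.2)) f f.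
Proof.
move=> s0 mp mq fi.
pose phi (ij : nat * nat) (x : X) : R := dgfeat s ij.1 (p x) * gfeat s ij.2 (q x).
pose s_ n := [seq (i, j) | i <- iota 0 n, j <- iota 0 n].
have sumE n x y : \sum_(ij <- s_ n) phi ij x * phi ij y =
    (\sum_(i <- iota 0 n) dgfeat s i (p x) * dgfeat s i (p y)) *
    (\sum_(j <- iota 0 n) gfeat s j (q x) * gfeat s j (q y)).
  rewrite big_distrlr/= big_allpairs; apply: eq_bigr => i _.
  by apply: eq_bigr => j _; rewrite /phi/= mulrACA.
have s2E n x : \sum_(ij <- s_ n) phi ij x ^+ 2 =
    (\sum_(i <- iota 0 n) dgfeat s i (p x) ^+ 2) *
    (\sum_(j <- iota 0 n) gfeat s j (q x) ^+ 2).
  by under eq_bigr do rewrite expr2; rewrite sumE.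
have d1 i (a : R) : dgfeat s i a ^+ 2 <= 1.
  apply: le_trans (sum_dgfeat_le1 a i.+1 s0).
  exact: (@le_sum_iota _ (fun i => dgfeat s i a ^+ 2) i (fun i => sqr_ge0 _)).
have g1 i (a : R) : gfeat s i a ^+ 2 <= 1.
  apply: le_trans (sum_gfeat_le1 a i.+1 s0).
  exact: (@le_sum_iota _ (fun i => gfeat s i a ^+ 2) i (fun i => sqr_ge0 _)).
apply: (@kform_psd _ _ _ _ _ s_ phi 1) => //.
- by move=> [i j]; apply: measurable_funM;
    [apply: measurableT_comp (@measurable_dgfeat R s i) mp
    |apply: measurableT_comp (@measurable_gfeat R s j) mq].
- by move=> [i j] x; rewrite exprMn mulr_ile1 ?sqr_ge0.
- move=> n x; rewrite s2E mulr_ile1 ?sum_dgfeat_le1 ?sum_gfeat_le1//;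
    by apply: sumr_ge0 => i _; exact: sqr_ge0.
- move=> z; under eq_fun do rewrite sumE.
  by apply: cvgM; [exact: cvg_sum_dgfeat|exact: cvg_sum_gfeat].
Qed.

Lemma hat_le1 s a b : 0 <= s -> `|hat s a b| <= 1.
Proof.
move=> s0; rewrite /hat !normrM !(ger0_norm (expR_ge0 _)).
apply: mulr_ile1; rewrite ?mulr_ge0 ?expR_ge0//; last first.
  by rewrite -expR0 ler_expR oppr_le0 mulr_ge0 ?sqr_ge0.
rewrite expRN ler_pdivrMr ?expR_gt0// mul1r.
have v0 : 0 <= s * a ^+ 2 by rewrite mulr_ge0 ?sqr_ge0.
have e := expR_ge1Dx (s * a ^+ 2).
(* With [v = s a^2] the claim is [|1 - 2 v| <= exp v]. For large [v] the bound [1 + v <= exp v] is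
   too weak; its square at [v / 2] gives [2 v - 1 <= (1 + v / 2)^2 <= exp v]. *)
have e2 : 2 * (s * a ^+ 2) - 1 <= expR (s * a ^+ 2).
  have -> : expR (s * a ^+ 2) = expR (s * a ^+ 2 / 2) ^+ 2.
    by rewrite [RHS]expr2 -expRD; congr expR; field.
  have := expR_ge1Dx (s * a ^+ 2 / 2).
  by have := sqr_ge0 (s * a ^+ 2 / 2 - 1); nra.
by rewrite ler_norml; apply/andP; split; lra.
Qed.

End HatKernel.

(** * Explicit primitives and Gaussian integrals *)

Section FTC.
Variable R : realType.
Implicit Types (F f : R -> R) (a b : R).

Lemma is_derive1_continuous F f : (forall s, is_derive s (1 : R) F (f s)) ->
  continuous F.
Proof.
move=> dF s; apply: differentiable_continuous.
by apply/derivable1_diffP; apply: ex_derive.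
Qed.

Lemma Rint_derive F f a b : a < b -> (forall s, is_derive s (1 : R) F (f s)) ->
  continuous f -> \int[mu1 R]_(s in `[a, b]) f s = F b - F a.
Proof.
move=> ab dF cf; have cF := is_derive1_continuous dF.
rewrite /Rintegral (@continuous_FTC2 _ _ F)//.
- by apply: continuous_subspaceT.
- split.
  + by move=> x _; apply: ex_derive.
  + exact: cvg_at_right_filter (cF a).
  + exact: cvg_at_left_filter (cF b).
- by move=> x _; rewrite derive1E; apply: derive_val.
Qed.

Lemma Rint_derivey F f (l : R) : (forall s, is_derive s (1 : R) F (f s)) ->
  continuous f -> (forall s, 0 <= s -> 0 <= f s) -> F x @[x --> +oo] --> l ->
  (\int[mu1 R]_(s in `[0%R, +oo[) (f s)%:E)%E = (l - F 0)%:E.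
Proof.
move=> dF cf f0 Fl; have cF := is_derive1_continuous dF.
rewrite EFinB; apply: ge0_continuous_FTC2y => //.
- by apply: continuous_subspaceT.
- exact: cvg_at_right_filter (cF 0).
- by move=> x _; rewrite derive1E; apply: derive_val.
Qed.

Lemma is_derive_expR_comp F (x df : R) : is_derive x (1 : R) F df ->
  is_derive x (1 : R) (fun y => expR (F y)) (df * expR (F x)).
Proof.
move=> dF; have := @is_derive1_comp _ expR F x _ _ (is_derive_expR _) dF.
by rewrite /comp => h; apply: is_derive_eq; rewrite mulrC.
Qed.

Lemma is_derive_lin_exp (al be c s : R) :
  is_derive s (1 : R) (fun s => (al + be * s) * expR (- (s * c)))
    ((be - c * (al + be * s)) * expR (- (s * c))).
Proof.
have d1 : is_derive s (1 : R) (fun s => - (s * c)) (- c).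
  by apply: is_derive_eq; rewrite /GRing.scale/=; ring.
have d2 := is_derive_expR_comp d1.
have d3 : is_derive s (1 : R) (fun s => al + be * s) be.
  by apply: is_derive_eq; rewrite /GRing.scale/=; ring.
have := is_deriveM d3 d2 => d4; apply: is_derive_eq.
by rewrite /GRing.scale/=; ring.
Qed.

Lemma continuous_lin_exp (al be c : R) :
  continuous (fun s => (al + be * s) * expR (- (s * c))).
Proof. exact: is_derive1_continuous (is_derive_lin_exp al be c). Qed.

Lemma Rint_lin_exp (al be c M : R) : 0 < M ->
  \int[mu1 R]_(s in `[0, M]) ((be - c * (al + be * s)) * expR (- (s * c))) =
  (al + be * M) * expR (- (M * c)) - al.
Proof.
move=> M0; rewrite (Rint_derive M0 (is_derive_lin_exp al be c)).
  by rewrite mulr0 addr0 mul0r oppr0 expR0 mulr1.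
rewrite (_ : (fun s => _) =
  (fun s => (be - c * al + - c * be * s) * expR (- (s * c)))); first exact: continuous_lin_exp.
by apply/funext => s; congr (_ * _); ring.
Qed.

End FTC.

Section Gaussian.
Variable R : realType.
Local Notation plane := (measurableTypeR R * measurableTypeR R)%type.

Lemma Rint_gaussian (M a : R) : 0 < M ->
  intg (mu1 R) (fun y => expR (- (M * (a - y) ^+ 2))) /\
  \int[mu1 R]_y expR (- (M * (a - y) ^+ 2)) = Num.sqrt (pi / M).
Proof.
(* The standard deviation for which the normal density of mean [a] is proportional to
   [exp (- M (a - y)^2)]. *)
move=> M0; set s : R := Num.sqrt (2 * M)^-1.
have s2 : s ^+ 2 = (2 * M)^-1 by rewrite sqr_sqrtr// invr_ge0 mulr_ge0// ltW.
have s0 : s != 0 by rewrite sqrtr_eq0 -ltNge invr_gt0 mulr_gt0.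
have Epeak : normal_peak s = (Num.sqrt (pi / M))^-1.
  rewrite /normal_peak s2; congr (Num.sqrt _)^-1.
  by rewrite -mulr_natl; field; rewrite gt_eqF.
have E y : expR (- (M * (a - y) ^+ 2)) = Num.sqrt (pi / M) * normal_pdf a s y.
  rewrite normal_pdfE// Epeak mulVKf ?gt_eqF//; last first.
    by rewrite sqrtr_gt0 divr_gt0 ?pi_gt0.
  rewrite /normal_fun s2 -[_^-1 *+ 2]mulr_natl; congr expR.
  by field; rewrite gt_eqF.
split.
  apply: eq_integrable (integrableZl measurableT (Num.sqrt (pi / M))
    (integrable_normal_pdf a s)) => // y _.
  by rewrite /= E EFinM.
under eq_Rintegral do rewrite E.
rewrite RintegralZl//; last exact: integrable_normal_pdf.
by rewrite /Rintegral integral_normal_pdf/= mulr1.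
Qed.

Definition gauss2 M (x : plane) : R :=
  M / pi * expR (- (M * (x.1 ^+ 2 + x.2 ^+ 2))).

Lemma Rint_gauss2 M (x : plane) : 0 < M ->
  intg (mu2 R) (fun y => gauss2 M (x - y)) /\
  \int[mu2 R]_y gauss2 M (x - y) = 1.
Proof.
move=> M0; have [i1 e1] := Rint_gaussian x.1 M0.
have [i2 e2] := Rint_gaussian x.2 M0.
have E y : gauss2 M (x - y) = M / pi *
   (expR (- (M * (x.1 - y.1) ^+ 2)) * expR (- (M * (x.2 - y.2) ^+ 2))).
  by rewrite /gauss2 -expRD; congr (_ * expR _) => /=; ring.
have := intg_prod i1 i2; have := Rint_prod i1 i2 => e i.
split; first by under eq_fun do rewrite E; apply: intgZ i.
under eq_Rintegral do rewrite E.
rewrite RintegralZl//= [X in _ * X]e e1 e2 -expr2 sqr_sqrtr.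
  by rewrite mulrA divfK ?gt_eqF ?pi_gt0// divff ?gt_eqF.
by rewrite divr_ge0 ?pi_ge0 ?ltW.
Qed.

Lemma gauss2_ge0 M x : 0 <= M -> 0 <= gauss2 M x.
Proof. by move=> M0; rewrite mulr_ge0 ?expR_ge0 ?divr_ge0 ?pi_ge0. Qed.

Lemma gauss2_le M x : 0 <= M -> gauss2 M x <= M / pi.
Proof.
move=> M0; rewrite ler_piMr ?divr_ge0 ?pi_ge0// -expR0 ler_expR oppr_le0.
by rewrite mulr_ge0 ?addr_ge0 ?sqr_ge0.
Qed.

Lemma gauss2N M x : gauss2 M (- x) = gauss2 M x.
Proof. by rewrite /gauss2/= !sqrrN. Qed.

Lemma measurable_gauss2 M :
  measurable_fun setT (fun z : plane * plane => gauss2 M (z.1 - z.2)).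
Proof.
rewrite (_ : (fun _ => _) = (fun z : plane * plane => M / pi *
  expR (- (M * ((z.1.1 - z.2.1) ^+ 2 + (z.1.2 - z.2.2) ^+ 2)))))//.
by meas.
Qed.

End Gaussian.

(** * The smoothed operator *)

Section SmoothedKernel.
Variable R : realType.
Local Notation plane := (measurableTypeR R * measurableTypeR R)%type.
Local Notation leb := (mu1 R).

Definition cutoff (t : R) : R := 1 - (1 + t) * expR (- t).

Definition smoothed_kernel (M : R) (x : plane) : R :=
  cz_kernel x * cutoff (M * (x.1 ^+ 2 + x.2 ^+ 2)).

Lemma cz_kernelE (x : plane) :
  cz_kernel x = (x.2 ^+ 2 - x.1 ^+ 2) / (2 * pi * (x.1 ^+ 2 + x.2 ^+ 2) ^+ 2).
Proof.
by rewrite /cz_kernel /enorm (exprM _ 2 2) sqr_sqrtr// addr_ge0 ?sqr_ge0.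
Qed.

Lemma cz_kernel_swap (a b : R) : cz_kernel (b, a) = - cz_kernel (a, b).
Proof.
by rewrite !cz_kernelE/= [b ^+ 2 + a ^+ 2]addrC -opprB mulNr.
Qed.

Lemma cz_kernelN (x : plane) : cz_kernel (- x) = cz_kernel x.
Proof. by rewrite !cz_kernelE/= !sqrrN. Qed.

Lemma smoothed_kernelN M x : smoothed_kernel M (- x) = smoothed_kernel M x.
Proof. by rewrite /smoothed_kernel cz_kernelN/= !sqrrN. Qed.

(** With [c = |x|^2] and [A = 2 pi K(x)], the integrand has the primitive
    [(- A + (1 - A c) s) exp (- s c)], because [A c^2 = b^2 - a^2]. At the origin both sides of this
    identity vanish, so the formula holds there as well. *)
Lemma Rint_hat (M a b : R) : 0 < M ->
  \int[leb]_(s in `[0, M]) hat s a b =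
  2 * pi * smoothed_kernel M (a, b) + pi * gauss2 M (a, b).
Proof.
move=> M0; set c := a ^+ 2 + b ^+ 2.
have pi0 := pi_gt0 R; have pin0 : pi != 0 :> R by rewrite gt_eqF.
set A := 2 * pi * cz_kernel (a, b).
have Ac : A * c ^+ 2 = b ^+ 2 - a ^+ 2.
  rewrite /A cz_kernelE/= -/c; have [c0|c0] := eqVneq c 0; last first.
    by move: (pi) pin0 => P Pn; field; rewrite c0 Pn.
  have a0 : a ^+ 2 = 0.
    by have := sqr_ge0 a; have := sqr_ge0 b; rewrite /c in c0; lra.
  have b0 : b ^+ 2 = 0 by rewrite /c a0 add0r in c0.
  by rewrite c0 a0 b0 subrr expr0n mulr0.
transitivity (\int[leb]_(s in `[0, M])
   (((1 - A * c) - c * (- A + (1 - A * c) * s)) * expR (- (s * c)))).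
  apply: eq_Rintegral => s _; rewrite /hat -mulrA -expRD.
  have -> : - (s * a ^+ 2) + - (s * b ^+ 2) = - (s * c) by rewrite /c; ring.
  congr (_ * _); rewrite [RHS](_ : _ = 1 - c * s + A * c ^+ 2 * s); last by ring.
  by rewrite Ac /c; ring.
rewrite Rint_lin_exp// /smoothed_kernel/= -/c /cutoff /gauss2/= -/c.
rewrite [RHS](_ : _ = A * (1 - (1 + M * c) * expR (- (M * c)))
   + M * expR (- (M * c))); last by rewrite /A; move: (pi) pin0 => P Pn; field.
by ring.
Qed.

Lemma measurable_cz_kernel : measurable_fun setT (fun x : plane => cz_kernel x).
Proof.
(* The inverse of [c ^+ 2], with [c] the squared norm, is written as [exp (- 2 ln c)], a composition
   of measurable functions. Where [c = 0] the numerator vanishes, so both expressions are 0. *)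
rewrite (_ : (fun _ => _) = (fun x : plane => (x.2 ^+ 2 - x.1 ^+ 2) *
  ((2 * pi)^-1 * expR (- (ln (x.1 ^+ 2 + x.2 ^+ 2) + ln (x.1 ^+ 2 + x.2 ^+ 2)))))).
  by meas.
apply/funext => x; rewrite cz_kernelE.
have [c0|c0] := eqVneq (x.1 ^+ 2 + x.2 ^+ 2) 0.
  have := sqr_ge0 x.1; have := sqr_ge0 x.2 => b0 a0.
  have -> : x.2 ^+ 2 - x.1 ^+ 2 = 0 by lra.
  by rewrite !mul0r.
have cp : 0 < x.1 ^+ 2 + x.2 ^+ 2 by rewrite lt0r c0 addr_ge0 ?sqr_ge0.
by rewrite expRN expRD lnK ?posrE// -expr2 -invfM.
Qed.

Lemma measurable_smoothed_kernel M :
  measurable_fun setT (fun x : plane => smoothed_kernel M x).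
Proof.
rewrite /smoothed_kernel; apply: measurable_funM; first exact: measurable_cz_kernel.
by rewrite /cutoff; meas.
Qed.

Lemma measurable_plane_sub :
  measurable_fun setT (fun z : plane * plane => (z.1 - z.2 : plane)).
Proof.
rewrite (_ : (fun _ => _) = (fun z : plane * plane =>
  ((z.1.1 - z.2.1, z.1.2 - z.2.2) : plane))); last first.
  by apply/funext => -[[a b] [c e]].
by meas.
Qed.

Lemma intg_itv (a b : R) : intg leb (\1_(`[a, b]%classic : set R)).
Proof. exact: integrable_indic_itv. Qed.

Lemma Rint_itv (M : R) : 0 < M ->
  \int[leb]_s (\1_(`[0, M]%classic : set R) s : R) = M.
Proof.
move=> M0; rewrite /Rintegral integral_indic//= setIT /mu1.
by rewrite lebesgue_measure_itv/= lte_fin M0 oppr0 adde0.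
Qed.

Lemma measurable_hat d (T : measurableType d) (s a b : T -> R) :
  measurable_fun setT s -> measurable_fun setT a -> measurable_fun setT b ->
  measurable_fun setT (fun z => hat (s z) (a z) (b z)).
Proof. by move=> ms ma mb; rewrite /hat; meas. Qed.

Lemma itv_hat_le (M s a b : R) :
  `|\1_(`[0, M]%classic : set R) s * hat s a b| <= \1_(`[0, M]%classic : set R) s.
Proof.
rewrite indicE; case: (boolP (s \in _)) => [|_]; last by rewrite mul0r normr0.
by rewrite mul1r inE/= in_itv/= => /andP[s0 _]; exact: hat_le1.
Qed.

(** Read off from the mixture and not from the singular quotient: [2 pi K chi] is an integral of
    modulus at most [M] minus [pi G], and [pi G] lies in [[0, M]]. *)
Lemma smoothed_kernel_le (M : R) x : 0 < M -> `|smoothed_kernel M x| <= M / pi.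
Proof.
move=> M0.
have : `|\int[leb]_(s in `[0, M]) hat s x.1 x.2| <= M.
  have ih : intg leb (fun s => \1_(`[0, M]%classic : set R) s * hat s x.1 x.2).
    apply: intg_le (intg_itv 0 M); last by move=> s; exact: itv_hat_le.
    by apply: measurable_funM => //; exact: measurable_hat.
  rewrite Rint_indic; apply: le_trans (le_normr_Rintegral _ ih) _ => //.
  rewrite -[leRHS](Rint_itv M0); apply: le_Rintegral => //.
  - exact: intg_norm ih.
  - exact: intg_itv.
  - by move=> s _; exact: itv_hat_le.
have g0 := gauss2_ge0 x (ltW M0); have g1 := gauss2_le x (ltW M0).
rewrite Rint_hat// -surjective_pairing.
move: (pi) (pi_gt0 R) g1 => P P0 g1.
have g2 : P * gauss2 M x <= M. by rewrite mulrC -ler_pdivlMr.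
have g3 : 0 <= P * gauss2 M x by rewrite mulr_ge0 // ltW.
rewrite !ler_norml => /andP[h1 h2]; apply/andP; split.
  by rewrite -mulNr ler_pdivrMr//; lra.
by rewrite ler_pdivlMr//; lra.
Qed.

Lemma measurable_smoothed_kernel_sub M :
  measurable_fun setT (fun z : plane * plane => smoothed_kernel M (z.1 - z.2)).
Proof.
exact: measurableT_comp (measurable_smoothed_kernel M) measurable_plane_sub.
Qed.

Local Notation skform M f g :=
  (kform (mu2 R) (fun z => smoothed_kernel M (z.1 - z.2)) f g).
Local Notation gform M f g :=
  (kform (mu2 R) (fun z => gauss2 M (z.1 - z.2)) f g).

Lemma skform_half_gform (M : R) (f : plane -> R) : 0 < M -> intg (mu2 R) f ->
  `|skform M f f| <= gform M f f / 2.
Proof.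
move=> M0 fi; have pi0 := pi_gt0 R.
have iS : intg (pmeas (mu2 R) (mu2 R))
    (fun z => smoothed_kernel M (z.1 - z.2) * (f z.1 * f z.2)).
  apply: (@kform_intg _ _ _ (mu2 R) _ (M / pi) f f) => //.
    exact: measurable_smoothed_kernel_sub.
  by move=> z; exact: smoothed_kernel_le.
have iG : intg (pmeas (mu2 R) (mu2 R))
    (fun z => gauss2 M (z.1 - z.2) * (f z.1 * f z.2)).
  apply: (@kform_intg _ _ _ (mu2 R) _ (M / pi) f f) => //.
    exact: measurable_gauss2.
  by move=> z; rewrite ger0_norm ?gauss2_ge0 ?gauss2_le// ltW.
(* Kept general in the coordinate functions: [fst, snd] and [snd, fst] give the bounds for the two
   signs of the kernel. *)
have psd (p q : plane -> R) : measurable_fun setT p -> measurable_fun setT q ->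
    0 <= kform (mu2 R) (fun z => 2 * pi * smoothed_kernel M
           (p z.1 - p z.2, q z.1 - q z.2) +
           pi * gauss2 M (p z.1 - p z.2, q z.1 - q z.2)) f f.
  move=> mp mq.
  have := @kform_mixture_ge0 _ _ _ (mu2 R) _ _ leb
    (fun sz => \1_(`[0, M]%classic : set R) sz.1 *
       hat sz.1 (p sz.2.1 - p sz.2.2) (q sz.2.1 - q sz.2.2))
    (\1_(`[0, M]%classic : set R)) f _ _ (intg_itv 0 M) fi _.
  rewrite (_ : (fun z => \int[leb]_s _) = (fun z => 2 * pi * smoothed_kernel M
           (p z.1 - p z.2, q z.1 - q z.2) +
           pi * gauss2 M (p z.1 - p z.2, q z.1 - q z.2))); last first.
    by apply/funext => z; rewrite -Rint_hat// [RHS]Rint_indic.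
  apply.
  - apply: measurable_funM; first exact: measurableT_comp.
    have m1 := measurableT_comp (@measurable_fst _ _ plane plane)
      (@measurable_snd _ _ (measurableTypeR R) (plane * plane)%type).
    have m2 := measurableT_comp (@measurable_snd _ _ plane plane)
      (@measurable_snd _ _ (measurableTypeR R) (plane * plane)%type).
    by apply: measurable_hat => //; apply: measurable_funB;
      [exact: measurableT_comp mp m1|exact: measurableT_comp mp m2|
       exact: measurableT_comp mq m1|exact: measurableT_comp mq m2].
  - by move=> z; exact: itv_hat_le.
  - move=> s; case: (boolP (s \in (`[0, M]%classic : set R))) => hs.
      rewrite (_ : (fun z => _) = (fun z =>
          hat s (p z.1 - p z.2) (q z.1 - q z.2))); last first.
        by apply/funext => z; rewrite /= indicE hs mul1r.
      by apply: hat_psd => //; move: hs; rewrite inE/= in_itv/= => /andP[].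
    rewrite (_ : (fun z => _) = (fun=> 0)); last first.
      by apply/funext => z; rewrite /= indicE (negbTE hs) mul0r.
    rewrite /kform; under eq_Rintegral do rewrite mul0r.
    by rewrite Rintegral_cst// mul0r.
have lin c : \int[pmeas (mu2 R) (mu2 R)]_z ((c * smoothed_kernel M (z.1 - z.2) +
    pi * gauss2 M (z.1 - z.2)) * (f z.1 * f z.2)) =
    c * skform M f f + pi * gform M f f.
  rewrite /kform -!RintegralZl// -RintegralD//; [|exact: intgZ|exact: intgZ].
  by apply: eq_Rintegral => z _; ring.
have h1 : 0 <= 2 * pi * skform M f f + pi * gform M f f.
  rewrite -lin; have := psd fst snd measurable_fst measurable_snd.
  by congr (0 <= _); apply: eq_Rintegral => -[[a b] [c e]] _.
have h2 : 0 <= - (2 * pi) * skform M f f + pi * gform M f f.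
  rewrite -lin; have := psd snd fst measurable_snd measurable_fst.
  congr (0 <= _); apply: eq_Rintegral => -[[a b] [c e]] _ /=; congr (_ * _).
  rewrite /smoothed_kernel/= cz_kernel_swap/= /gauss2/=.
  by rewrite [(b - e) ^+ 2 + _]addrC; ring.
rewrite ler_norml; move: (pi) pi0 h1 h2 => P P0 h1 h2.
by apply/andP; split; nra.
Qed.

End SmoothedKernel.

(** * Schur's test and the norm of the smoothed operator *)

Section MarkovKernel.
Context d (X : measurableType d) (R : realType).
Variable mu : {sigma_finite_measure set X -> \bar R}.

Lemma intg_sqr_mul (f g : X -> R) : measurable_fun setT f ->
  measurable_fun setT g -> intg mu (fun x => f x ^+ 2) ->
  intg mu (fun x => g x ^+ 2) -> intg mu (fun x => f x * g x).
Proof.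
move=> mf mg f2 g2; apply: intg_le (intgD f2 g2); first exact: measurable_funM.
move=> x; rewrite ler_norml; apply/andP.
have := sqr_ge0 (f x + g x); have := sqr_ge0 (f x - g x).
by have := sqr_ge0 (f x); have := sqr_ge0 (g x); split; nra.
Qed.

(** Schur's test: [f x * f y] is at most half of [f x ^ 2 + f y ^ 2], and since both marginals of
    [k] are 1, each of the two squares integrates to the squared norm of [f]. *)
Lemma kform_markov_le (k : X * X -> R) (B : R) (f : X -> R) :
  measurable_fun setT k -> (forall z, 0 <= k z <= B) ->
  (forall x, intg mu (fun y => k (x, y)) /\ \int[mu]_y k (x, y) = 1) ->
  (forall y, intg mu (fun x => k (x, y)) /\ \int[mu]_x k (x, y) = 1) ->
  intg mu f -> intg mu (fun x => f x ^+ 2) ->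
  kform mu k f f <= \int[mu]_x f x ^+ 2.
Proof.
move=> mk kB k1 k2 fi f2.
have mf := intg_meas fi.
have k0 z : 0 <= k z by have /andP[] := kB z.
have i1 : intg (pmeas mu mu) (fun z => k z * f z.1 ^+ 2).
  apply/integrable12ltyP.
    by apply/measurable_EFinP/measurable_funM => //; apply: measurable_funX;
      exact: measurableT_comp.
  rewrite (_ : (\int[mu]_x _)%E = (\int[mu]_x (f x ^+ 2)%:E)%E).
    by rewrite Rint_fin// ltry.
  apply: eq_integral => x _; have [ki ke] := k1 x.
  rewrite [RHS](_ : _ = (\int[mu]_y (k (x, y) * f x ^+ 2))%:E); last first.
    by rewrite RintegralZr// ke mul1r.
  rewrite -Rint_fin; last exact: intgZr.
  by apply: eq_integral => y _; rewrite /= ger0_norm// mulr_ge0// sqr_ge0.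
have i2 : intg (pmeas mu mu) (fun z => k z * f z.2 ^+ 2).
  apply/integrable21ltyP.
    by apply/measurable_EFinP/measurable_funM => //; apply: measurable_funX;
      exact: measurableT_comp.
  rewrite (_ : (\int[mu]_x _)%E = (\int[mu]_x (f x ^+ 2)%:E)%E).
    by rewrite Rint_fin// ltry.
  apply: eq_integral => x _; have [ki ke] := k2 x.
  rewrite [RHS](_ : _ = (\int[mu]_y (k (y, x) * f x ^+ 2))%:E); last first.
    by rewrite RintegralZr// ke mul1r.
  rewrite -Rint_fin; last exact: intgZr.
  by apply: eq_integral => y _; rewrite /= ger0_norm// mulr_ge0// sqr_ge0.
have e1 : \int[pmeas mu mu]_z (k z * f z.1 ^+ 2) = \int[mu]_x f x ^+ 2.
  rewrite (Rint_fubini1 i1); apply: eq_Rintegral => x _ /=.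
  by have [ki ke] := k1 x; rewrite RintegralZr// ke mul1r.
have e2 : \int[pmeas mu mu]_z (k z * f z.2 ^+ 2) = \int[mu]_x f x ^+ 2.
  rewrite (Rint_fubini2 i2); apply: eq_Rintegral => x _ /=.
  by have [ki ke] := k2 x; rewrite RintegralZr// ke mul1r.
rewrite (_ : \int[mu]_x f x ^+ 2 = \int[pmeas mu mu]_z
  (2^-1 * (k z * f z.1 ^+ 2 + k z * f z.2 ^+ 2))); last first.
  rewrite RintegralZl//; last exact: intgD.
  by rewrite RintegralD// e1 e2; field.
apply: le_Rintegral => //.
- apply: (@kform_intg _ _ _ _ _ B) => //.
  by move=> z; have /andP[? ?] := kB z; rewrite ger0_norm.
- exact/intgZ/intgD.
- move=> z _; have := k0 z; have := sqr_ge0 (f z.1 - f z.2).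
  move: (k z) (f z.1) (f z.2) => K u v; nra.
Qed.

End MarkovKernel.

Section SmoothedOperator.
Variable R : realType.
Local Notation plane := (measurableTypeR R * measurableTypeR R)%type.
Local Notation skform M f g :=
  (kform (mu2 R) (fun z => smoothed_kernel M (z.1 - z.2)) f g).

Lemma skform_le (M : R) (f : plane -> R) : 0 < M -> intg (mu2 R) f ->
  intg (mu2 R) (fun x => f x ^+ 2) ->
  `|skform M f f| <= (\int[mu2 R]_x f x ^+ 2) / 2.
Proof.
move=> M0 fi f2; apply: le_trans (skform_half_gform M0 fi) _.
rewrite ler_wpM2r ?invr_ge0//.
apply: (@kform_markov_le _ _ _ (mu2 R) _ (M / pi)) => //.
- exact: measurable_gauss2.
- by move=> z; rewrite gauss2_ge0 ?gauss2_le// ltW.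
- by move=> x; exact: Rint_gauss2.
- move=> y; have := Rint_gauss2 y M0.
  by under eq_fun do rewrite -gauss2N opprB;
    under eq_Rintegral do rewrite -gauss2N opprB.
Qed.

Definition smoothed_op (M : R) (f : plane -> R) (x : plane) : R :=
  \int[mu2 R]_y (smoothed_kernel M (x - y) * f y).

Section Bound.
Variables (M : R) (f : plane -> R).
Hypotheses (M0 : 0 < M) (fi : intg (mu2 R) f).

Lemma smoothed_op_intg x : intg (mu2 R) (fun y => smoothed_kernel M (x - y) * f y).
Proof.
apply: (@intg_bounded_mul _ _ _ _ _ _ (M / pi)) => //.
- have mx := measurable_smoothed_kernel_sub M.
  exact: (measurableT_comp mx (@measurable_pair1 _ _ plane plane x)).
- by move=> y; exact: smoothed_kernel_le.
Qed.

Lemma smoothed_op_le x : `|smoothed_op M f x| <= M / pi * \int[mu2 R]_y `|f y|.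
Proof.
apply: le_trans (le_normr_Rintegral _ (smoothed_op_intg x)) _ => //.
rewrite -RintegralZl//; last exact: intg_norm.
apply: le_Rintegral => //.
- exact: intg_norm (smoothed_op_intg x).
- exact/intgZ/intg_norm.
- by move=> y _; rewrite normrM ler_wpM2r// smoothed_kernel_le.
Qed.

Lemma skform_op (g : plane -> R) : intg (mu2 R) g ->
  skform M g f = \int[mu2 R]_x (g x * smoothed_op M f x).
Proof.
move=> gi; rewrite /kform Rint_fubini1.
  apply: eq_Rintegral => x _ /=; rewrite -RintegralZl//; last exact: smoothed_op_intg.
  by apply: eq_Rintegral => y _; rewrite mulrCA.
apply: (@kform_intg _ _ _ _ _ (M / pi)) => //.
  exact: measurable_smoothed_kernel_sub.
by move=> z; exact: smoothed_kernel_le.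
Qed.

Variable D : set plane.
Hypotheses (mD : measurable D) (iD : intg (mu2 R) (\1_D : plane -> R)).

(** The cut to a set of finite measure makes the bounded function [smoothed_op M f] integrable, as
    required of the arguments of the form. *)
Let g (x : plane) : R := \1_D x * smoothed_op M f x.

Lemma measurable_smoothed_op : measurable_fun setT g.
Proof.
have ik := @kform_intg _ _ _ (mu2 R) _ (M / pi) _ _
   (measurable_smoothed_kernel_sub M)
   (fun z => smoothed_kernel_le (z.1 - z.2) M0) iD fi.
have := measurable_fubini_F ik => mF.
rewrite (_ : g = fine \o fubini_F (mu2 R)
   (EFin \o fun z => smoothed_kernel M (z.1 - z.2) * (\1_D z.1 * f z.2))).
  exact: measurableT_comp.
apply/funext => x; rewrite /= /g /smoothed_op.
rewrite -RintegralZl//; last exact: smoothed_op_intg.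
by apply: eq_Rintegral => y _ /=; rewrite mulrCA.
Qed.

(** Polarization. Let [S] be the symmetric form and [F], [G] the squared norms of [f], [g]. Since
    [S f g = G], subtracting the values of [S] at [f + e g] and [f - e g] leaves [4 e G], and the
    bound of each value by half the squared norm gives [4 e G <= F + e^2 G]. The choice [e = 2]
    maximizes [4 e - e^2] and yields [4 G <= F]. *)
Lemma smoothed_op_bound : intg (mu2 R) (fun x => f x ^+ 2) ->
  intg (mu2 R) (fun x => g x ^+ 2) /\
  \int[mu2 R]_x g x ^+ 2 <= (\int[mu2 R]_x f x ^+ 2) / 4.
Proof.
move=> f2; have mf := intg_meas fi; have mg := measurable_smoothed_op.
have M1 : 0 <= M / pi by rewrite divr_ge0 ?pi_ge0// ltW.
pose C := M / pi * \int[mu2 R]_y `|f y|.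
have C0 : 0 <= C by rewrite mulr_ge0// Rintegral_ge0.
have gC x : `|g x| <= C * \1_D x.
  have i0 : 0 <= \1_D x :> R by rewrite indicE.
  by rewrite /g normrM mulrC (ger0_norm i0) ler_wpM2r//; exact: smoothed_op_le.
have gi : intg (mu2 R) g by apply: intg_le mg gC _; exact: intgZ.
have g2 : intg (mu2 R) (fun x => g x ^+ 2).
  apply: (@intg_le _ _ _ _ _ (fun x => C ^+ 2 * \1_D x)); last exact: intgZ.
    exact: measurable_funX.
  move=> x; rewrite ger0_norm ?sqr_ge0// -(real_normK (num_real (g x))).
  apply: (@le_trans _ _ ((C * \1_D x) ^+ 2)).
    by rewrite ler_sqr ?nnegrE// (le_trans _ (gC x)).
  by rewrite exprMn indicE; case: (_ \in _); rewrite ?expr1n// expr0n.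
have fg := intg_sqr_mul mf mg f2 g2.
split=> //.
set F := \int[mu2 R]_x f x ^+ 2; set G := \int[mu2 R]_x g x ^+ 2.
set H := \int[mu2 R]_x (f x * g x).
have GE : skform M g f = G.
  rewrite skform_op//; apply: eq_Rintegral => x _.
  by rewrite /g expr2 mulrACA indicE; case: (_ \in _);
    rewrite ?mul1r ?mul0r ?mulr0.
have i2 (u v : plane -> R) : intg (mu2 R) u -> intg (mu2 R) v ->
    intg (pmeas (mu2 R) (mu2 R))
      (fun z => smoothed_kernel M (z.1 - z.2) * (u z.1 * v z.2)).
  apply: kform_intg; first exact: measurable_smoothed_kernel_sub.
  by move=> z; exact: smoothed_kernel_le.
have GE' : skform M f g = G.
  rewrite -GE /kform (Rint_fubini1 (i2 _ _ fi gi)) (Rint_fubini2 (i2 _ _ gi fi)).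
  apply: eq_Rintegral => x _; apply: eq_Rintegral => y _ /=.
  by rewrite -(smoothed_kernelN M (x - y)) opprB [f x * _]mulrC.
have exp2 (e : R) : skform M (fun x => f x + e * g x) (fun x => f x + e * g x)
   = skform M f f + 2 * e * G + e ^+ 2 * skform M g g.
  transitivity (\int[pmeas (mu2 R) (mu2 R)]_z
    (smoothed_kernel M (z.1 - z.2) * (f z.1 * f z.2) +
     e * (smoothed_kernel M (z.1 - z.2) * (f z.1 * g z.2)) +
     e * (smoothed_kernel M (z.1 - z.2) * (g z.1 * f z.2)) +
     e ^+ 2 * (smoothed_kernel M (z.1 - z.2) * (g z.1 * g z.2)))).
    by apply: eq_Rintegral => z _; ring.
  have j1 := i2 _ _ fi fi; have j2 := intgZ e (i2 _ _ fi gi).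
  have j3 := intgZ e (i2 _ _ gi fi); have j4 := intgZ (e ^+ 2) (i2 _ _ gi gi).
  rewrite RintegralD//; last by apply: intgD => //; exact: intgD.
  rewrite RintegralD//; last exact: intgD.
  rewrite RintegralD// !RintegralZl//; [|exact: i2..].
  by rewrite -!/(kform _ _ _ _) GE GE'; ring.
have sq2 (e : R) : \int[mu2 R]_x (f x + e * g x) ^+ 2 =
    F + 2 * e * H + e ^+ 2 * G.
  transitivity (\int[mu2 R]_x
    (f x ^+ 2 + (2 * e) * (f x * g x) + e ^+ 2 * g x ^+ 2)).
    by apply: eq_Rintegral => z _; ring.
  have j2 := intgZ (2 * e) fg; have j3 := intgZ (e ^+ 2) g2.
  by rewrite RintegralD ?RintegralD ?RintegralZl//; exact: intgD.
have ui (e : R) : intg (mu2 R) (fun x => f x + e * g x).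
  by apply: intgD => //; exact: intgZ.
have u2 (e : R) : intg (mu2 R) (fun x => (f x + e * g x) ^+ 2).
  rewrite (_ : (fun x => _) = (fun x =>
    f x ^+ 2 + (2 * e) * (f x * g x) + e ^+ 2 * g x ^+ 2)).
    by do ?[exact: intgZ|apply: intgD].
  by apply/funext => x; ring.
have := skform_le M0 (ui 2) (u2 2); have := skform_le M0 (ui (-2)) (u2 (-2)).
rewrite !exp2 !sq2 !ler_norml => /andP[h1 h2] /andP[h3 h4].
lra.
Qed.

End Bound.
End SmoothedOperator.

(** * Smoothing as an average of truncations *)

Section Moments.
Variable R : realType.
Implicit Types (a b c M r : R).

(** One family of primitives for all the radial integrals below. The coefficients are chosen at each
    use so that the derivative [quad_exp'] is the weight, its majorant against the truncated kernel,
    or the weight times [r^2]. *)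
Definition quad_exp a b c M r : R :=
  (a + b * (M * r ^+ 2) + c * (M * r ^+ 2) ^+ 2) * expR (- (M * r ^+ 2)).

Definition quad_exp' a b c M r : R :=
  2 * M * r * (b - a + (2 * c - b) * (M * r ^+ 2) - c * (M * r ^+ 2) ^+ 2) *
  expR (- (M * r ^+ 2)).

Lemma is_derive_quad_exp a b c M r :
  is_derive r (1 : R) (quad_exp a b c M) (quad_exp' a b c M r).
Proof.
have d1 : is_derive r (1 : R) (fun r => M * r ^+ 2) (2 * M * r).
  by apply: is_derive_eq; rewrite /GRing.scale/=; ring.
have d2 : is_derive r (1 : R) (fun r => - (M * r ^+ 2)) (- (2 * M * r)).
  by apply: is_derive_eq; rewrite /GRing.scale/=; ring.
have d3 := is_derive_expR_comp d2.
have d4 : is_derive r (1 : R)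
    (fun r => a + b * (M * r ^+ 2) + c * (M * r ^+ 2) ^+ 2)
    (2 * M * r * (b + 2 * c * (M * r ^+ 2))).
  by apply: is_derive_eq; rewrite /GRing.scale/=; ring.
have := is_deriveM d4 d3 => d5; apply: is_derive_eq.
by rewrite /GRing.scale/= /quad_exp'; ring.
Qed.

Lemma continuous_quad_exp' a b c M : continuous (quad_exp' a b c M).
Proof.
have d r : is_derive r (1 : R) (fun r => 2 * M * r *
  (b - a + (2 * c - b) * (M * r ^+ 2) - c * (M * r ^+ 2) ^+ 2))
  (2 * M * (b - a + (2 * c - b) * (M * r ^+ 2) - c * (M * r ^+ 2) ^+ 2) +
   2 * M * r * ((2 * c - b) * M * 2 * r - c * M ^+ 2 * 4 * r ^+ 3)).
  by apply: is_derive_eq; rewrite /GRing.scale/=; ring.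
have d2 r : is_derive r (1 : R) (fun r => - (M * r ^+ 2)) (- (2 * M * r)).
  by apply: is_derive_eq; rewrite /GRing.scale/=; ring.
have c1 := is_derive1_continuous d.
have c2 := is_derive1_continuous (fun r => is_derive_expR_comp (d2 r)).
by move=> r; apply: cvgM; [exact: c1|exact: c2].
Qed.

Lemma cvg_quad_exp a b c M : 0 < M -> quad_exp a b c M r @[r --> +oo] --> 0.
Proof.
move=> M0; apply/cvgrPdist_le => e e0; near=> r.
set u := M * r ^+ 2; set C := `|a| + `|b| + `|c|.
have C0 : 0 <= C by rewrite !addr_ge0.
have r1 : 1 <= r by near: r; apply: nbhs_pinfty_ge; exact: num_real.
have r0 : 0 <= r := le_trans ler01 r1.
have rM : M^-1 <= r by near: r; apply: nbhs_pinfty_ge; exact: num_real.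
(* From [exp u >= u^3 / 6], and since the polynomial is at most [C u^2] for [u >= 1], the function
   is at most [6 C / u]; the three lower bounds on [r] give [u >= 1] and [6 C <= u e]. *)
have rC : 6 * C / (e * M) <= r by near: r; apply: nbhs_pinfty_ge; exact: num_real.
have uM : M * r <= u by rewrite /u ler_pM2l// expr2 ler_peMl.
have u1 : 1 <= u by apply: le_trans uM; rewrite -ler_pdivrMl// mulr1.
have u0 : 0 <= u by apply: le_trans u1.
have uC : 6 * C <= u * e.
  have := rC; rewrite ler_pdivrMr ?mulr_gt0// => h.
  apply: le_trans h _; rewrite (_ : r * (e * M) = M * r * e); last by ring.
  by rewrite ler_pM2r.
have eu : u ^+ 3 <= 6 * expR u.
  have := @expR_ge1Dxn _ u 2 (le_trans ler01 u1).
  rewrite (_ : 3`!%:R = 6)// => h.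
  have : u ^+ 3 / 6 <= expR u by apply: le_trans h; rewrite lerDr.
  by rewrite ler_pdivrMr// mulrC.
rewrite sub0r normrN /quad_exp -/u expRN normrM normfV (ger0_norm (expR_ge0 _)).
rewrite ler_pdivrMr ?expR_gt0//.
have q : `|a + b * u + c * u ^+ 2| <= C * u ^+ 2.
  have u2 : u <= u ^+ 2 by rewrite expr2 ler_peMl.
  apply: le_trans (ler_normD _ _) _; apply: le_trans (lerD (ler_normD _ _) (lexx _)) _.
  have u21 : 1 <= u ^+ 2 by apply: le_trans u2.
  rewrite (normrM b u) (normrM c) (ger0_norm (sqr_ge0 u)).
  rewrite (ger0_norm u0) /C !mulrDl.
  by rewrite lerD2r lerD// ?ler_wpM2l// ler_peMr.
have u6 : 0 < 6 * u by rewrite mulr_gt0// (lt_le_trans ltr01).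
apply: le_trans q _; rewrite -(ler_pM2r u6).
have eE := expR_gt0 u.
have h1 : 6 * C * u ^+ 3 <= u * e * (6 * expR u).
  by apply: ler_pM => //; [rewrite mulr_ge0|rewrite exprn_ge0].
rewrite (_ : C * u ^+ 2 * (6 * u) = 6 * C * u ^+ 3); last by ring.
by rewrite (_ : e * expR u * (6 * u) = u * e * (6 * expR u)); last by ring.
Unshelve. all: by end_near. Qed.

(** Nonnegativity lets the fundamental theorem on the half-line deliver integrability along with the
    value; only the end point 0 contributes. *)
Lemma Rint_quad_exp a b c M : 0 < M ->
  (forall r, 0 <= r -> 0 <= quad_exp' a b c M r) ->
  intg (mu1 R) (fun r => \1_(`[0, +oo[%classic : set R) r * quad_exp' a b c M r) /\
  \int[mu1 R]_r (\1_(`[0, +oo[%classic : set R) r * quad_exp' a b c M r) = - a.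
Proof.
move=> M0 q0.
have e : (\int[mu1 R]_r (\1_(`[0%R, +oo[%classic : set R) r * quad_exp' a b c M r)%:E)%E = (- a)%:E.
  have := Rint_derivey (is_derive_quad_exp a b c M) (@continuous_quad_exp' a b c M) q0 (cvg_quad_exp a b c M0).
  rewrite /quad_exp expr0n/= !mulr0 expr0n/= !mulr0 !addr0 oppr0 expR0 mulr1 sub0r => <-.
  rewrite [RHS]integral_mkcond; apply: eq_integral => r _.
  by rewrite epatch_indic/= -EFinM mulrC.
split; last by rewrite /Rintegral e.
apply: intg_ge0; last by rewrite e ltry.
  apply: measurable_funM => //; apply: continuous_measurable_fun.
  exact: continuous_quad_exp'.
move=> r; rewrite indicE; case: (boolP (r \in _)) => [|_]; last by rewrite mul0r.
by rewrite inE/= in_itv/= andbT mul1r; exact: q0.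
Qed.

End Moments.

Section Average.
Variable R : realType.
Local Notation plane := (measurableTypeR R * measurableTypeR R)%type.
Local Notation halfline := (`[0, +oo[%classic : set R).

Definition trunc_kernel (x : plane) (r : R) (y : plane) : R :=
  (r < enorm (x - y))%R%:R * cz_kernel (x - y).

Definition trunc_op (f : plane -> R) (x : plane) (r : R) : R :=
  \int[mu2 R]_y (trunc_kernel x r y * f y).

(* The density with respect to which [cutoff (M |x|^2)] is an average of the
   indicators of [r < |x|]. *)
Definition avg_weight (M r : R) : R := quad_exp' (-1) (-1) 0 M r.

Lemma avg_weightE M r :
  avg_weight M r = 2 * M ^+ 2 * r ^+ 3 * expR (- (M * r ^+ 2)).
Proof. by rewrite /avg_weight /quad_exp'; ring. Qed.

Lemma enorm_ge0 (x : plane) : 0 <= enorm x.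
Proof. exact: sqrtr_ge0. Qed.

Lemma enorm_sqr (x : plane) : enorm x ^+ 2 = x.1 ^+ 2 + x.2 ^+ 2.
Proof. by rewrite sqr_sqrtr// addr_ge0 ?sqr_ge0. Qed.

Lemma measurable_enorm : measurable_fun setT (fun x : plane => enorm x).
Proof.
rewrite /enorm; apply: (measurableT_comp
  (continuous_measurable_fun (@sqrt_continuous R))
  (g := fun x : plane => x.1 ^+ 2 + x.2 ^+ 2)).
by meas.
Qed.

Lemma cz_kernel_le (x : plane) : enorm x ^+ 2 * `|cz_kernel x| <= (2 * pi)^-1.
Proof.
have pi0 : 0 <= (2 * pi)^-1 :> R by rewrite invr_ge0 mulr_ge0 ?pi_ge0.
rewrite cz_kernelE enorm_sqr.
have x1 := sqr_ge0 x.1; have x2 := sqr_ge0 x.2.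
set c := x.1 ^+ 2 + x.2 ^+ 2.
have [->|c0] := eqVneq c 0; first by rewrite mul0r.
have cp : 0 < c by rewrite lt0r c0 addr_ge0.
rewrite (_ : (x.2 ^+ 2 - x.1 ^+ 2) / (2 * pi * c ^+ 2) =
  (2 * pi)^-1 * ((x.2 ^+ 2 - x.1 ^+ 2) / c ^+ 2)); last first.
  by rewrite invfM [RHS]mulrCA.
rewrite normrM (ger0_norm pi0) mulrCA ler_piMr// normrM normfV.
rewrite (ger0_norm (sqr_ge0 c)) expr2 invfM mulrCA [c * (_ * _)]mulrA mulfV// mul1r.
rewrite ler_pdivrMr// mul1r ler_norml /c.
by apply/andP; split; lra.
Qed.

Lemma trunc_kernel_le x r y : 0 <= r ->
  r ^+ 2 * `|trunc_kernel x r y| <= (2 * pi)^-1.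
Proof.
move=> r0; rewrite /trunc_kernel; case: ltP => [rx|_]; last first.
  by rewrite mul0r normr0 mulr0 invr_ge0 mulr_ge0 ?pi_ge0.
rewrite mul1r; apply: le_trans (cz_kernel_le (x - y)).
by rewrite ler_wpM2r// ler_sqr ?nnegrE ?enorm_ge0// ltW.
Qed.

Lemma measurable_plane_subl (x : plane) :
  measurable_fun setT (fun y : plane => (x - y : plane)).
Proof.
exact: (measurableT_comp (@measurable_plane_sub R)
  (@measurable_pair1 _ _ plane plane x)).
Qed.

Lemma measurable_trunc_kernel x :
  measurable_fun setT (fun z : R * plane => trunc_kernel x z.1 z.2).
Proof.
have m := measurableT_comp (measurable_plane_subl x)
  (@measurable_snd _ _ (measurableTypeR R) plane).
apply: measurable_funM; last exact: measurableT_comp (@measurable_cz_kernel R) m.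
rewrite (_ : (fun z => _) = (fun z : R * plane =>
   if z.1 < enorm (x - z.2) then 1 else 0)).
  apply: measurable_fun_ifT => //.
  apply: measurable_fun_ltr; first exact: measurable_fst.
  exact: measurableT_comp measurable_enorm m.
by apply/funext => z; case: ifP.
Qed.

Lemma avg_weight_ge0 M r : 0 < M -> 0 <= r -> 0 <= avg_weight M r.
Proof.
by move=> /ltW M0 r0; rewrite avg_weightE !mulr_ge0 ?exprn_ge0 ?expR_ge0.
Qed.

Lemma measurable_quad_exp' a b c M : measurable_fun setT (quad_exp' a b c M : R -> R).
Proof. by apply: continuous_measurable_fun; exact: continuous_quad_exp'. Qed.

Lemma smoothed_kernel_average M x y : 0 < M ->
  \int[mu1 R]_r (\1_halfline r * avg_weight M r * trunc_kernel x r y) =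
  smoothed_kernel M (x - y).
Proof.
move=> M0; rewrite /smoothed_kernel /trunc_kernel -enorm_sqr.
set p := enorm (x - y).
have [p0|p0] := eqVneq p 0.
  have K0 : cz_kernel (x - y) = 0.
    rewrite cz_kernelE -enorm_sqr -/p p0.
    have := enorm_sqr (x - y); rewrite -/p p0 expr0n/= => h.
    have := sqr_ge0 (x - y).1; have := sqr_ge0 (x - y).2 => h1 h2.
    have -> : (x - y).2 ^+ 2 - (x - y).1 ^+ 2 = 0 by lra.
    by rewrite mul0r.
  rewrite K0 mul0r; under eq_Rintegral do rewrite !mulr0.
  by rewrite Rintegral_cst// mul0r.
have pp : 0 < p by rewrite lt0r p0 enorm_ge0.
transitivity (\int[mu1 R]_(r in `[0, p[) (avg_weight M r * cz_kernel (x - y))).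
  rewrite [RHS]Rint_indic; apply: eq_Rintegral => r _.
  rewrite !indicE !mem_setE !in_itv/= andbT; case: (0 <= r) => /=; last by rewrite !mul0r.
  by case: (r < p) => /=; rewrite ?mul1r// !mul0r mulr0.
have d := is_derive_quad_exp (-1) (-1) 0 M.
have c := @continuous_quad_exp' R (-1) (-1) 0 M.
have ic : intg (mu1 R) (fun r => \1_halfline r * quad_exp' (-1) (-1) 0 M r).
  by have [] := Rint_quad_exp M0 (fun r r0 => avg_weight_ge0 M0 r0).
have ip : (mu1 R).-integrable `[0, p[ (EFin \o avg_weight M).
  apply/integrable_mkcond => //; apply: eq_integrable (intg_indicM _ ic) => //;
    last first.
    exact: (measurable_itv `[0, p[).
  move=> r _; rewrite epatch_indic/= -EFinM; congr EFin.
  rewrite !indicE !mem_setE !in_itv/= andbT mulrC.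
  by case: (0 <= r) => /=; rewrite ?mul1r ?mulr0.
rewrite RintegralZr// Rintegral_itv_bndo_bndc// (Rint_derive pp d c).
rewrite mulrC /quad_exp expr0n/= !mulr0 expr0n/= !mulr0 !addr0 oppr0 expR0.
by rewrite /cutoff mul0r; ring.
Qed.

Section AverageOp.
Variables (f : plane -> R) (x : plane).
Hypothesis fi : intg (mu2 R) f.

Let If : R := \int[mu2 R]_y `|f y|.

(** A majorant of [weighted]: the weight is of order [r^3] at 0 and absorbs the bound
    [(2 pi r^2)^-1] for the truncated kernel, leaving [M^2 r exp (- M r^2) / pi]. *)
Let b (M r : R) : R := \1_halfline r * quad_exp' (- (M / (2 * pi))) 0 0 M r.

Let b_intg M : 0 < M -> intg (mu1 R) (b M).
Proof.
move=> M0; have [] // := @Rint_quad_exp R (- (M / (2 * pi))) 0 0 M M0.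
move=> r r0; rewrite /quad_exp' (_ : _ - _ + _ - _ = M / (2 * pi)); last by ring.
by rewrite !mulr_ge0 ?expR_ge0 ?invr_ge0 ?mulr_ge0 ?pi_ge0 ?(ltW M0).
Qed.

Let weighted M (z : R * plane) : R :=
  \1_halfline z.1 * avg_weight M z.1 * trunc_kernel x z.1 z.2.

Let measurable_weighted M : measurable_fun setT (weighted M).
Proof.
apply: measurable_funM; last exact: measurable_trunc_kernel.
apply: measurable_funM; first exact: measurableT_comp.
apply: (measurableT_comp (@measurable_quad_exp' (-1) (-1) 0 M)).
exact: measurable_fst.
Qed.

Let weighted_le M z : 0 < M -> `|weighted M z| <= b M z.1.
Proof.
move=> M0; rewrite /weighted /b indicE.
case: (boolP (z.1 \in _)) => [|_]; last by rewrite !mul0r normr0.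
rewrite inE/= in_itv/= andbT => r0; rewrite !mul1r normrM.
rewrite ger0_norm ?avg_weight_ge0// avg_weightE /quad_exp'.
have t := trunc_kernel_le x z.2 r0.
rewrite (_ : 2 * M ^+ 2 * z.1 ^+ 3 * expR (- (M * z.1 ^+ 2)) * _ =
  (2 * M ^+ 2 * z.1 * expR (- (M * z.1 ^+ 2))) *
  (z.1 ^+ 2 * `|trunc_kernel x z.1 z.2|)); last by ring.
rewrite [leRHS](_ : _ = (2 * M ^+ 2 * z.1 * expR (- (M * z.1 ^+ 2))) * (2 * pi)^-1);
  last by ring.
by rewrite ler_wpM2l// !mulr_ge0 ?exprn_ge0 ?expR_ge0// ltW.
Qed.

Lemma trunc_op_intg r : 0 < r ->
  intg (mu2 R) (fun y => trunc_kernel x r y * f y).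
Proof.
move=> r0; apply: (@intg_bounded_mul _ _ _ _ _ _ ((2 * pi)^-1 / r ^+ 2)) => //.
  exact: (measurableT_comp (measurable_trunc_kernel x)
    (@measurable_pair1 _ _ (measurableTypeR R) plane r)).
move=> y; rewrite ler_pdivlMr ?exprn_gt0// mulrC.
exact: trunc_kernel_le (ltW r0).
Qed.

Lemma trunc_op_le r : 0 < r -> `|trunc_op f x r| <= (2 * pi)^-1 / r ^+ 2 * If.
Proof.
move=> r0; apply: le_trans (le_normr_Rintegral _ (trunc_op_intg r0)) _ => //.
rewrite -RintegralZl//; last exact: intg_norm.
apply: le_Rintegral => //.
- exact: intg_norm (trunc_op_intg r0).
- exact/intgZ/intg_norm.
- move=> y _; rewrite normrM ler_wpM2r// ler_pdivlMr ?exprn_gt0// mulrC.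
  exact: trunc_kernel_le (ltW r0).
Qed.

Lemma smoothed_op_average M : 0 < M ->
  intg (mu1 R) (fun r => \1_halfline r * avg_weight M r * trunc_op f x r) /\
  smoothed_op M f x =
    \int[mu1 R]_r (\1_halfline r * avg_weight M r * trunc_op f x r).
Proof.
move=> M0.
have wf : intg (pmeas (mu1 R) (mu2 R)) (fun z => weighted M z * f z.2).
  apply: (@intg_le _ _ _ (pmeas (mu1 R) (mu2 R)) (fun z => weighted M z * f z.2)
    (fun z => b M z.1 * `|f z.2|)).
  - apply: measurable_funM; first exact: measurable_weighted.
    exact: measurableT_comp (intg_meas fi) (@measurable_snd _ _ (measurableTypeR R) plane).
  - by move=> z; rewrite normrM ler_wpM2r// weighted_le.
  - exact: (intg_prod (b_intg M0) (intg_norm fi)).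
have sec r : intg (mu2 R) (fun y => weighted M (r, y) * f y).
  apply: (@intg_bounded_mul _ _ _ _ _ _ (b M r)) => //.
    exact: (measurableT_comp (@measurable_weighted M)
      (@measurable_pair1 _ _ (measurableTypeR R) plane r)).
  by move=> y; exact: (@weighted_le M (r, y) M0).
have E r : \int[mu2 R]_y (weighted M (r, y) * f y) =
    \1_halfline r * avg_weight M r * trunc_op f x r.
  have [r0|r0] := ltP 0 r.
    rewrite /trunc_op -RintegralZl//; last exact: trunc_op_intg.
    by apply: eq_Rintegral => y _; rewrite /weighted/= mulrA.
  (* For [r <= 0] the truncated kernel may be unbounded, so the weight cannot be taken out of the
     integral; it vanishes instead, also at the end point [r = 0] of the half-line, by the factor
     [r^3]. *)
  have w0 : \1_halfline r * avg_weight M r = 0.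
    rewrite indicE mem_setE in_itv/= andbT; case: (leP 0 r) => r1; last by rewrite mul0r.
    have -> : r = 0 by apply/eqP; rewrite eq_le r0 r1.
    by rewrite avg_weightE expr0n/= mulr0 !mul0r mulr0.
  rewrite w0 mul0r; under eq_Rintegral do rewrite /weighted/= w0 !mul0r.
  by rewrite Rintegral_cst// mul0r.
have := intg_fubini1 wf sec; under eq_fun do rewrite E.
move=> i; split=> //.
under [RHS]eq_Rintegral do rewrite -E.
rewrite -(Rint_mixture (nu := mu1 R) (m := mu2 R) (measurable_weighted M)
  (fun z => weighted_le z M0) (b_intg M0) fi).
by apply: eq_Rintegral => y _; rewrite -smoothed_kernel_average.
Qed.

(* Where [r < dl] the truncation is within [eta] of its limit; elsewhere the
   difference is at most [C <= C r^2 / dl^2], whose average is [2 C / (M dl^2)]. *)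
Lemma smoothed_op_cvg (h : R) : trunc_op f x r @[r --> 0^'+] --> h ->
  smoothed_op n.+1%:R f x @[n --> \oo] --> h.
Proof.
move=> Th; apply/cvgrPdist_le => e e0.
have e20 : 0 < e / 2 by rewrite divr_gt0.
have [dl /= dl0 Tdl] : \forall r \near 0^'+, `|h - trunc_op f x r| <= e / 2.
  by move/cvgrPdist_le : Th; exact.
have {}Tdl r : 0 < r -> r < dl -> `|trunc_op f x r - h| <= e / 2.
  move=> r0 rdl; rewrite distrC; apply: Tdl => //=.
  by rewrite sub0r normrN gtr0_norm.
have If0 : 0 <= If by apply: Rintegral_ge0.
have pi20 : 0 <= (2 * pi)^-1 :> R by rewrite invr_ge0 mulr_ge0 ?pi_ge0.
pose C := (2 * pi)^-1 / dl ^+ 2 * If + `|h|.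
have C0 : 0 <= C by rewrite addr_ge0// mulr_ge0// mulr_ge0// invr_ge0 exprn_ge0// ltW.
have dl2 : 0 < dl ^+ 2 by rewrite exprn_gt0.
have TC r : 0 < r -> `|trunc_op f x r - h| <= e / 2 + C / dl ^+ 2 * r ^+ 2.
  move=> r0; have [rdl|rdl] := ltP r dl.
    apply: le_trans (Tdl _ r0 rdl) _.
    by rewrite lerDl mulr_ge0 ?sqr_ge0// divr_ge0// ltW.
  apply: (@le_trans _ _ C).
    apply: le_trans (ler_normB _ _) _; rewrite lerD2r.
    apply: le_trans (trunc_op_le r0) _; rewrite ler_wpM2r// ler_wpM2l//.
    by rewrite lef_pV2 ?posrE ?exprn_gt0// ler_sqr ?nnegrE// ltW.
  apply: (@le_trans _ _ (C / dl ^+ 2 * r ^+ 2)); last by rewrite lerDr ltW.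
  rewrite -mulrA ler_peMr// mulrC ler_pdivlMr// mul1r.
  by rewrite ler_sqr ?nnegrE// ltW.
have key M : 0 < M -> `|smoothed_op M f x - h| <= e / 2 + C / dl ^+ 2 * (2 / M).
  move=> M0; have [iT ->] := smoothed_op_average M0.
  have [iw ew] := Rint_quad_exp M0 (fun r r0 => avg_weight_ge0 M0 r0).
  (* The coefficients for which the derivative is the weight times [r^2]; the second moment of the
     weight is therefore [2 / M]. *)
  have w2E r : quad_exp' (- (2 / M)) (- (2 / M)) (- M^-1) M r = avg_weight M r * r ^+ 2.
    by rewrite avg_weightE /quad_exp'; field; rewrite gt_eqF.
  have w20 r : 0 <= r -> 0 <= quad_exp' (- (2 / M)) (- (2 / M)) (- M^-1) M r.
    by move=> r0; rewrite w2E mulr_ge0 ?sqr_ge0// avg_weight_ge0.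
  have [iw2 ew2] := Rint_quad_exp M0 w20.
  rewrite opprK in ew; rewrite opprK in ew2.
  set w := fun r => _ * _ in iw ew; set w2 := fun r => _ * _ in iw2 ew2.
  have -> : h = \int[mu1 R]_r (h * w r) by rewrite RintegralZl// ew mulr1.
  have -> : e / 2 + C / dl ^+ 2 * (2 / M) =
      \int[mu1 R]_r (e / 2 * w r + C / dl ^+ 2 * w2 r).
    by rewrite RintegralD// ?RintegralZl// ?ew ?ew2 ?mulr1//; exact: intgZ.
  rewrite -RintegralB//; last exact: intgZ.
  apply: le_trans (le_normr_Rintegral _ _) _ => //.
    by apply: intgB => //; exact: intgZ.
  apply: le_Rintegral => //.
  - by apply: intg_norm; apply: intgB => //; exact: intgZ.
  - by apply: intgD; exact: intgZ.
  - move=> r _; rewrite /w /w2 w2E -/(avg_weight M r).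
    have [r0|r0] := ltP 0 r.
      rewrite indicE mem_setE in_itv/= andbT (ltW r0) !mul1r.
      have -> : avg_weight M r * trunc_op f x r - h * avg_weight M r =
        avg_weight M r * (trunc_op f x r - h) by ring.
      have -> : e / 2 * avg_weight M r + C / dl ^+ 2 * (avg_weight M r * r ^+ 2) =
        avg_weight M r * (e / 2 + C / dl ^+ 2 * r ^+ 2) by ring.
      have w0 := avg_weight_ge0 M0 (ltW r0).
      by rewrite normrM (ger0_norm w0) ler_wpM2l// TC.
    have w0 : \1_halfline r * avg_weight M r = 0.
      rewrite indicE mem_setE in_itv/= andbT; case: (leP 0 r) => r1; last by rewrite mul0r.
      have -> : r = 0 by apply/eqP; rewrite eq_le r0 r1.
      by rewrite avg_weightE expr0n/= mulr0 !mul0r mulr0.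
    by rewrite [X in _ + _ * X]mulrA w0 !mul0r !mulr0 subr0 normr0 addr0.
have : C / dl ^+ 2 * (2 / n.+1%:R) @[n --> \oo] --> C / dl ^+ 2 * (2 * 0).
  apply: cvgM; first exact: cvg_cst.
  by apply: cvgM; [exact: cvg_cst|exact: cvg_harmonic].
rewrite !mulr0 => /cvgrPdist_le /(_ _ e20); apply: filterS => n.
rewrite sub0r normrN => hn; rewrite distrC; apply: le_trans (key _ _) _ => //.
rewrite [leRHS](_ : _ = e / 2 + e / 2); last by field.
by rewrite lerD2l (le_trans _ hn)// ler_norm.
Qed.

End AverageOp.
End Average.

(** * The principal value operator *)

Section Fatou.
Variable R : realType.
Local Notation plane := (measurableTypeR R * measurableTypeR R)%type.
Variable D : set plane.
Hypotheses (mD : measurable D) (iD : intg (mu2 R) (\1_D : plane -> R)).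

Lemma restrict_L2 (f : plane -> R) : measurable_fun D f ->
  (\int[mu2 R]_(x in D) (f x ^+ 2)%:E < +oo)%E ->
  [/\ intg (mu2 R) (f \_ D), intg (mu2 R) (fun x => (f \_ D) x ^+ 2) &
    \int[mu2 R]_x (f \_ D) x ^+ 2 = \int[mu2 R]_(x in D) f x ^+ 2].
Proof.
move=> mf f2.
have mfD : measurable_fun setT (f \_ D) by apply/(measurable_restrictT f mD).
have e2 : (fun x => ((f \_ D) x ^+ 2)%:E) = (fun x => (f x ^+ 2)%:E) \_ D.
  apply/funext => x; rewrite !patchE; case: (_ \in _) => //.
  by rewrite expr0n.
have i2 : intg (mu2 R) (fun x => (f \_ D) x ^+ 2).
  apply: intg_ge0; first exact: measurable_funX.
    by move=> x; exact: sqr_ge0.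
  by rewrite e2 -integral_mkcond.
split => //; last by rewrite /Rintegral e2 -integral_mkcond.
apply: (@intg_le _ _ _ _ _ (fun x => \1_D x + (f \_ D) x ^+ 2)) => //; last exact: intgD.
move=> x; rewrite indicE patchE; case: (_ \in _).
  rewrite -(real_normK (num_real (f x))) mulr1n.
  by have := sqr_ge0 (`|f x| - 1); have := sqr_ge0 (`|f x|); nra.
by rewrite normr0 expr0n addr0.
Qed.

Lemma pv_half_norm (f h : plane -> R) : measurable_fun D f ->
  measurable_fun D h ->
  (\int[mu2 R]_(x in D) (f x ^+ 2)%:E < +oo)%E ->
  {ae mu2 R, forall x, D x -> trunc_op (f \_ D) x r @[r --> 0^'+] --> h x} ->
  (\int[mu2 R]_(x in D) (h x ^+ 2)%:E <=
    ((\int[mu2 R]_(x in D) f x ^+ 2) / 4)%:E)%E.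
Proof.
move=> mf mh f2 pv.
have [fi fi2 <-] := restrict_L2 mf f2.
set f0 := f \_ D in fi fi2 pv *.
pose g n (x : plane) : R := \1_D x * smoothed_op n.+1%:R f0 x.
have mg n : measurable_fun setT (fun x => (g n x ^+ 2)%:E).
  by apply/measurable_EFinP; apply: measurable_funX; exact: measurable_smoothed_op.
have gb n : (\int[mu2 R]_x (g n x ^+ 2)%:E <= ((\int[mu2 R]_x f0 x ^+ 2) / 4)%:E)%E.
  have [] := @smoothed_op_bound R n.+1%:R f0 _ fi D iD fi2 => // i b.
  by rewrite Rint_fin// lee_fin.
rewrite integral_mkcond.
have mhD : measurable_fun setT (h \_ D) by apply/(measurable_restrictT h mD).
have g0 n x : (0 <= (g n x ^+ 2)%:E)%E by rewrite lee_fin sqr_ge0.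
have mliminf : measurable_fun setT (fun x => limn_einf (fun n => (g n x ^+ 2)%:E)).
  rewrite (_ : (fun x => _) =
    \- (fun x => limn_esup (fun n => - (g n x ^+ 2)%:E)))%E.
    apply: measurableT_comp; first exact: oppe_measurable.
    apply: measurable_fun_limn_esup => n.
    by apply: (measurableT_comp _ (mg n)); exact: oppe_measurable.
  apply/funext => x; rewrite -[LHS]oppeK -limn_esupN.
  by congr (- limn_esup _)%E.
have cg x : D x -> trunc_op f0 x r @[r --> 0^'+] --> h x ->
    (limn_einf (fun n => (g n x ^+ 2)%:E) = (h x ^+ 2)%:E)%E.
  move=> Dx Th; have := smoothed_op_cvg fi Th => c.
  apply: (cvg_limn_einf_sup _).1; apply: cvg_EFin; first exact: nearW.
  have Eg n : g n x = smoothed_op n.+1%:R f0 x.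
    by rewrite /g indicE mem_set// mul1r.
  by under eq_fun do rewrite Eg; rewrite expr2; apply: cvgM.
apply: (@le_trans _ _ (\int[mu2 R]_x limn_einf (fun n => (g n x ^+ 2)%:E))%E).
  rewrite le_eqVlt; apply/orP; left; apply/eqP.
  (* Fatou's lemma is applied on the whole plane; off [D] every [g n] is 0, as is the restriction of
     [h]. *)
  have g00 x : ~ D x -> limn_einf (fun n => (g n x ^+ 2)%:E) = 0%E.
    move=> Dx; apply: (cvg_limn_einf_sup _).1.
    rewrite (_ : (fun n => _) = (fun=> 0%E)); first exact: cvg_cst.
    by apply/funext => n; rewrite /g indicE memNset// mul0r expr0n.
  apply: ge0_ae_eq_integral => //.
  - apply/(measurable_restrictT (fun x => (h x ^+ 2)%:E) mD).
    by apply/measurable_EFinP; exact: measurable_funX.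
  - by move=> x _; rewrite patchE; case: ifP => // _; rewrite lee_fin sqr_ge0.
  - move=> x _; rewrite limn_einf_lim; apply: lime_ge; first exact: is_cvg_einfs.
    by apply: nearW => n; apply: le_ereal_inf_tmp => _ [k _ <-].
  - apply: filterS pv => x pvx _; rewrite patchE.
    case: (boolP (x \in D)) => [/set_mem Dx|/negP Dx].
      by rewrite cg//; exact: pvx.
    by rewrite g00// => Dx'; apply: Dx; rewrite inE.
apply: le_trans (fatou (mu2 R) measurableT mg (fun n x _ => g0 n x)) _.
rewrite limn_einf_lim; apply: lime_le; first exact: is_cvg_einfs.
apply: nearW => n; apply: le_trans (gb n); apply: ereal_inf_lbound.
by exists n => /=.
Qed.
End Fatou.

(** * Geometric convergence in the mean square *)

Section L2Series.
Context d (X : measurableType d) (R : realType).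
Variable mu : {measure set X -> \bar R}.

Lemma dominated_series (a : nat -> R) (s r : R) : 0 <= s -> 0 < r < 1 ->
  (forall n, `|a n| <= s * r ^+ n) ->
  exists2 w, series a n @[n --> \oo] --> w &
    forall N, `|w - series a N| <= s * r ^+ N / (1 - r).
Proof.
move=> s0 /andP[r0 r1] ar.
have r1' : 0 < 1 - r by rewrite subr_gt0.
have seriesS N : series a N.+1 = series a N + a N.
  by rewrite /series/= big_nat_recr.
have dist N M : (N <= M)%N ->
    `|series a M - series a N| <= s * (r ^+ N - r ^+ M) / (1 - r).
  elim: M => [|M IH]; first by rewrite leqn0 => /eqP ->; rewrite !subrr normr0 mulr0 mul0r.
  rewrite leq_eqVlt => /orP[/eqP ->|NM]; first by rewrite !subrr normr0 mulr0 mul0r.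
  rewrite seriesS addrAC; apply: le_trans (ler_normD _ _) _.
  apply: le_trans (lerD (IH NM) (ar M)) _.
  rewrite ler_pdivlMr// mulrDl divfK ?gt_eqF// exprS; nra.
have cv : cvgn (series a).
  apply: normed_cvg; apply: (@series_le_cvg _ _ (geometric s r)) => //.
  - by move=> n; exact: normr_ge0.
  - by move=> n; rewrite /geometric/= mulr_ge0// exprn_ge0// ltW.
  - by apply: is_cvg_geometric_series; rewrite ger0_norm// ltW.
exists (limn (series a)) => // N.
have cN : `|series a n - series a N| @[n --> \oo] --> `|limn (series a) - series a N|.
  by apply: cvg_norm; apply: cvgB => //; exact: cvg_cst.
rewrite -(cvg_lim (@Rhausdorff R) cN); apply: limr_le; first by apply/cvg_ex; eexists; exact: cN.
exists N => // M /= NM; apply: le_trans (dist _ _ NM) _.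
rewrite ler_pM2r ?invr_gt0// ler_wpM2l// lerBlDr lerDl exprn_ge0//.
exact: ltW.
Qed.

(** The weighted square function [H], the sum of [a_n^2 / r^(2 n)], has integral at most
    [C / (1 - r^2)], since half of the decay [r^(4 n)] is kept for summation. Where [H] is finite,
    [|a_n| <= sqrt H * r^n]: the series converges pointwise with remainder at most
    [sqrt H * r^N / (1 - r)], and the square of this bound is integrable. *)
Lemma l2_series (a : nat -> X -> R) (C r : R) : 0 <= C -> 0 < r < 1 ->
  (forall n, measurable_fun setT (a n)) ->
  (forall n, (\int[mu]_x (a n x ^+ 2)%:E <= (C * r ^+ (4 * n))%:E)%E) ->
  exists (w : X -> R) (K : R), measurable_fun setT w /\ forall N,
    (\int[mu]_x ((w x - \sum_(0 <= n < N) a n x) ^+ 2)%:E <= (K * r ^+ (2 * N))%:E)%E.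
Proof.
move=> C0 r01 ma a2; have /andP[r0 r1] := r01.
have r1' : 0 < 1 - r by rewrite subr_gt0.
pose h n x := (a n x ^+ 2 / r ^+ (2 * n))%:E.
have h0 n x : (0 <= h n x)%E by rewrite lee_fin divr_ge0 ?sqr_ge0 ?exprn_ge0// ltW.
have mh n : measurable_fun setT (h n).
  by apply/measurable_EFinP; apply: measurable_funM => //; exact: measurable_funX.
pose H x := (\sum_(0 <= n <oo) h n x)%E.
have H0 x : (0 <= H x)%E by apply: nneseries_ge0.
have mH : measurable_fun setT H by apply: ge0_emeasurable_sum.
have HC : (\int[mu]_x H x <= (C / (1 - r ^+ 2))%:E)%E.
  rewrite /H integral_nneseries//.
  apply: lime_le; first by apply: is_cvg_nneseries => n _ _; exact: integral_ge0.
  apply: nearW => n; apply: (@le_trans _ _ (series (geometric C (r ^+ 2)) n)%:E).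
    rewrite /series/= -sumEFin; apply: lee_sum => i _.
    rewrite /h; under eq_integral do rewrite mulrC EFinM.
    rewrite ge0_integralZl//; last first.
    - by rewrite lee_fin invr_ge0 exprn_ge0// ltW.
    - by move=> x _; rewrite lee_fin sqr_ge0.
    - by apply/measurable_EFinP; exact: measurable_funX.
    apply: le_trans (lee_wpmul2l _ (a2 i)) _; first by rewrite lee_fin invr_ge0 exprn_ge0// ltW.
    rewrite -EFinM lee_fin mulrCA ler_wpM2l//.
    have -> : (4 * i = 2 * i + 2 * i)%N by rewrite -mulnDl.
    by rewrite exprD mulKf ?expf_neq0 ?gt_eqF// exprM.
  rewrite lee_fin; apply: geometric_le_lim => //; first exact: exprn_gt0.
  by rewrite ger0_norm ?sqr_ge0// expr_lt1// ltW.
have Hi : mu.-integrable setT H.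
  apply/integrableP; split => //.
  under eq_integral do rewrite gee0_abs//.
  by apply: le_lt_trans HC _; rewrite ltry.
have Hae := integrable_ae measurableT Hi.
have mfin : measurable_fun setT (fun x => H x \is a fin_num).
  rewrite (_ : (fun x => _) = (fun x => H x < +oo)%E).
    exact: measurable_fun_lte.
  by apply/funext => x; rewrite ge0_fin_numE.
(* The terms are set to 0 on the null set where [H] is infinite, so that the pointwise limit exists
   everywhere and is measurable. *)
pose a' n x := if H x \is a fin_num then a n x else 0.
have ma' n : measurable_fun setT (a' n) by apply: measurable_fun_ifT.
pose s x := Num.sqrt (fine (H x)).
have a's x n : `|a' n x| <= s x * r ^+ n.
  rewrite /a' /s; case: ifPn => Hx; last first.
    by rewrite normr0 mulr_ge0 ?exprn_ge0 ?sqrtr_ge0// ltW.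
  have hH : a n x ^+ 2 / r ^+ (2 * n) <= fine (H x).
    rewrite -lee_fin fineK//; apply: (@le_trans _ _ (\sum_(0 <= i < n.+1) h i x)%E).
      by rewrite big_nat_recr//= leeDr// sume_ge0.
    exact: nneseries_lim_ge.
  rewrite -(@ler_sqr _ `|_|) ?nnegrE ?mulr_ge0 ?exprn_ge0 ?sqrtr_ge0 ?(ltW r0)//.
  rewrite (real_normK (num_real _)) exprMn sqr_sqrtr ?fine_ge0//.
  by move: hH; rewrite ler_pdivrMr ?exprn_gt0// mulnC exprM.
have /choice[w wP] x : exists w, series (a'^~ x) n @[n --> \oo] --> w /\
    forall N, `|w - series (a'^~ x) N| <= s x * r ^+ N / (1 - r).
  have [w w1 w2] := dominated_series (sqrtr_ge0 _) r01 (a's x).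
  by exists w.
have mw : measurable_fun setT w.
  apply: (measurable_fun_cvg (h := fun n x => series (a'^~ x) n)).
    by move=> n; apply: measurable_sum.
  by move=> x _; have [] := wP x.
exists w, (C / (1 - r ^+ 2) / (1 - r) ^+ 2); split=> // N.
apply: (@le_trans _ _ (\int[mu]_x ((r ^+ (2 * N) / (1 - r) ^+ 2)%:E * H x))%E).
  apply: ae_ge0_le_integral => //.
  - by move=> x _; rewrite lee_fin sqr_ge0.
  - apply/measurable_EFinP/measurable_funX/measurable_funB => //.
    exact: measurable_sum.
  - by move=> x _; rewrite mule_ge0// lee_fin divr_ge0 ?sqr_ge0// exprn_ge0// ltW.
  - exact: measurable_funeM.
  - apply: filterS Hae => x /(_ I) Hx _.
    have [_ /(_ N)] := wP x.
    have -> : series (a'^~ x) N = \sum_(0 <= n < N) a n x.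
      by rewrite /series/=; apply: eq_bigr => i _; rewrite /a' Hx.
    move=> wN; rewrite -(fineK Hx) -EFinM lee_fin -(real_normK (num_real (w x - _))).
    apply: (@le_trans _ _ ((s x * r ^+ N / (1 - r)) ^+ 2)).
      by rewrite ler_sqr ?nnegrE// (le_trans _ wN).
    rewrite !exprMn sqr_sqrtr ?fine_ge0// exprVn -exprM (mulnC N).
    by rewrite [leRHS]mulrC mulrA.
rewrite ge0_integralZl//; last by rewrite lee_fin divr_ge0 ?sqr_ge0// exprn_ge0// ltW.
apply: le_trans (lee_wpmul2l _ HC) _.
  by rewrite lee_fin divr_ge0 ?sqr_ge0// exprn_ge0// ltW.
by rewrite -EFinM lee_fin le_eqVlt; apply/orP; left; apply/eqP; ring.
Qed.

End L2Series.

Import ComplexField.Normc.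
Local Open Scope complex_scope.

#[global] Instance ae_leb2_filter (R : realType) :
  Filter (nbhs (almost_everywhere (@leb2 R))).
Proof. exact: (ae_filter_ringOfSetsType (@leb2 R)). Qed.

(** * Complex square-integrable functions *)

Section L2Space.
Variable R : realType.
Local Notation plane := (measurableTypeR R * measurableTypeR R)%type.
Local Notation Re := (@complex.Re R).
Local Notation Im := (@complex.Im R).
Variable D : set plane.
Hypothesis mD : measurable D.
Implicit Types (u v w : plane -> R[i]).

Lemma normc_sqr (z : R[i]) : normc z ^+ 2 = Re z ^+ 2 + Im z ^+ 2.
Proof. by case: z => a b /=; rewrite sqr_sqrtr// addr_ge0 ?sqr_ge0. Qed.

Definition cmeas u := measurable_fun D (Re \o u) /\ measurable_fun D (Im \o u).

Lemma cmeas_sqr u : cmeas u -> measurable_fun D (fun x => (normc (u x) ^+ 2)%:E).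
Proof.
move=> [mr mi]; apply/measurable_EFinP.
under eq_fun do rewrite normc_sqr.
by apply: measurable_funD; exact: measurable_funX.
Qed.

Lemma L2_cmeas u : L2 D u -> cmeas u.
Proof. by case. Qed.

Lemma cmeas_lin c u v : cmeas u -> cmeas v -> cmeas (fun x => c * u x + v x).
Proof.
case: c => a b [mr mi] [mr' mi']; split.
- rewrite (_ : _ \o _ = fun x => a * (Re \o u) x - b * (Im \o u) x + (Re \o v) x).
    apply: measurable_funD => //; apply: measurable_funB;
    exact: measurable_funM.
  by apply/funext => x /=; case: (u x) => ? ?; case: (v x).
- rewrite (_ : _ \o _ = fun x => a * (Im \o u) x + b * (Re \o u) x + (Im \o v) x).
    apply: measurable_funD => //; apply: measurable_funD;
    exact: measurable_funM.
  by apply/funext => x /=; case: (u x) => ? ?; case: (v x).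
Qed.

Lemma sqnorm2_ge0 u : (0 <= sqnorm2 D u)%E.
Proof. by apply: integral_ge0 => x _; rewrite lee_fin sqr_ge0. Qed.

Lemma sqnorm2_le_comb (al be : R) u v w : 0 <= al -> 0 <= be ->
  cmeas u -> cmeas v -> cmeas w ->
  {ae @leb2 R, forall x, D x -> normc (w x) ^+ 2 <=
     al * normc (u x) ^+ 2 + be * normc (v x) ^+ 2} ->
  (sqnorm2 D w <= al%:E * sqnorm2 D u + be%:E * sqnorm2 D v)%E.
Proof.
move=> al0 be0 mu mv mw h.
have n0 z x : (0 <= (normc (z x : R[i]) ^+ 2)%:E)%E by rewrite lee_fin sqr_ge0.
rewrite /sqnorm2 -!ge0_integralZl//; try exact: cmeas_sqr.
rewrite -ge0_integralD//; first last.
- by apply: measurable_funeM; exact: cmeas_sqr.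
- by move=> x _; rewrite mule_ge0.
- by apply: measurable_funeM; exact: cmeas_sqr.
- by move=> x _; rewrite mule_ge0.
apply: ae_ge0_le_integral => //.
- exact: cmeas_sqr.
- by move=> x _; rewrite adde_ge0// mule_ge0.
- by apply: emeasurable_funD; apply: measurable_funeM; exact: cmeas_sqr.
Qed.

Lemma ae_eq_onP u v :
  {ae @leb2 R, forall x, D x -> normc (u x - v x) ^+ 2 = 0} -> ae_eq_on D u v.
Proof.
apply: filterS => x h Dx; have /eqP := h Dx.
rewrite sqrf_eq0 => /eqP /eq0_normc => e.
by apply/eqP; rewrite -subr_eq0; apply/eqP.
Qed.

Lemma sqnorm2_eq0 u v : cmeas u -> cmeas v ->
  (sqnorm2 D (fun x => (-1) * v x + u x)%R <= 0)%E -> ae_eq_on D u v.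
Proof.
move=> mu mv s0; apply: ae_eq_onP.
have m := cmeas_sqr (cmeas_lin (-1) mv mu).
have z : (\int[@leb2 R]_(x in D) `|(normc ((-1) * v x + u x)%R ^+ 2)%:E|)%E = 0%E.
  apply/eqP; rewrite eq_le; apply/andP; split; last exact: integral_ge0.
  apply: le_trans s0; rewrite /sqnorm2 le_eqVlt; apply/orP; left; apply/eqP.
  by apply: eq_integral => x _; rewrite gee0_abs// lee_fin sqr_ge0.
have := (ae_eq_integral_abs (@leb2 R) mD m).1 z.
apply: filterS => x h Dx; have := h Dx; rewrite mulN1r addrC => -[].
by [].
Qed.

Lemma L2_comb (al be : R) u v w : L2 D u -> L2 D v -> cmeas w ->
  0 <= al -> 0 <= be ->
  {ae @leb2 R, forall x, D x -> normc (w x) ^+ 2 <=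
     al * normc (u x) ^+ 2 + be * normc (v x) ^+ 2} -> L2 D w.
Proof.
move=> Lu Lv mw al0 be0 h; case: (mw) => ? ?; split => //.
apply: le_lt_trans (sqnorm2_le_comb al0 be0 (L2_cmeas Lu) (L2_cmeas Lv) mw h) _.
have [_ _ fu] := Lu; have [_ _ fv] := Lv.
by apply: lte_add_pinfty; apply: lte_mul_pinfty.
Qed.

(** Young's inequality with a free weight. The value [t = 1] suffices for qualitative estimates,
    whereas the lower bound for [lam - A] takes [t] depending on [lam], to work for all [lam ^+ 2]
    above 1/4. *)
Lemma normc_lin_le (c z1 z2 : R[i]) (t : R) : 0 < t ->
  normc (c * z1 + z2) ^+ 2 <=
  (1 + t) * normc c ^+ 2 * normc z1 ^+ 2 + (1 + t^-1) * normc z2 ^+ 2.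
Proof.
move=> t0; have n0 (z : R[i]) : 0 <= normc z by case: z => ? ? /=.
apply: (@le_trans _ _ ((normc c * normc z1 + normc z2) ^+ 2)).
  rewrite ler_sqr ?nnegrE ?addr_ge0 ?mulr_ge0// -normcM.
  exact: le_normcD.
set p := normc c * normc z1.
rewrite (_ : (1 + t) * _ * _ = (1 + t) * p ^+ 2); last by rewrite /p; ring.
set q := normc z2.
have := sqr_ge0 (t * p - q) => h.
rewrite -subr_ge0 (_ : _ - _ = (t * p - q) ^+ 2 / t); last by field; rewrite gt_eqF.
by rewrite divr_ge0// ltW.
Qed.

Lemma L2_lin c u v : L2 D u -> L2 D v -> L2 D (fun x => c * u x + v x).
Proof.
move=> Lu Lv.
apply: (@L2_comb (2 * normc c ^+ 2) 2 u v) => //.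
- exact: (cmeas_lin c (L2_cmeas Lu) (L2_cmeas Lv)).
- by rewrite mulr_ge0// sqr_ge0.
- apply: aeW => x _; have := normc_lin_le c (u x) (v x) ltr01.
  by rewrite invr1.
Qed.

End L2Space.

Section PrincipalValue.
Variable R : realType.
Local Notation plane := (measurableTypeR R * measurableTypeR R)%type.
Local Notation Re := (@complex.Re R).
Local Notation Im := (@complex.Im R).
Variable D : set plane.
Hypotheses (mD : measurable D) (iD : intg (mu2 R) (\1_D : plane -> R)).

Lemma trunc_opE (f : plane -> R) x r :
  \int[@leb2 R]_(y in D `&` [set y | r < enorm (x - y)]) (cz_kernel (x - y) * f y)
  = trunc_op (f \_ D) x r.
Proof.
rewrite Rint_indic; apply: eq_Rintegral => y _.
rewrite /trunc_kernel patchE indicE in_setI.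
have -> : (y \in [set y | r < enorm (x - y)]) = (r < enorm (x - y)).
  by apply/idP/idP; rewrite inE.
case: (y \in D) => /=; last by rewrite mul0r mulr0.
by rewrite mulrA.
Qed.

Lemma Re_truncated u x r :
  Re (truncated cz_kernel D u x r) = trunc_op ((Re \o u) \_ D) x r.
Proof.
rewrite -trunc_opE /truncated /Cint/=; apply: eq_Rintegral => y _.
by case: (u y) => a b /=; rewrite mul0r subr0.
Qed.

Lemma Im_truncated u x r :
  Im (truncated cz_kernel D u x r) = trunc_op ((Im \o u) \_ D) x r.
Proof.
rewrite -trunc_opE /truncated /Cint/=; apply: eq_Rintegral => y _.
by case: (u y) => a b /=; rewrite mul0r addr0.
Qed.

Lemma sqnorm2_split u : cmeas D u ->
  (sqnorm2 D u = \int[mu2 R]_(x in D) (Re (u x) ^+ 2)%:E +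
                 \int[mu2 R]_(x in D) (Im (u x) ^+ 2)%:E)%E.
Proof.
move=> [mr mi]; rewrite /sqnorm2 -ge0_integralD//.
- by apply: eq_integral => x _; rewrite normc_sqr.
- by move=> x _; rewrite lee_fin sqr_ge0.
- by apply/measurable_EFinP; exact: measurable_funX.
- by move=> x _; rewrite lee_fin sqr_ge0.
- by apply/measurable_EFinP; exact: measurable_funX.
Qed.

(** The kernel is real, so the real and imaginary parts of [u] have separate principal values, and
    the real bound applies to each. *)
Lemma pv_sqnorm2_le u v : L2 D u -> L2 D v ->
  {ae @leb2 R, forall x, D x -> is_pv cz_kernel D u x (v x)} ->
  (sqnorm2 D v <= (4^-1)%:E * sqnorm2 D u)%E.
Proof.
move=> Lu Lv pv; have cu := L2_cmeas Lu; have cv := L2_cmeas Lv.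
have [mur mui fu] := Lu; have [mvr mvi fv] := Lv.
have i0 (f : plane -> R) : (0 <= \int[mu2 R]_(x in D) (f x ^+ 2)%:E)%E.
  by apply: integral_ge0 => x _; rewrite lee_fin sqr_ge0.
rewrite sqnorm2_split// in fu.
have fur : (\int[mu2 R]_(x in D) (Re (u x) ^+ 2)%:E < +oo)%E.
  by apply: le_lt_trans fu; rewrite leeDl.
have fui : (\int[mu2 R]_(x in D) (Im (u x) ^+ 2)%:E < +oo)%E.
  by apply: le_lt_trans fu; rewrite leeDr.
rewrite !sqnorm2_split// ge0_muleDr//; apply: leeD.
- have := @pv_half_norm R D mD iD (Re \o u) (Re \o v) mur mvr fur.
  rewrite mulrC EFinM /Rintegral fineK ?ge0_fin_numE//; apply.
  apply: filterS pv => x h Dx; have [c _] := h Dx.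
  by move: c; under eq_fun do rewrite Re_truncated.
- have := @pv_half_norm R D mD iD (Im \o u) (Im \o v) mui mvi fui.
  rewrite mulrC EFinM /Rintegral fineK ?ge0_fin_numE//; apply.
  apply: filterS pv => x h Dx; have [_ c] := h Dx.
  by move: c; under eq_fun do rewrite Im_truncated.
Qed.

End PrincipalValue.

(** * Inversion by a Neumann series *)

Section Neumann.
Variable R : realType.
Local Notation plane := (measurableTypeR R * measurableTypeR R)%type.
Local Notation Re := (@complex.Re R).
Local Notation Im := (@complex.Im R).
Variables (D : set plane) (A : (plane -> R[i]) -> plane -> R[i]) (lam : R).
Hypotheses (mD : measurable D) (bA : bounded_operator D A).
Hypothesis A_half : forall u, L2 D u ->
  (sqnorm2 D (A u) <= (4^-1)%:E * sqnorm2 D u)%E.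
Hypothesis lam_gt : 4^-1 < lam ^+ 2.

Let B u (x : plane) : R[i] := lam%:C * u x - A u x.

Let L2A u : L2 D u -> L2 D (A u).
Proof. by case: bA => + _ _; exact. Qed.

Let A_lin c u v : L2 D u -> L2 D v ->
  ae_eq_on D (A (fun x => c * u x + v x)) (fun x => c * A u x + A v x).
Proof. by case: bA => _ + _; exact. Qed.

Lemma L2B u : L2 D u -> L2 D (B u).
Proof.
move=> Lu; have := L2_lin mD (-1) (L2A Lu) (L2_lin mD (lam%:C - 1) Lu Lu).
congr (L2 D _); apply/funext => x; rewrite /B; ring.
Qed.

Lemma B_lin c u v : L2 D u -> L2 D v ->
  ae_eq_on D (B (fun x => c * u x + v x)) (fun x => c * B u x + B v x).
Proof.
move=> Lu Lv; have := A_lin c Lu Lv; apply: filterS => x h Dx.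
by rewrite /B h//; ring.
Qed.

(** Young's weight is [t = 2 lam^2 - 1/2], so that [1 + t] is the midpoint of 1 and [4 lam^2]. The
    contribution [(1 + t) / 4] of [A] then stays below [lam^2], and the difference [lam^2 / 2 - 1/8]
    is the denominator. *)
Let K0 : R := (1 + (2 * lam ^+ 2 - 2^-1)^-1) / (lam ^+ 2 / 2 - 8^-1).

Let K0_ge0 : 0 <= K0.
Proof.
have t0 : 0 <= 2 * lam ^+ 2 - 2^-1 by move: lam_gt; lra.
have l0 : 0 <= lam ^+ 2 / 2 - 8^-1 by move: lam_gt; lra.
by rewrite divr_ge0// addr_ge0// invr_ge0.
Qed.

Let normc_real : normc lam%:C ^+ 2 = lam ^+ 2.
Proof. by rewrite normc_sqr/= expr0n addr0. Qed.

(* Comparing [lam w = B w + A w] with [|A w| <= |w| / 2 < |lam w|]. *)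
Lemma B_bounded_below w : L2 D w -> (sqnorm2 D w <= K0%:E * sqnorm2 D (B w))%E.
Proof.
move=> Lw; have LB := L2B Lw.
set t := 2 * lam ^+ 2 - 2^-1; have t0 : 0 < t by rewrite /t; move: lam_gt; lra.
have l2 : 0 < lam ^+ 2 / 2 - 8^-1 by move: lam_gt; lra.
have l0 : lam ^+ 2 != 0 by rewrite gt_eqF//; move: lam_gt; lra.
have h : (sqnorm2 D w <= ((1 + t) / lam ^+ 2)%:E * sqnorm2 D (A w) +
                   ((1 + t^-1) / lam ^+ 2)%:E * sqnorm2 D (B w))%E.
  apply: sqnorm2_le_comb (L2_cmeas (L2A Lw)) (L2_cmeas LB) (L2_cmeas Lw) _ => //.
  - by rewrite divr_ge0 ?sqr_ge0// addr_ge0// ltW.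
  - by rewrite divr_ge0 ?sqr_ge0// addr_ge0// invr_ge0 ltW.
  - apply: aeW => x _; have := normc_lin_le 1 (A w x) (B w x) t0.
    have -> : 1 * A w x + B w x = lam%:C * w x by rewrite /B; ring.
    rewrite normcM exprMn normc_real normc1 expr1n mulr1 => h.
    rewrite -(@ler_pM2l _ (lam ^+ 2)) ?lt0r ?l0 ?sqr_ge0//.
    apply: le_trans h _; rewrite le_eqVlt; apply/orP; left; apply/eqP.
    have e c : lam ^+ 2 * (c / lam ^+ 2) = c by rewrite mulrC divfK.
    by rewrite mulrDr ![lam ^+ 2 * (_ / _ * _)]mulrA !e.
have [_ _ fw] := Lw; have [_ _ fB] := LB; have [_ _ fA] := L2A Lw.
have hA := A_half Lw.
have f1 u : (sqnorm2 D u < +oo)%E -> sqnorm2 D u = (fine (sqnorm2 D u))%:E.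
  by move=> fu; rewrite fineK// ge0_fin_numE// sqnorm2_ge0.
move: h hA; rewrite (f1 _ fw) (f1 _ fB) (f1 _ fA) -!EFinM -EFinD !lee_fin.
set p := fine _; set q := fine _; set a := fine _ => h hA.
have p0 : 0 <= p by rewrite fine_ge0 ?sqnorm2_ge0.
have h2 : p * lam ^+ 2 <= (1 + t) * q + (1 + t^-1) * a.
  have lp : 0 < lam ^+ 2 by rewrite lt0r l0 sqr_ge0.
  move: h; rewrite mulrAC [X in _ + X]mulrAC -mulrDl ler_pdivlMr//.
rewrite /K0 -/t mulrAC ler_pdivlMr//.
have h3 : (1 + t) * q <= (1 + t) * (4^-1 * p).
  by rewrite ler_wpM2l// addr_ge0// ltW.
have -> : p * (lam ^+ 2 / 2 - 8^-1) = p * lam ^+ 2 - (1 + t) * (4^-1 * p).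
  by rewrite /t; field.
by lra.
Qed.

Let L2_0 : L2 D (fun=> 0 : R[i]).
Proof.
have e (f : R[i] -> R) : f 0 = 0 -> measurable_fun D (fun _ : plane => f 0).
  by move=> ->; exact: measurable_cst.
split; [exact: measurable_cst|exact: measurable_cst|].
rewrite /sqnorm2; under eq_integral do rewrite normc0 expr0n/=.
by rewrite integral0.
Qed.

Lemma B_injective u v : L2 D u -> L2 D v -> ae_eq_on D (B u) (B v) ->
  ae_eq_on D u v.
Proof.
move=> Lu Lv Buv; have Lw := L2_lin mD (-1) Lv Lu.
apply: (sqnorm2_eq0 mD (L2_cmeas Lu) (L2_cmeas Lv)).
apply: le_trans (B_bounded_below Lw) _.
suff -> : sqnorm2 D (B (fun x => (-1) * v x + u x)) = 0%E by rewrite mule0.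
transitivity (sqnorm2 D (fun=> 0 : R[i])); last first.
  rewrite /sqnorm2; under eq_integral do rewrite normc0 expr0n/=.
  by rewrite integral0.
apply: ge0_ae_eq_integral => //.
- exact: cmeas_sqr (L2_cmeas (L2B Lw)).
- by move=> x _; rewrite lee_fin sqr_ge0.
- by move=> x _; rewrite lee_fin sqr_ge0.
- have h := B_lin (-1) Lv Lu; apply: filterS2 h Buv => x h1 h2 Dx.
  by rewrite h1// h2//; congr ((normc _ ^+ 2)%:E); ring.
Qed.

(** The summand 0 here and the factor 1 in [neumann_sum] bring each step to the shape [c * u + v],
    for which membership in [L2] and linearity modulo null sets are stated. *)
Fixpoint neumann_term (u : plane -> R[i]) n : plane -> R[i] :=
  if n is m.+1 then (fun x => (lam^-1)%:C * A (neumann_term u m) x + 0)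
  else (fun x => (lam^-1)%:C * u x + 0).

Fixpoint neumann_sum u n : plane -> R[i] :=
  if n is m.+1 then (fun x => 1 * neumann_term u m x + neumann_sum u m x)
  else (fun=> 0).

Lemma L2_neumann_term u n : L2 D u -> L2 D (neumann_term u n).
Proof.
by move=> Lu; elim: n => [|n IH] /=; apply: L2_lin => //; exact: L2A.
Qed.

Lemma L2_neumann_sum u n : L2 D u -> L2 D (neumann_sum u n).
Proof.
by move=> Lu; elim: n => [|n IH] //=; apply: L2_lin => //; exact: L2_neumann_term.
Qed.

Lemma lam_neq0 : lam != 0.
Proof. by apply/eqP => l0; move: lam_gt; rewrite l0 expr0n/=; lra. Qed.

(** The recursion [lam S_(n+1) = u + A S_n] of the partial sums. Shifting one index keeps the
    identity free of a remainder term. *)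
Lemma neumann_sum_eq u n : L2 D u ->
  ae_eq_on D (fun x => lam%:C * neumann_sum u n.+1 x - A (neumann_sum u n) x) u.
Proof.
have lC : lam%:C * (lam^-1)%:C = 1 by rewrite -rmorphM/= mulfV ?lam_neq0.
move=> Lu; elim: n => [|n IH].
  (* Linearity holds only almost everywhere, so even [A 0 = 0] has to be extracted from
     [A (1 * 0 + 0) = 1 * A 0 + A 0]. *)
  have : ae_eq_on D (A (fun=> 0)) (fun=> 0).
    have := A_lin 1 L2_0 L2_0.
    rewrite (_ : (fun _ => 1 * 0 + 0) = (fun=> 0)); last first.
      by apply/funext => ?; rewrite mul1r addr0.
    apply: filterS => x h Dx; have := h Dx; rewrite mul1r => /eqP.
    by rewrite -subr_eq0 opprD addrA subrr sub0r oppr_eq0 => /eqP.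
  apply: filterS => x h Dx; rewrite /= h// subr0 mul1r !addr0 mulrA lC mul1r.
  by [].
have Lt := L2_neumann_term n Lu; have Ls := L2_neumann_sum n Lu.
have h1 := A_lin 1 Lt Ls; apply: filterS2 IH h1 => x h h2 Dx.
rewrite -[RHS]h// [A (neumann_sum u n.+1) x]h2// /=.
rewrite [LHS](_ : _ = lam%:C * (lam^-1)%:C * A (neumann_term u n) x +
  lam%:C * (1 * neumann_term u n x + neumann_sum u n x) -
  (1 * A (neumann_term u n) x + A (neumann_sum u n) x)); last by ring.
by rewrite lC; ring.
Qed.

Let q : R := (4 * lam ^+ 2)^-1.

Lemma neumann_term_le u n : L2 D u -> (sqnorm2 D (neumann_term u n) <=
  (lam ^- 2 * q ^+ n)%R%:E * sqnorm2 D u)%E.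
Proof.
have nl : normc (lam^-1)%:C ^+ 2 = lam ^- 2.
  by rewrite normc_sqr/= expr0n addr0 exprVn.
have step v : L2 D v -> (sqnorm2 D (fun x => ((lam^-1)%:C * v x + 0)%R) =
    (lam ^- 2)%R%:E * sqnorm2 D v)%E.
  move=> Lv; rewrite /sqnorm2 -ge0_integralZl//.
  - by apply: eq_integral => x _; rewrite addr0 normcM exprMn nl EFinM.
  - exact: cmeas_sqr (L2_cmeas Lv).
  - by move=> x _; rewrite lee_fin sqr_ge0.
  - by rewrite lee_fin invr_ge0 sqr_ge0.
move=> Lu; elim: n => [|n IH] /=; first by rewrite step// expr0 mulr1.
have Lt := L2_neumann_term n Lu.
rewrite step; last exact: L2A.
apply: (@le_trans _ _ ((lam ^- 2)%R%:E * ((4^-1)%:E * sqnorm2 D (neumann_term u n)))%E).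
  apply: lee_wpmul2l; last exact: A_half.
  by rewrite lee_fin invr_ge0 sqr_ge0.
rewrite muleA -EFinM.
apply: le_trans (lee_wpmul2l _ IH) _.
  by rewrite lee_fin mulr_ge0// invr_ge0 sqr_ge0.
rewrite muleA -EFinM (_ : lam ^- 2 * 4^-1 * (lam ^- 2 * q ^+ n) = lam ^- 2 * q ^+ n.+1)//.
have qE : q = 4^-1 * lam ^- 2 by rewrite /q invfM.
rewrite [q ^+ n.+1]exprS; move: (q ^+ n) => p; rewrite qE.
by move: (lam ^- 2) => l; ring.
Qed.

Lemma neumann_series u : L2 D u -> exists w (K r : R),
  [/\ L2 D w, 0 <= r < 1 & forall N,
    (sqnorm2 D (fun x => ((-1) * neumann_sum u N x + w x)%R) <=
      (K * r ^+ N)%:E)%E].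
Proof.
move=> Lu; have l2 : 0 < 4 * lam ^+ 2 by move: lam_gt; lra.
have q0 : 0 < q by rewrite invr_gt0.
have q1 : q < 1 by rewrite invf_lt1//; move: lam_gt; lra.
(* The fourth root of [q]: the squared norms decay like [q ^+ n], and [l2_series] expects the rate
   [r ^+ (4 * n)]. *)
pose r := Num.sqrt (Num.sqrt q).
have r4 n : r ^+ (4 * n) = q ^+ n.
  by rewrite exprM (exprM _ 2 2) !sqr_sqrtr ?sqrtr_ge0// ltW.
have r0 : 0 < r by rewrite !sqrtr_gt0.
have r1 : r < 1.
  by rewrite -(@expr_lt1 _ 4)// ?ltW// -[4%N]muln1 r4 expr1.
have [_ _ fu] := Lu.
have fu' : sqnorm2 D u = (fine (sqnorm2 D u))%:E.
  by rewrite fineK// ge0_fin_numE// sqnorm2_ge0.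
pose C := lam ^- 2 * fine (sqnorm2 D u).
have C0 : 0 <= C by rewrite mulr_ge0 ?invr_ge0 ?sqr_ge0// fine_ge0// sqnorm2_ge0.
have aC n : (sqnorm2 D (neumann_term u n) <= (C * r ^+ (4 * n))%:E)%E.
  apply: le_trans (neumann_term_le n Lu) _.
  by rewrite r4 fu' -EFinM lee_fin /C mulrAC.
have part (P : R[i] -> R) : (forall u, cmeas D u -> measurable_fun D (P \o u)) ->
    (forall z, P z ^+ 2 <= normc z ^+ 2) -> P 0 = 0 ->
    (forall z1 z2, P (z1 + z2) = P z1 + P z2) ->
    exists (w : plane -> R) (K : R), measurable_fun setT w /\ forall N,
    (\int[mu2 R]_(x in D) ((w x - P (neumann_sum u N x)) ^+ 2)%:E <=
      (K * r ^+ (2 * N))%:E)%E.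
  move=> mP P2 P0 PD.
  pose a n := (P \o neumann_term u n) \_ D.
  have mt n : measurable_fun D (P \o neumann_term u n).
    exact: mP (L2_cmeas (L2_neumann_term n Lu)).
  have ma n : measurable_fun setT (a n).
    by apply/(measurable_restrictT (P \o neumann_term u n) mD).
  have [||w [K [mw wK]]] := @l2_series _ _ R (mu2 R) a C r C0 _ ma.
  - by rewrite r0 r1.
  - move=> n; apply: le_trans (aC n).
    rewrite (_ : (fun x => _) = (fun x => (P (neumann_term u n x) ^+ 2)%:E) \_ D).
      rewrite -integral_mkcond; apply: ge0_le_integral => //.
      + by move=> x _; rewrite lee_fin sqr_ge0.
      + by apply/measurable_EFinP; apply: measurable_funX; exact: mt.
      + exact: cmeas_sqr (L2_cmeas (L2_neumann_term n Lu)).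
      + by move=> x _; rewrite lee_fin.
    by apply/funext => x; rewrite /a !patchE; case: ifP => // _; rewrite expr0n.
  exists w, K; split => // N; apply: le_trans (wK N).
  have sE x : D x -> P (neumann_sum u N x) = \sum_(0 <= n < N) a n x.
    move=> Dx; elim: N => [|N IH]; first by rewrite big_geq//= P0.
    by rewrite big_nat_recr//= PD mul1r IH addrC /a patchE mem_set.
  apply: (@le_trans _ _
      (\int[mu2 R]_(x in D) ((w x - \sum_(0 <= n < N) a n x) ^+ 2)%:E)%E).
    rewrite le_eqVlt; apply/orP; left; apply/eqP.
    by apply: eq_integral => x /set_mem Dx; rewrite sE.
  apply: ge0_subset_integral => //.
    apply/measurable_EFinP; apply: measurable_funX; apply: measurable_funB => //.
    exact: measurable_sum.
  by move=> x _; rewrite lee_fin sqr_ge0.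
have [||||wr [Kr [mwr wrK]]] := part Re.
- by move=> v [].
- by move=> z; rewrite normc_sqr lerDl sqr_ge0.
- by [].
- by move=> [? ?] [? ?].
have [||||wi [Ki [mwi wiK]]] := part Im.
- by move=> v [].
- by move=> z; rewrite normc_sqr lerDr sqr_ge0.
- by [].
- by move=> [? ?] [? ?].
pose w x : R[i] := wr x +i* wi x.
have cw : cmeas D w by split; exact: measurable_funTS.
have wK N : (sqnorm2 D (fun x => ((-1) * neumann_sum u N x + w x)%R) <=
      ((Kr + Ki) * (r ^+ 2) ^+ N)%:E)%E.
  rewrite sqnorm2_split//; last first.
    exact: cmeas_lin (L2_cmeas (L2_neumann_sum N Lu)) cw.
  rewrite mulrDl -exprM EFinD; apply: leeD.
    apply: le_trans (wrK N); rewrite le_eqVlt; apply/orP; left; apply/eqP.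
    apply: eq_integral => x _; rewrite mulN1r.
    by case: (neumann_sum u N x) => a b /=; rewrite addrC.
  apply: le_trans (wiK N); rewrite le_eqVlt; apply/orP; left; apply/eqP.
  apply: eq_integral => x _; rewrite mulN1r.
  by case: (neumann_sum u N x) => a b /=; rewrite addrC.
exists w, (Kr + Ki), (r ^+ 2); split => //.
  have [mr mi] := cw; split => //; have := wK 0%N; rewrite expr0 mulr1 /=.
  rewrite (_ : (fun x => _) = w); last by apply/funext => x; rewrite mulr0 add0r.
  by move=> h; apply: le_lt_trans h _; rewrite ltry.
by rewrite sqr_ge0/= expr_lt1// ltW.
Qed.

(** With [e_N = w - S_N], the recursion gives [B w - u = lam e_(N+1) - A e_N] almost everywhere for
    every [N]. The right side tends to 0 in norm and the left side does not depend on [N]. *)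
Lemma B_surjective u : L2 D u -> exists2 w, L2 D w & ae_eq_on D (B w) u.
Proof.
move=> Lu; have [w [K [r [Lw /andP[r0 r1] wK]]]] := neumann_series Lu.
exists w => //; have LB := L2B Lw.
apply: (sqnorm2_eq0 mD (L2_cmeas LB) (L2_cmeas Lu)).
pose e N (x : plane) := (-1) * neumann_sum u N x + w x.
have Le N : L2 D (e N) by apply: L2_lin => //; exact: L2_neumann_sum.
pose K' := 2 * lam ^+ 2 * `|K| + 2^-1 * `|K|.
have Lv := L2_lin mD (-1) Lu LB; have [_ _ fv] := Lv.
have bound N : (sqnorm2 D (fun x => ((-1) * u x + B w x)%R) <= (K' * r ^+ N)%:E)%E.
  apply: le_trans (sqnorm2_le_comb mD (al := 2 * lam ^+ 2) (be := 2) (u := e N.+1)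
    (v := A (e N)) _ _ (L2_cmeas (Le _)) (L2_cmeas (L2A (Le _))) (L2_cmeas Lv) _) _ => //.
  - by rewrite mulr_ge0// sqr_ge0.
  - have h1 := neumann_sum_eq N Lu.
    have h2 := A_lin (-1) (L2_neumann_sum N Lu) Lw.
    apply: filterS2 h1 h2 => x h1 h2 Dx.
    have := normc_lin_le lam%:C (e N.+1 x) (- A (e N) x) ltr01.
    rewrite invr1 normc_real normcN; apply: le_trans.
    rewrite -(h1 Dx) (h2 Dx) /e le_eqVlt; apply/orP; left; apply/eqP.
    by congr (normc _ ^+ 2); rewrite /B; ring.
  apply: (@le_trans _ _ ((2 * lam ^+ 2)%:E * (K * r ^+ N.+1)%:E +
     2%:E * (4^-1%:E * (K * r ^+ N)%:E))%E).
    apply: leeD; apply: lee_wpmul2l => //.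
    + by rewrite lee_fin mulr_ge0// sqr_ge0.
    + exact: wK.
    + by apply: le_trans (A_half (Le N)) _; apply: lee_wpmul2l => //; exact: wK.
  rewrite -!EFinM -EFinD lee_fin /K' [leRHS]mulrDl; apply: lerD.
    have l20 : 0 <= 2 * lam ^+ 2 by rewrite mulr_ge0// sqr_ge0.
    rewrite -[leRHS]mulrA ler_wpM2l//.
    apply: (@le_trans _ _ (`|K| * r ^+ N.+1)).
      by rewrite ler_wpM2r ?exprn_ge0// ler_norm.
    by rewrite ler_wpM2l// exprS ler_piMl ?exprn_ge0// ltW.
  have -> : 2 * (4^-1 * (K * r ^+ N)) = 2^-1 * (K * r ^+ N) by field.
  by rewrite -[leRHS]mulrA ler_wpM2l// ler_wpM2r ?exprn_ge0// ler_norm.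
have fv' : sqnorm2 D (fun x => ((-1) * u x + B w x)%R) =
    (fine (sqnorm2 D (fun x => ((-1) * u x + B w x)%R)))%:E.
  by rewrite fineK// ge0_fin_numE// sqnorm2_ge0.
rewrite fv' in bound *; rewrite lee_fin.
have cv : K' * r ^+ n @[n --> \oo] --> K' * 0.
  by apply: cvgM; [exact: cvg_cst|apply: cvg_expr; rewrite ger0_norm].
rewrite -(mulr0 K') -(cvg_lim (@Rhausdorff R) cv); apply: limr_ge.
  by apply/cvg_ex; eexists; exact: cv.
by apply: nearW => n; rewrite -lee_fin.
Qed.

(** The inverse is chosen function by function, with an arbitrary value outside [L2]. Injectivity of
    [B] modulo null sets makes the choice linear almost everywhere and a left inverse; the lower
    bound for [B] is its norm bound. *)
Lemma B_boundedly_invertible : boundedly_invertible D B.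
Proof.
have /choice[S SP] u : exists w, L2 D u -> L2 D w /\ ae_eq_on D (B w) u.
  have [Lu|Lu] := pselect (L2 D u); last by exists u.
  by have [w Lw Bw] := B_surjective Lu; exists w.
have LS u : L2 D u -> L2 D (S u) by move=> /SP[].
have BS u : L2 D u -> ae_eq_on D (B (S u)) u by move=> /SP[].
exists S; first split => //.
- move=> c u v Lu Lv; apply: B_injective.
  + exact/LS/L2_lin.
  + exact: L2_lin (LS _ Lu) (LS _ Lv).
  + have h := BS _ (L2_lin mD c Lu Lv); have hu := BS _ Lu; have hv := BS _ Lv.
    have hl := B_lin c (LS _ Lu) (LS _ Lv).
    have {hu hv hl} hl : ae_eq_on D (B (fun x => c * S u x + S v x))
        (fun x => c * u x + v x).
      by apply: filterS3 hu hv hl => x h1 h2 h3 Dx; rewrite h3// h1// h2.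
    by apply: filterS2 h hl => x h1 h2 Dx; rewrite h1// h2.
- exists (Num.sqrt K0) => u Lu; have LSu := LS _ Lu; have LBS := L2B LSu.
  have [_ _ fu] := Lu; have [_ _ fSu] := LSu.
  rewrite /L2norm -sqrtrM ?K0_ge0// ler_wsqrtr//.
  have f1 v : (sqnorm2 D v < +oo)%E -> sqnorm2 D v = (fine (sqnorm2 D v))%:E.
    by move=> fv; rewrite fineK// ge0_fin_numE// sqnorm2_ge0.
  rewrite -lee_fin EFinM -!f1//.
  apply: le_trans (B_bounded_below LSu) _; apply: lee_wpmul2l; first by rewrite lee_fin K0_ge0.
  rewrite le_eqVlt; apply/orP; left; apply/eqP.
  apply: ge0_ae_eq_integral => //.
  + exact: cmeas_sqr (L2_cmeas LBS).
  + exact: cmeas_sqr (L2_cmeas Lu).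
  + by move=> x _; rewrite lee_fin sqr_ge0.
  + by move=> x _; rewrite lee_fin sqr_ge0.
  + by have := BS _ Lu; apply: filterS => x h Dx; rewrite h.
- move=> u Lu; split; last exact: BS.
  exact: (B_injective (LS _ (L2B Lu)) Lu (BS _ (L2B Lu))).
Qed.

End Neumann.

(** * Bounded open sets and well-posedness *)

Section PlaneTopology.
Variable R : realType.
Local Notation plane := (measurableTypeR R * measurableTypeR R)%type.

Lemma nbhs_boxP (U : set (R * R)) (x : R * R) : nbhs x U <->
  exists2 e : R, 0 < e & forall y : R * R,
    `|x.1 - y.1| < e -> `|x.2 - y.2| < e -> U y.
Proof.
split.
  move=> /nbhs_ballP[e /= e0 eU]; exists e => // y y1 y2.
  by apply: eU; split; [exact: y1|exact: y2].
move=> [e e0 eU]; apply/nbhs_ballP; exists e => // y [].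
by move=> y1 y2; apply: eU; [exact: y1|exact: y2].
Qed.

Lemma open_measurable_plane (U : set (R * R)) : open U ->
  measurable (U : set plane).
Proof.
move=> oU.
pose box (q : rat * rat * (rat * rat)) : set plane :=
  `]ratr q.1.1, ratr q.1.2[%classic `*` `]ratr q.2.1, ratr q.2.2[%classic.
have -> : U = \bigcup_q (if `[< box q `<=` U >] then box q else set0).
  apply/seteqP; split => [x Ux|x [q _]]; last first.
    by case: ifPn => // /asboolP h /h.
  have [e e0 eU] := (nbhs_boxP U x).1 (oU x Ux).
  have e1 (a : R) : a - e < a by rewrite ltrBlDr ltrDl.
  have e2 (a : R) : a < a + e by rewrite ltrDl.
  have [a] := rat_in_itvoo (e1 x.1); have [b] := rat_in_itvoo (e2 x.1).
  have [c] := rat_in_itvoo (e1 x.2); have [d] := rat_in_itvoo (e2 x.2).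
  rewrite !in_itv/= => /andP[d1 d2] /andP[c1 c2] /andP[b1 b2] /andP[a1 a2].
  exists ((a, b), (c, d)) => //; rewrite asboolT.
    by split; rewrite /= in_itv/=; apply/andP.
  move=> y []; rewrite /= !in_itv/= => /andP[y1 y2] /andP[y3 y4].
  by apply: eU; rewrite distrC ltr_norml; apply/andP; split; lra.
apply: countable_bigcupT_measurable; first exact: countableP.
move=> q; case: ifP => // _.
by apply: measurableX; exact: measurable_itv.
Qed.

Lemma box_measure (a b c d : R) : a <= b -> c <= d ->
  (mu2 R (`[a, b]%classic `*` `[c, d]%classic) = ((b - a) * (d - c))%:E)%E.
Proof.
move=> ab cd; rewrite /mu2/= /pmeas product_measure1E//.
have h (x y : R) : x <= y -> mu1 R `[x, y]%classic = (y - x)%:E.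
  move=> xy; have := @lebesgue_measure_itv R `[x, y]; rewrite /= lte_fin.
  rewrite /mu1/= => ->.
  by case: ltP => // yx; rewrite (le_anti (x := x) (y := y)) ?xy// subrr.
by rewrite [X in (X * _)%E]h// [X in (_ * X)%E]h.
Qed.

Lemma intg_indic_box (D : set plane) (a b c d : R) : a <= b -> c <= d ->
  measurable D -> D `<=` `[a, b]%classic `*` `[c, d]%classic ->
  intg (mu2 R) (\1_D : plane -> R).
Proof.
move=> ab cd mD DB; apply: intg_ge0 => //.
rewrite integral_indic// setIT; apply: le_lt_trans (ltry ((b - a) * (d - c))).
rewrite -box_measure//; apply: le_measure; rewrite ?inE//.
by apply: measurableX; exact: measurable_itv.
Qed.

Lemma bounded_box (D : set (R * R)) : bounded_set D ->
  exists2 M : R, 0 < M & forall x, D x -> `|x.1| <= M /\ `|x.2| <= M.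
Proof.
move=> [M [_ DM]]; exists (`|M| + 1); first by rewrite ltr_wpDl.
move=> x Dx; have := DM (`|M| + 1) (ltr_pwDr ltr01 (ler_norm M)) x Dx.
by rewrite /Num.norm/= ge_max => /andP[].
Qed.

Lemma well_posed (D : set (R * R)) A (lam : R) : open D -> bounded_set D ->
  pv_operator cz_kernel D A -> 2^-1 < `|lam| ->
  boundedly_invertible D (fun u x => lam%:C * u x - A u x).
Proof.
move=> oD bD [bA pvA] lam2.
have mD := open_measurable_plane oD.
have [M M0 DM] := bounded_box bD.
have MM : - M <= M by rewrite ge0_cp// ltW.
have iD : intg (mu2 R) (\1_D : plane -> R).
  apply: (intg_indic_box MM MM mD) => x Dx; have [] := DM x Dx.
  by split; rewrite /= in_itv/= -ler_norml.
apply: B_boundedly_invertible => //.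
- move=> u Lu; apply: (pv_sqnorm2_le mD iD Lu) (pvA u Lu).
  by have [+ _ _] := bA; exact.
- rewrite -(real_normK (num_real lam)).
  rewrite (_ : 4^-1 = 2^-1 ^+ 2); last by field.
  by rewrite ltr_sqr ?nnegrE// invr_ge0.
Qed.

End PlaneTopology.

(** * The numerical symbol *)

Section TorusIntegral.
Variable R : realType.
Local Notation plane := (measurableTypeR R * measurableTypeR R)%type.
Local Notation Qset := (@Q R : set plane).
Local Notation circle := (`[- pi, pi]%classic : set R).

Definition bmeas (b : plane -> R) :=
  measurable_fun setT b /\ exists C, forall t, `|b t| <= C.

(** Not normalized: the constant 1 has integral [4 pi^2]. The indicator is a factor of the integrand
    so that the results on integrals over the whole space apply. *)
Definition torus_int (b : plane -> R) : R := \int[mu2 R]_t (b t * \1_Qset t).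

Lemma ltNpipi : - pi < pi :> R.
Proof. by rewrite gt0_cp// pi_gt0. Qed.

Lemma measurable_Q : measurable Qset.
Proof. by apply: measurableX; exact: measurable_itv. Qed.

Lemma intg_Q : intg (mu2 R) (\1_Qset : plane -> R).
Proof.
by apply: (intg_indic_box (ltW ltNpipi) (ltW ltNpipi)) => //; exact: measurable_Q.
Qed.

Lemma bmeas_intg b : bmeas b -> intg (mu2 R) (fun t => b t * \1_Qset t).
Proof. by move=> [mb [C bC]]; exact: intg_bounded_mul mb bC intg_Q. Qed.

Lemma bmeas_cst c : bmeas (fun=> c).
Proof. by split=> //; exists `|c|. Qed.

Lemma bmeasD b1 b2 : bmeas b1 -> bmeas b2 -> bmeas (fun t => b1 t + b2 t).
Proof.
move=> [m1 [C1 h1]] [m2 [C2 h2]]; split; first exact: measurable_funD.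
by exists (C1 + C2) => t; apply: le_trans (ler_normD _ _) _; exact: lerD.
Qed.

Lemma bmeasM b1 b2 : bmeas b1 -> bmeas b2 -> bmeas (fun t => b1 t * b2 t).
Proof.
move=> [m1 [C1 h1]] [m2 [C2 h2]]; split; first exact: measurable_funM.
by exists (C1 * C2) => t; rewrite normrM ler_pM.
Qed.

Lemma bmeasN b : bmeas b -> bmeas (fun t => - b t).
Proof.
move=> [m1 [C1 h1]]; split; first exact: measurable_funN.
by exists C1 => t; rewrite normrN.
Qed.

Lemma bmeasB b1 b2 : bmeas b1 -> bmeas b2 -> bmeas (fun t => b1 t - b2 t).
Proof. by move=> h1 h2; apply: bmeasD => //; exact: bmeasN. Qed.

Lemma bmeas_sqr b : bmeas b -> bmeas (fun t => b t ^+ 2).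
Proof. by move=> h; under eq_fun do rewrite expr2; exact: bmeasM. Qed.

Lemma bmeas_sum (I : Type) (s : seq I) (b : I -> plane -> R) :
  (forall i, bmeas (b i)) -> bmeas (fun t => \sum_(i <- s) b i t).
Proof.
move=> h; elim: s => [|i s IH].
  by under eq_fun do rewrite big_nil; exact: bmeas_cst.
by under eq_fun do rewrite big_cons; exact: bmeasD.
Qed.

Lemma torus_intD b1 b2 : bmeas b1 -> bmeas b2 ->
  torus_int (fun t => b1 t + b2 t) = torus_int b1 + torus_int b2.
Proof.
move=> h1 h2; rewrite /torus_int -RintegralD//; try exact: bmeas_intg.
by apply: eq_Rintegral => t _; rewrite mulrDl.
Qed.

Lemma torus_intZ c b : bmeas b -> torus_int (fun t => c * b t) = c * torus_int b.
Proof.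
move=> h; rewrite /torus_int -RintegralZl//; last exact: bmeas_intg.
by apply: eq_Rintegral => t _; rewrite mulrA.
Qed.

Lemma torus_intB b1 b2 : bmeas b1 -> bmeas b2 ->
  torus_int (fun t => b1 t - b2 t) = torus_int b1 - torus_int b2.
Proof.
move=> h1 h2; rewrite /torus_int -RintegralB//; try exact: bmeas_intg.
by apply: eq_Rintegral => t _; rewrite mulrBl.
Qed.

Lemma torus_int_sum (I : Type) (s : seq I) (b : I -> plane -> R) :
  (forall i, bmeas (b i)) ->
  torus_int (fun t => \sum_(i <- s) b i t) = \sum_(i <- s) torus_int (b i).
Proof.
move=> h; rewrite /torus_int -Rint_sum; last by move=> i; exact: bmeas_intg.
by apply: eq_Rintegral => t _; rewrite mulr_suml.
Qed.

Lemma le_torus_int b1 b2 : bmeas b1 -> bmeas b2 ->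
  (forall t, Qset t -> b1 t <= b2 t) -> torus_int b1 <= torus_int b2.
Proof.
move=> h1 h2 le12; apply: le_Rintegral => //; try exact: bmeas_intg.
move=> t _; rewrite indicE; case: (boolP (t \in Qset)) => [/set_mem Qt|_].
  by rewrite !mulr1 le12.
by rewrite !mulr0.
Qed.

Lemma eq_torus_int b1 b2 : (forall t, Qset t -> b1 t = b2 t) ->
  torus_int b1 = torus_int b2.
Proof.
move=> e; apply: eq_Rintegral => t _; rewrite indicE.
case: (boolP (t \in Qset)) => [/set_mem Qt|_]; first by rewrite e.
by rewrite !mulr0.
Qed.

Definition phase (m : int * int) (t : plane) : R :=
  m.1%:~R * t.1 + m.2%:~R * t.2.

Lemma bmeas_cos m : bmeas (fun t => cos (phase m t)).
Proof.
split; last by exists 1 => t; rewrite ler_norml cos_geN1 cos_le1.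
have mc : measurable_fun setT (@cos R).
  by apply: continuous_measurable_fun; exact: continuous_cos.
apply: (measurableT_comp mc (g := fun t : plane => phase m t)).
by rewrite /phase; meas.
Qed.

Lemma bmeas_sin m : bmeas (fun t => sin (phase m t)).
Proof.
split; last by exists 1 => t; rewrite ler_norml sin_geN1 sin_le1.
have mc : measurable_fun setT (@sin R).
  by apply: continuous_measurable_fun; exact: continuous_sin.
apply: (measurableT_comp mc (g := fun t : plane => phase m t)).
by rewrite /phase; meas.
Qed.

Lemma sin_int_pi (k : int) : sin (k%:~R * pi) = 0 :> R.
Proof.
have h (n : nat) : sin (n%:R * pi) = 0 :> R.
  elim: n => [|n IH]; first by rewrite mul0r sin0.
  by rewrite -natr1 mulrDl mul1r sinD IH sinpi mul0r mulr0 addr0.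
case: k => n; first exact: h.
by rewrite NegzE mulrNz mulNr sinN h oppr0.
Qed.

Lemma intg_circle (b : R -> R) : continuous b ->  (forall s, `|b s| <= 1) ->
  intg (mu1 R) (fun s => b s * \1_circle s).
Proof.
move=> cb b1; apply: (@intg_bounded_mul _ _ _ (mu1 R) b \1_circle 1) => //.
  exact: continuous_measurable_fun.
exact: intg_itv.
Qed.

Lemma continuous_scaled (f df : R -> R) (k : R) :
  (forall s, is_derive s (1 : R) f (df s)) ->
  (forall s, is_derive s (1 : R) (fun s => f (k * s)) (k * df (k * s))).
Proof.
move=> dF s.
have d1 : is_derive s (1 : R) (fun s => k * s) k.
  by apply: is_derive_eq; rewrite /GRing.scale/=; ring.
have := @is_derive1_comp _ f _ s _ _ (dF (k * s)) d1.
by rewrite /comp => h; apply: is_derive_eq; rewrite mulrC.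
Qed.

Lemma Rint_cos (k : int) :
  \int[mu1 R]_s (cos (k%:~R * s) * \1_circle s) = (k == 0)%:R * (2 * pi).
Proof.
under eq_Rintegral do rewrite mulrC.
rewrite -Rint_indic; have [->|k0] := eqVneq k 0.
  under eq_Rintegral do rewrite mul0r cos0.
  have d (s : R) : is_derive s (1 : R) (fun s => s) 1 by apply: is_derive_eq.
  rewrite (Rint_derive ltNpipi d); last by move=> s; exact: cvg_cst.
  by rewrite mul1r; ring.
have kR : k%:~R != 0 :> R by rewrite intr_eq0.
have dsin := continuous_scaled k%:~R (@is_derive_sin R).
have dcos := continuous_scaled k%:~R (@is_derive_cos R).
have d (s : R) : is_derive s (1 : R) (fun s => k%:~R^-1 * sin (k%:~R * s)) (cos (k%:~R * s)).
  by apply: is_derive_eq; rewrite /GRing.scale/= mulKf// addr0.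
rewrite (Rint_derive ltNpipi d); last exact: is_derive1_continuous dcos.
by rewrite mulrN sinN sin_int_pi oppr0 !mulr0 subrr mul0r.
Qed.

Lemma Rint_sin (k : int) :
  \int[mu1 R]_s (sin (k%:~R * s) * \1_circle s) = 0.
Proof.
under eq_Rintegral do rewrite mulrC.
rewrite -Rint_indic; have [->|k0] := eqVneq k 0.
  under eq_Rintegral do rewrite mul0r sin0.
  by rewrite Rintegral_cst// mul0r.
have kR : k%:~R != 0 :> R by rewrite intr_eq0.
have dsin := continuous_scaled k%:~R (@is_derive_sin R).
have dcos := continuous_scaled k%:~R (@is_derive_cos R).
have d (s : R) : is_derive s (1 : R) (fun s => - k%:~R^-1 * cos (k%:~R * s)) (sin (k%:~R * s)).
  by apply: is_derive_eq; rewrite /GRing.scale/= !mulrN mulNr opprK mulKf.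
rewrite (Rint_derive ltNpipi d); last exact: is_derive1_continuous dsin.
by rewrite mulrN cosN subrr.
Qed.

Let i_cos (k : int) : intg (mu1 R) (fun s => cos (k%:~R * s) * \1_circle s).
Proof.
apply: intg_circle => [|s]; last by rewrite ler_norml cos_geN1 cos_le1.
exact: is_derive1_continuous (continuous_scaled k%:~R (@is_derive_cos R)).
Qed.

Let i_sin (k : int) : intg (mu1 R) (fun s => sin (k%:~R * s) * \1_circle s).
Proof.
apply: intg_circle => [|s]; last by rewrite ler_norml sin_geN1 sin_le1.
exact: is_derive1_continuous (continuous_scaled k%:~R (@is_derive_sin R)).
Qed.

Lemma indic_Q (t : plane) : \1_Qset t = \1_circle t.1 * \1_circle t.2 :> R.
Proof. by rewrite !indicE -natrM mulnb -in_setX. Qed.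

Lemma torus_int_cos m : torus_int (fun t => cos (phase m t)) =
  (m == 0)%:R * (4 * pi ^+ 2).
Proof.
transitivity (\int[mu2 R]_t
  ((cos (m.1%:~R * t.1) * \1_circle t.1) * (cos (m.2%:~R * t.2) * \1_circle t.2) -
   (sin (m.1%:~R * t.1) * \1_circle t.1) * (sin (m.2%:~R * t.2) * \1_circle t.2))).
  by apply: eq_Rintegral => t _; rewrite /phase cosD indic_Q; ring.
rewrite RintegralB//; [|exact: (intg_prod (i_cos _) (i_cos _))|
   exact: (intg_prod (i_sin _) (i_sin _))].
rewrite [X in X - _](Rint_prod (i_cos m.1) (i_cos m.2)).
rewrite [X in _ - X](Rint_prod (i_sin m.1) (i_sin m.2)).
rewrite !Rint_cos !Rint_sin mulr0 subr0.
case: m => a b /=; rewrite xpair_eqE -mulnb natrM; ring.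
Qed.

Lemma torus_int_sin m : torus_int (fun t => sin (phase m t)) = 0.
Proof.
transitivity (\int[mu2 R]_t
  ((sin (m.1%:~R * t.1) * \1_circle t.1) * (cos (m.2%:~R * t.2) * \1_circle t.2) +
   (cos (m.1%:~R * t.1) * \1_circle t.1) * (sin (m.2%:~R * t.2) * \1_circle t.2))).
  by apply: eq_Rintegral => t _; rewrite /phase sinD indic_Q; ring.
rewrite RintegralD//; [|exact: (intg_prod (i_sin _) (i_cos _))|
   exact: (intg_prod (i_cos _) (i_sin _))].
rewrite [X in X + _](Rint_prod (i_sin m.1) (i_cos m.2)).
rewrite [X in _ + X](Rint_prod (i_cos m.1) (i_sin m.2)).
by rewrite !Rint_sin mulr0 mul0r addr0.
Qed.

End TorusIntegral.

Section Symbol.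
Variable R : realType.
Local Notation plane := (measurableTypeR R * measurableTypeR R)%type.
Local Notation Qset := (@Q R : set plane).
Local Notation Re := (@complex.Re R).
Local Notation Im := (@complex.Im R).

(** At [k = 0] the quotient is 0 by the convention on division. This accounts at once for the term
    left out of the symbol and for the zero diagonal of the matrix. *)
Definition latt_kernel (k : int * int) : R := cz_kernel (k.1%:~R, k.2%:~R).

Lemma latt_kernel0 : latt_kernel 0 = 0.
Proof. by rewrite /latt_kernel cz_kernelE/= expr0n subrr mul0r. Qed.

Lemma latt_kernelN k : latt_kernel (- k) = latt_kernel k.
Proof.
rewrite /latt_kernel -cz_kernelN; congr cz_kernel.
by case: k => a b; congr pair; rewrite /= intrN opprK.
Qed.

Lemma phaseD m k (t : plane) : phase (m + k) t = phase m t + phase k t.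
Proof. by rewrite /phase/= !intrD; ring. Qed.

Lemma phaseN m (t : plane) : phase (- m) t = - phase m t.
Proof. by rewrite /phase/= !intrN; ring. Qed.

Lemma phaseB m k (t : plane) : phase (m - k) t = phase m t - phase k t.
Proof. by rewrite phaseD phaseN. Qed.

Variable F : R * R -> R.
Hypothesis hF : numerical_symbol cz_kernel F.
Variable Lam : R.
Hypothesis hLam : F @` Q = `[- Lam, Lam]%classic.

Let FQ : plane -> R := F \_ Q.

Lemma symbol_le t : Q t -> `|F t| <= Lam.
Proof.
move=> Qt; have : (F @` Q) (F t) by exists t.
by rewrite hLam /= in_itv/= ler_norml.
Qed.

Lemma Q0 : Q (0 : R * R).
Proof. by split; rewrite /= in_itv/= oppr_le0 pi_ge0. Qed.

Lemma Lam_ge0 : 0 <= Lam.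
Proof. exact: le_trans (symbol_le Q0). Qed.

(** The bound comes from the range of [F]. Continuity gives measurability off the origin only, and
    the origin is added as a measurable singleton. *)
Lemma symbol_bmeas : bmeas FQ.
Proof.
split; last first.
  exists Lam => t; rewrite /FQ patchE; case: ifPn => [/set_mem Qt|_].
    exact: symbol_le.
  by rewrite normr0 Lam_ge0.
have [_ cF _] := hF.
have m0 : measurable ([set (0 : R * R)] : set plane).
  rewrite (_ : [set _] = [set (0 : R)] `*` [set (0 : R)]).
    by apply: measurableX; exact: measurable_set1.
  by apply/seteqP; split => [_ ->|[a b] [/= -> ->]].
have mQ0 : measurable (Qset `\` [set (0 : R * R)]).
  by apply: measurableD => //; exact: measurable_Q.
apply/(measurable_restrictT F (@measurable_Q R)).
have -> : Qset = (Qset `\` [set (0 : R * R)]) `|` [set (0 : R * R)].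
  by rewrite setUC setDUK// => _ ->; exact: Q0.
apply/measurable_funU => //; split; last exact: measurable_fun_set1.
move=> _; apply: (measurability _ (RGenOpens.measurableE R)) => // _ [_ [a [b ->]] <-].
have oab : open (`]a, b[%classic : set R) by exact: interval_open.
move/continuousP : cF => cF; have [W oW WV] := (open_subspaceP _ _).1 (cF _ oab).
rewrite setIC -WV setIC; apply: measurableI => //.
exact: open_measurable_plane.
Qed.

Definition re_symbol_sum (S : {fset int * int}) (t : plane) : R :=
  \sum_(m <- S) latt_kernel m * cos (phase m t).

Lemma Re_symbol_sum S t : Re (symbol_sum cz_kernel S t) = re_symbol_sum S t.
Proof.
rewrite /symbol_sum /re_symbol_sum [RHS](bigID (fun m => m != 0))/=.
rewrite [X in _ = _ + X]big1 ?addr0; last first.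
  by move=> m /negbNE /eqP ->; rewrite latt_kernel0 mul0r.
rewrite (raddf_sum (@complex.Re R)); apply: eq_bigr => m _.
by rewrite /= mul0r subr0.
Qed.

Lemma Im_symbol_sum S t : Im (symbol_sum cz_kernel S t) =
  \sum_(m <- S) latt_kernel m * sin (phase m t).
Proof.
rewrite /symbol_sum [RHS](bigID (fun m => m != 0))/=.
rewrite [X in _ = _ + X]big1 ?addr0; last first.
  by move=> m /negbNE /eqP ->; rewrite latt_kernel0 mul0r.
rewrite (raddf_sum (@complex.Im R)); apply: eq_bigr => m _.
by rewrite /= mul0r addr0.
Qed.

Lemma bmeas_re_symbol_sum S : bmeas (re_symbol_sum S).
Proof.
by apply: bmeas_sum => m; apply: bmeasM; [exact: bmeas_cst|exact: bmeas_cos].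
Qed.

Lemma symbol_limit (e : R) : 0 < e -> exists S0 : {fset int * int},
  forall S : {fset int * int}, (S0 `<=` S)%fset ->
    torus_int (fun t => (FQ t - re_symbol_sum S t) ^+ 2) <= e.
Proof.
move=> e0; have [/(_ e e0) [S0 hS] _ _] := hF.
exists S0 => S S0S; have := hS S S0S.
have bi : bmeas (fun t : plane => Im (symbol_sum cz_kernel S t)).
  under eq_fun do rewrite Im_symbol_sum.
  by apply: bmeas_sum => m; apply: bmeasM; [exact: bmeas_cst|exact: bmeas_sin].
have b1 := bmeas_sqr (bmeasB symbol_bmeas (bmeas_re_symbol_sum S)).
have b2 := bmeas_sqr bi.
rewrite (_ : sqnorm2 Q _ = (torus_int (fun t => (FQ t - re_symbol_sum S t) ^+ 2 +
   Im (symbol_sum cz_kernel S t) ^+ 2))%:E).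
  rewrite lte_fin torus_intD// => h; apply: ltW; apply: le_lt_trans h.
  rewrite lerDl; apply: Rintegral_ge0 => t _; apply: mulr_ge0.
    exact: sqr_ge0.
  by rewrite indicE.
rewrite /torus_int -Rint_fin; last by apply: bmeas_intg; exact: bmeasD.
rewrite /sqnorm2 [LHS]integral_mkcond; apply: eq_integral => t _.
rewrite epatch_indic/= -EFinM; congr EFin.
rewrite indicE; case: (boolP (t \in _)) => [tQ|_]; last by rewrite !mulr0.
rewrite !mulr1 normc_sqr !raddfB/= subr0; congr (_ + _).
by rewrite Re_symbol_sum /FQ patchE tQ -sqrrN opprB.
Qed.

(** Mean-square convergence implies convergence of the pairing with a bounded [g]. For [|s| <= 1],
    the inequality [s y <= e / 2 + y^2 / (2 e)] is integrated with [y] the error of a partial sum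
    whose squared norm is at most [e^2]; the pairing of that partial sum is already [c]. *)
Lemma symbol_coef (g : plane -> R) (c : R) : bmeas g -> (forall t, `|g t| <= 1) ->
  (exists S1 : {fset int * int}, forall S : {fset int * int}, (S1 `<=` S)%fset ->
    torus_int (fun t => re_symbol_sum S t * g t) = c) ->
  torus_int (fun t => FQ t * g t) = c.
Proof.
move=> bg g1 [S1 hS1].
have I1 : torus_int (fun=> 1) = 4 * pi ^+ 2 :> R.
  have := torus_int_cos R 0; rewrite eqxx mul1r => <-.
  by apply: eq_torus_int => t _; rewrite /phase/= !mul0r addr0 cos0.
have pi0 := pi_gt0 R.
suff h (e : R) : 0 < e -> `|torus_int (fun t => FQ t * g t) - c| <= e * (4 * pi ^+ 2 + 1) / 2.
  apply/eqP; rewrite -subr_eq0 -normr_le0; apply/ler_addgt0Pr => e e0.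
  have P0 : 0 < 4 * pi ^+ 2 + 1 :> R by rewrite addr_gt0// mulr_gt0// exprn_gt0.
  rewrite add0r; apply: le_trans (h (2 * e / (4 * pi ^+ 2 + 1)) _) _.
    by rewrite divr_gt0// mulr_gt0.
  by rewrite divfK ?gt_eqF// mulrAC divff// mul1r.
move=> e0; have [S0 hS0] := symbol_limit (exprn_gt0 2 e0).
pose S := (S0 `|` S1)%fset.
have {}hS0 := hS0 S (fsubsetUl _ _); have {}hS1 := hS1 S (fsubsetUr _ _).
have bF := symbol_bmeas; have bS := bmeas_re_symbol_sum S.
have bd := bmeasB bF bS; have b2 := bmeas_sqr bd.
rewrite -hS1 -torus_intB; [|exact: bmeasM..].
pose maj (t : plane) := (e / 2) * 1 + (2 * e)^-1 * (FQ t - re_symbol_sum S t) ^+ 2.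
have bm : bmeas maj.
  apply: bmeasD; first exact: bmeas_cst.
  by apply: bmeasM => //; exact: bmeas_cst.
have Im : torus_int maj <= e * (4 * pi ^+ 2 + 1) / 2.
  rewrite /maj torus_intD; [|exact: bmeas_cst|by apply: bmeasM => //; exact: bmeas_cst].
  rewrite !torus_intZ//; last exact: bmeas_cst.
  rewrite I1 [leRHS](_ : _ = e / 2 * (4 * pi ^+ 2) + (2 * e)^-1 * e ^+ 2).
    by rewrite lerD2l ler_wpM2l// invr_ge0 mulr_ge0// ltW.
  by move: (pi) => P; field; rewrite gt_eqF.
have le_maj (s : R) t : `|s| <= 1 -> s * (FQ t - re_symbol_sum S t) <= maj t.
  move=> s1; rewrite /maj; set y := FQ t - _.
  have s2 : s ^+ 2 <= 1 by rewrite -(real_normK (num_real s)) expr_le1.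
  have h := sqr_ge0 (s * e - y).
  rewrite -subr_ge0 (_ : _ - _ = ((s * e - y) ^+ 2 + e ^+ 2 * (1 - s ^+ 2)) / (2 * e)).
    apply: divr_ge0; last by rewrite mulr_ge0// ltW.
    by rewrite addr_ge0 ?sqr_ge0// mulr_ge0 ?sqr_ge0// subr_ge0.
  by field; rewrite gt_eqF.
have bdiff : bmeas (fun t => FQ t * g t - re_symbol_sum S t * g t).
  by apply: bmeasB; exact: bmeasM.
rewrite ler_norml lerNl; apply/andP; split; apply: le_trans Im.
  rewrite -mulN1r -torus_intZ//; apply: le_torus_int => //.
    by apply: bmeasM => //; exact: bmeas_cst.
  move=> t _; rewrite (_ : _ * _ = - g t * (FQ t - re_symbol_sum S t)); last by ring.
  by apply: le_maj; rewrite normrN.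
apply: le_torus_int => // t _.
by rewrite -mulrBl mulrC; exact: le_maj.
Qed.

Lemma phase_cos_cos m k : torus_int (fun t => cos (phase m t) * cos (phase k t)) =
  2 * pi ^+ 2 * ((m == k)%:R + (m == - k)%:R) :> R.
Proof.
transitivity (torus_int (fun t => 2^-1 * (cos (phase (m - k) t) + cos (phase (m + k) t)) : R)).
  by apply: eq_torus_int => t _; rewrite phaseB phaseD cosB cosD; field.
rewrite torus_intZ; last by apply: bmeasD; exact: bmeas_cos.
rewrite torus_intD; [|exact: bmeas_cos..].
by rewrite !torus_int_cos subr_eq0 addr_eq0; move: (pi) => P; field.
Qed.

Lemma phase_cos_sin m k : torus_int (fun t => cos (phase m t) * sin (phase k t)) = 0 :> R.
Proof.
transitivity (torus_int (fun t => 2^-1 * (sin (phase (m + k) t) - sin (phase (m - k) t)) : R)).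
  by apply: eq_torus_int => t _; rewrite phaseB phaseD sinB sinD; field.
rewrite torus_intZ; last by apply: bmeasB; exact: bmeas_sin.
rewrite torus_intB; [|exact: bmeas_sin..].
by rewrite !torus_int_sin subrr mulr0.
Qed.

Lemma sum_fset_delta (S : {fset int * int}) (f : int * int -> R) k : k \in S ->
  \sum_(m <- S) f m * (m == k)%:R = f k.
Proof.
move=> kS; rewrite (bigD1_seq k)//= eqxx mulr1 big1 ?addr0// => m /negbTE ->.
by rewrite mulr0.
Qed.

Lemma symbol_cos_coef k : torus_int (fun t => FQ t * cos (phase k t)) =
  4 * pi ^+ 2 * latt_kernel k.
Proof.
apply: symbol_coef; first exact: bmeas_cos.
  by move=> t; rewrite ler_norml cos_geN1 cos_le1.
(* The frequencies [k] and [- k] contribute equally because the kernel is even. For [k = 0] they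
   coincide, and the single term is counted twice by the product formula. *)
exists [fset k; - k]%fset => S kS.
have k1 : k \in S by apply: (fsubsetP kS); rewrite !inE eqxx.
have k2 : - k \in S by apply: (fsubsetP kS); rewrite !inE eqxx orbT.
transitivity (torus_int (fun t => \sum_(m <- S) latt_kernel m *
    (cos (phase m t) * cos (phase k t)))).
  by apply: eq_torus_int => t _; rewrite mulr_suml; apply: eq_bigr => m _; rewrite mulrA.
rewrite torus_int_sum; last first.
  move=> m; apply: bmeasM; first exact: bmeas_cst.
  by apply: bmeasM; exact: bmeas_cos.
rewrite (eq_bigr (fun m => 2 * pi ^+ 2 * (latt_kernel m * (m == k)%:R +
   latt_kernel m * (m == - k)%:R))); last first.
  move=> m _; rewrite torus_intZ; last by apply: bmeasM; exact: bmeas_cos.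
  by rewrite phase_cos_cos; ring.
rewrite -mulr_sumr big_split/= !sum_fset_delta// latt_kernelN.
by move: (pi) => P; ring.
Qed.

Lemma symbol_sin_coef k : torus_int (fun t => FQ t * sin (phase k t)) = 0.
Proof.
apply: symbol_coef; first exact: bmeas_sin.
  by move=> t; rewrite ler_norml sin_geN1 sin_le1.
exists fset0 => S _.
transitivity (torus_int (fun t => \sum_(m <- S) latt_kernel m *
    (cos (phase m t) * sin (phase k t)))).
  by apply: eq_torus_int => t _; rewrite mulr_suml; apply: eq_bigr => m _; rewrite mulrA.
have b m : bmeas (fun t => cos (phase m t) * sin (phase k t)).
  by apply: bmeasM; [exact: bmeas_cos|exact: bmeas_sin].
rewrite torus_int_sum; last by move=> m; apply: bmeasM => //; exact: bmeas_cst.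
by rewrite big1// => m _; rewrite torus_intZ// phase_cos_sin mulr0.
Qed.

End Symbol.

(** * Toeplitz matrices *)

Section Toeplitz.
Variable R : realType.
Local Notation plane := (measurableTypeR R * measurableTypeR R)%type.
Local Notation Qset := (@Q R : set plane).
Local Notation Re := (@complex.Re R).
Local Notation Im := (@complex.Im R).

(* Real and imaginary parts of [z * conj w]. *)
Definition rip (z w : R[i]) : R := Re z * Re w + Im z * Im w.
Definition iip (z w : R[i]) : R := Im z * Re w - Re z * Im w.

Lemma ripC z w : rip z w = rip w z.
Proof. by rewrite /rip; ring. Qed.

Lemma ripDl z1 z2 w : rip (z1 + z2) w = rip z1 w + rip z2 w.
Proof. by rewrite /rip !raddfD/=; ring. Qed.

Lemma ripBl z1 z2 w : rip (z1 - z2) w = rip z1 w - rip z2 w.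
Proof. by rewrite /rip !raddfB/=; ring. Qed.

Lemma ripZl (a : R) z w : rip (a%:C * z) w = a * rip z w.
Proof. by case: z => x y; rewrite /rip/=; ring. Qed.

Lemma rip_suml (I : Type) (s : seq I) (z : I -> R[i]) w :
  rip (\sum_(i <- s) z i) w = \sum_(i <- s) rip (z i) w.
Proof.
elim: s => [|i s IH]; first by rewrite !big_nil /rip/= !mul0r addr0.
by rewrite !big_cons ripDl IH.
Qed.

Lemma ripii z : rip z z = normc z ^+ 2.
Proof. by rewrite normc_sqr /rip !expr2. Qed.

Lemma rip_expi z w (a b : R) : rip (z * expi a) (w * expi b) =
  rip z w * cos (a - b) - iip z w * sin (a - b).
Proof.
by case: z => x y; case: w => x' y'; rewrite /rip /iip/= cosB sinB; ring.
Qed.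

Variables (n : nat) (pos : 'I_n -> int * int).
Hypothesis pos_inj : injective pos.
Implicit Types u v : 'I_n -> R[i].

Definition rdot u v : R := \sum_i rip (u i) (v i).

Definition trig u (t : plane) : R[i] := \sum_i u i * expi (phase (pos i) t).

Definition toeplitz u i : R[i] :=
  \sum_j (latt_kernel R (pos i - pos j))%:C * u j.

Lemma rdotC u v : rdot u v = rdot v u.
Proof. by apply: eq_bigr => i _; rewrite ripC. Qed.

Lemma rdot_ge0 u : 0 <= rdot u u.
Proof. by apply: sumr_ge0 => i _; rewrite ripii sqr_ge0. Qed.

Lemma rip_trig u v t : rip (trig u t) (trig v t) =
  \sum_i \sum_j (rip (u i) (v j) * cos (phase (pos i - pos j) t) -
                 iip (u i) (v j) * sin (phase (pos i - pos j) t)).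
Proof.
rewrite /trig rip_suml; apply: eq_bigr => i _.
rewrite ripC rip_suml; apply: eq_bigr => j _.
by rewrite ripC rip_expi phaseB.
Qed.

Let bterm (a b : R) k : bmeas (fun t : plane =>
  a * cos (phase k t) - b * sin (phase k t)).
Proof.
by apply: bmeasB; apply: bmeasM;
  [exact: bmeas_cst|exact: bmeas_cos|exact: bmeas_cst|exact: bmeas_sin].
Qed.

Lemma bmeas_rip_trig u v : bmeas (fun t => rip (trig u t) (trig v t)).
Proof.
under eq_fun do rewrite rip_trig.
by apply: bmeas_sum => i; apply: bmeas_sum => j; exact: bterm.
Qed.

(** Only the cosine coefficients of the weight survive, so the imaginary products [iip] drop out.
    The weight 1 gives Parseval's identity, the symbol gives the Toeplitz form. *)
Lemma torus_int_rip_trig (G : plane -> R) (c : int * int -> R) u v : bmeas G ->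
  (forall k, torus_int (fun t => G t * cos (phase k t)) = c k) ->
  (forall k, torus_int (fun t => G t * sin (phase k t)) = 0) ->
  torus_int (fun t => G t * rip (trig u t) (trig v t)) =
  \sum_i \sum_j c (pos i - pos j) * rip (u i) (v j).
Proof.
move=> bG Gc Gs.
have bc k := bmeasM bG (bmeas_cos R k); have bs k := bmeasM bG (bmeas_sin R k).
transitivity (torus_int (fun t => \sum_i \sum_j
  (rip (u i) (v j) * (G t * cos (phase (pos i - pos j) t)) -
   iip (u i) (v j) * (G t * sin (phase (pos i - pos j) t))))).
  apply: eq_torus_int => t _; rewrite rip_trig mulr_sumr; apply: eq_bigr => i _.
  by rewrite mulr_sumr; apply: eq_bigr => j _; ring.
have b1 i j : bmeas (fun t => rip (u i) (v j) * (G t * cos (phase (pos i - pos j) t))).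
  by apply: bmeasM => //; exact: bmeas_cst.
have b2 i j : bmeas (fun t => iip (u i) (v j) * (G t * sin (phase (pos i - pos j) t))).
  by apply: bmeasM => //; exact: bmeas_cst.
rewrite torus_int_sum; last by move=> i; apply: bmeas_sum => j; exact: bmeasB.
apply: eq_bigr => i _; rewrite torus_int_sum; last by move=> j; exact: bmeasB.
apply: eq_bigr => j _; rewrite torus_intB// !torus_intZ// Gc Gs.
by rewrite mulr0 subr0 mulrC.
Qed.

Lemma parseval u v :
  torus_int (fun t => rip (trig u t) (trig v t)) = 4 * pi ^+ 2 * rdot u v.
Proof.
transitivity (torus_int (fun t => 1 * rip (trig u t) (trig v t))).
  by apply: eq_torus_int => t _; rewrite mul1r.
rewrite (@torus_int_rip_trig _ (fun k => (k == 0)%:R * (4 * pi ^+ 2))).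
- rewrite mulr_sumr; apply: eq_bigr => i _; rewrite (bigD1 i)//= subrr eqxx mul1r.
  rewrite big1 ?addr0// => j ji; rewrite subr_eq0 (inj_eq pos_inj) eq_sym.
  by rewrite (negbTE ji) !mul0r.
- exact: bmeas_cst.
- by move=> k; rewrite -torus_int_cos; apply: eq_torus_int => t _; rewrite mul1r.
- by move=> k; rewrite -(torus_int_sin R k); apply: eq_torus_int => t _; rewrite mul1r.
Qed.

Lemma rdot_toeplitz u v : rdot u (toeplitz v) =
  \sum_i \sum_j latt_kernel R (pos i - pos j) * rip (u i) (v j).
Proof.
apply: eq_bigr => i _; rewrite ripC rip_suml; apply: eq_bigr => j _.
by rewrite ripZl ripC.
Qed.

Variable F : R * R -> R.
Hypothesis hF : numerical_symbol cz_kernel F.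
Variable Lam : R.
Hypothesis hLam : F @` Q = `[- Lam, Lam]%classic.
Let FQ : plane -> R := F \_ Q.

Let bF : bmeas FQ.
Proof. by have := symbol_bmeas hF hLam. Qed.

Let pi2_gt0 : 0 < 4 * pi ^+ 2 :> R.
Proof. by rewrite mulr_gt0// exprn_gt0// pi_gt0. Qed.

Lemma toeplitz_symbol u v :
  torus_int (fun t => FQ t * rip (trig u t) (trig v t)) =
  4 * pi ^+ 2 * rdot u (toeplitz v).
Proof.
rewrite (@torus_int_rip_trig _ (fun k => 4 * pi ^+ 2 * latt_kernel R k)) //.
- rewrite rdot_toeplitz mulr_sumr; apply: eq_bigr => i _; rewrite mulr_sumr.
  by apply: eq_bigr => j _; rewrite mulrA.
- by have := symbol_cos_coef hF hLam.
- by have := symbol_sin_coef hF hLam.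
Qed.

Lemma toeplitz_range u : `|rdot u (toeplitz u)| <= Lam * rdot u u.
Proof.
have bp := bmeas_rip_trig u u.
have bFp : bmeas (fun t => FQ t * rip (trig u t) (trig u t)) by exact: bmeasM.
have bL c : bmeas (fun t => c * rip (trig u t) (trig u t)).
  by apply: bmeasM => //; exact: bmeas_cst.
have FL t : Qset t -> - Lam <= FQ t <= Lam.
  by move=> Qt; rewrite -ler_norml /FQ patchE mem_set// (symbol_le hLam).
have p0 t : 0 <= rip (trig u t) (trig u t) by rewrite ripii sqr_ge0.
rewrite -(ler_pM2l pi2_gt0) -[X in X * `|_|](gtr0_norm pi2_gt0) -normrM.
rewrite -toeplitz_symbol mulrCA -parseval -torus_intZ// ler_norml -mulN1r.
rewrite -torus_intZ//; apply/andP; split; apply: le_torus_int => //.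
- by apply: bmeasM => //; exact: bmeas_cst.
- by move=> t /FL /andP[h _]; rewrite mulrA mulN1r ler_wpM2r.
- by move=> t /FL /andP[_ h]; rewrite ler_wpM2r.
Qed.

Lemma toeplitz_sym u v : rdot u (toeplitz v) = rdot (toeplitz u) v.
Proof.
rewrite [RHS]rdotC !rdot_toeplitz exchange_big/=; apply: eq_bigr => i _.
by apply: eq_bigr => j _; rewrite ripC -latt_kernelN opprB.
Qed.

Let irot u : 'I_n -> R[i] := fun i => 'i * u i.

(** The matrix is real and symmetric while [rip ('i * u i) (u j)] changes sign under exchange of [i]
    and [j]: the Hermitian form takes real values. *)
Lemma rdot_irot_toeplitz u : rdot (irot u) (toeplitz u) = 0.
Proof.
have e : rdot (irot u) (toeplitz u) = - rdot (irot u) (toeplitz u).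
  rewrite {1}toeplitz_sym rdotC !rdot_toeplitz -sumrN.
  apply: eq_bigr => i _; rewrite -sumrN; apply: eq_bigr => j _.
  rewrite -mulrN; congr (_ * _).
  rewrite /irot; case: (u i) => a b; case: (u j) => c d.
  by rewrite /rip/=; ring.
by lra.
Qed.

(* With [rho] the Rayleigh quotient of the Hermitian Toeplitz form, [(rho - T) u]
   is orthogonal to [u], hence Pythagoras. *)
Lemma toeplitz_resolvent (lam : R[i]) u : exists2 rho : R, - Lam <= rho <= Lam &
  normc (lam - rho%:C) ^+ 2 * rdot u u <=
  rdot (fun i => lam * u i - toeplitz u i) (fun i => lam * u i - toeplitz u i).
Proof.
have Lam0 := Lam_ge0 hLam; have u0 := rdot_ge0 u.
have [uu|uu] := eqVneq (rdot u u) 0.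
  exists 0; first by rewrite oppr_le0 Lam0.
  by rewrite uu mulr0 rdot_ge0.
have up : 0 < rdot u u by rewrite lt0r uu.
pose rho := rdot u (toeplitz u) / rdot u u.
exists rho.
  by rewrite -ler_norml /rho normrM normfV (ger0_norm u0) ler_pdivrMr// toeplitz_range.
pose z i := rho%:C * u i - toeplitz u i.
have zu : rdot u z = 0.
  rewrite rdotC /rdot (eq_bigr (fun i => rho * rip (u i) (u i) - rip (toeplitz u i) (u i))).
    rewrite big_split/= -mulr_sumr -/(rdot u u) sumrN -/(rdot (toeplitz u) u).
    by rewrite /rho divfK// toeplitz_sym subrr.
  by move=> i _; rewrite ripBl ripZl.
have ziu : rdot (irot u) z = 0.
  rewrite rdotC /rdot (eq_bigr (fun i => rho * rip (u i) (irot u i) - rip (toeplitz u i) (irot u i))).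
    rewrite big_split/= -mulr_sumr sumrN -/(rdot (toeplitz u) (irot u)).
    rewrite [rdot (toeplitz u) _]rdotC rdot_irot_toeplitz subr0 big1 ?mulr0// => i _.
    by rewrite /irot; case: (u i) => a b; rewrite /rip/=; ring.
  by move=> i _; rewrite ripBl ripZl.
have [a [b lamE]] : exists a b : R, lam - rho%:C = a +i* b.
  by case: (lam - _) => a b; exists a, b.
have e : rdot (fun i => lam * u i - toeplitz u i) (fun i => lam * u i - toeplitz u i) =
   normc (lam - rho%:C) ^+ 2 * rdot u u + 2 * a * rdot u z + 2 * b * rdot (irot u) z + rdot z z.
  rewrite /rdot !mulr_sumr -!big_split/=; apply: eq_bigr => i _.
  have -> : lam * u i - toeplitz u i = (a +i* b) * u i + z i.
    by rewrite -lamE /z; ring.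
  rewrite lamE normc_sqr /rip /irot; case: (u i) => x y; case: (z i) => x' y' /=.
  by ring.
by rewrite e zu ziu !mulr0 !addr0 lerDl rdot_ge0.
Qed.

(** The transform of [v] is not [(lam - F) u^] but its projection onto the frequencies of the index
    set. Pairing with [v] itself removes the difference: [|v|^2] is the mean of [(lam - F)] times
    the product of [u^] and [v^], and Young's inequality absorbs half of [|v|^2]. *)
Lemma toeplitz_local (lam : R) u v :
  v =1 (fun i => lam%:C * u i - toeplitz u i) ->
  4 * pi ^+ 2 * rdot v v <=
  torus_int (fun t => (lam - FQ t) ^+ 2 * normc (trig u t) ^+ 2).
Proof.
move=> vE.
have bp := bmeas_rip_trig u v.
have bd : bmeas (fun t => lam - FQ t) by apply: bmeasB => //; exact: bmeas_cst.
have bq u' : bmeas (fun t => normc (trig u' t) ^+ 2).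
  by under eq_fun do rewrite -ripii; exact: bmeas_rip_trig.
have bm : bmeas (fun t => (lam - FQ t) ^+ 2 * normc (trig u t) ^+ 2).
  by apply: bmeasM => //; exact: bmeas_sqr.
have e1 : 4 * pi ^+ 2 * rdot v v =
    torus_int (fun t => (lam - FQ t) * rip (trig u t) (trig v t)).
  transitivity (lam * (4 * pi ^+ 2 * rdot u v) - 4 * pi ^+ 2 * rdot u (toeplitz v)).
    rewrite toeplitz_sym [lam * (_ * _)]mulrCA -mulrBr; congr (_ * _).
    rewrite /rdot mulr_sumr -sumrB; apply: eq_bigr => i _.
    by rewrite [X in rip X _]vE ripBl ripZl.
  rewrite -parseval -toeplitz_symbol -torus_intZ// -torus_intB//.
  - by apply: eq_torus_int => t _; rewrite mulrBl.
  - by apply: bmeasM => //; exact: bmeas_cst.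
  - exact: bmeasM.
have e2 : 4 * pi ^+ 2 * rdot v v = torus_int (fun t => normc (trig v t) ^+ 2).
  by rewrite -parseval; apply: eq_torus_int => t _; rewrite ripii.
have e3 : torus_int (fun t => (lam - FQ t) * rip (trig u t) (trig v t)) <=
  torus_int (fun t => 2^-1 * ((lam - FQ t) ^+ 2 * normc (trig u t) ^+ 2 +
                              normc (trig v t) ^+ 2)).
  apply: le_torus_int; first exact: bmeasM.
    by apply: bmeasM; [exact: bmeas_cst|exact: bmeasD].
  move=> t _; rewrite !normc_sqr /rip.
  case: (trig u t) => x y; case: (trig v t) => x' y' /=.
  set d := lam - _; have := sqr_ge0 (d * x - x'); have := sqr_ge0 (d * y - y').
  by nra.
rewrite -e1 torus_intZ ?torus_intD -?e2// in e3; last exact: bmeasD.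
by lra.
Qed.

End Toeplitz.

(** * Plane waves *)

Section Peak.
Variable R : realType.

Lemma cos_far (dl s : R) : 0 < dl -> dl <= `|s| -> `|s| <= 2 * pi - dl ->
  cos s <= cos dl.
Proof.
move=> dl0 sdl spi; have cs : cos s = cos `|s|.
  by case: (leP 0 s) => s0; rewrite ?(ger0_norm s0)// (ltr0_norm s0) cosN.
have mono (x : R) : dl <= x -> x <= pi -> cos x <= cos dl.
  move=> dx xpi.
  have x1 : x \in `[0, pi] by rewrite in_itv/= xpi (le_trans (ltW dl0)).
  have d1 : dl \in `[0, pi] by rewrite in_itv/= (ltW dl0) (le_trans dx).
  by rewrite leNgt ltr_cos// -leNgt.
rewrite cs; have [h|h] := leP `|s| pi; first exact: mono.
rewrite -cosN -(@cosD2pi R (- `|s|)) addrC -mulr_natl.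
apply: mono; first by lra.
by rewrite lerBlDr; lra.
Qed.

Lemma cos_lt1 (dl : R) : 0 < dl -> dl <= pi -> cos dl < 1.
Proof.
move=> dl0 dlpi; rewrite -cos0 ltr_cos// in_itv/= ?lexx ?pi_ge0//.
by rewrite ltW.
Qed.

Variable F : R * R -> R.
Hypothesis hF : numerical_symbol cz_kernel F.
Variable Lam : R.
Hypothesis hLam : F @` Q = `[- Lam, Lam]%classic.

(* The point is moved into the interior of [Q], as [F] is not assumed to be
   continuous across opposite sides of [Q]. *)
Lemma symbol_peak (lam e : R) : - Lam <= lam <= Lam -> lam != 0 -> 0 < e ->
  exists (tau : R * R) (dl : R), [/\ 0 < dl, `|tau.1| + dl <= pi, `|tau.2| + dl <= pi &
    forall t, Q t -> `|t.1 - tau.1| < dl -> `|t.2 - tau.2| < dl -> `|lam - F t| <= e].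
Proof.
move=> lamL lam0 e0; have [_ cF F0] := hF.
have : (F @` Q) lam by rewrite hLam.
move=> [s Qs Fs].
(* As [F 0 = 0], a point with nonzero value [lam] lies off the origin, where continuity is
   available. *)
have s0 : s != 0 by apply: contra_neq lam0 => s0; rewrite -Fs s0.
have As : (Q `\ (0 : R * R)) s by split => // /eqP; rewrite (negbTE s0).
move/subspace_continuousP : cF => /(_ s As) c.
have n1 : \forall t \near s, (Q `\ (0 : R * R)) t -> `|F s - F t| <= e.
  by move/cvgrPdist_le : c => /(_ e e0).
have n2 : \forall t \near s, t != 0.
  apply/nbhs_boxP; exists (Num.max `|s.1| `|s.2|).
    rewrite lt_max !normr_gt0; move: s0; case: s {Qs Fs As c n1} => a b /=.
    by rewrite xpair_eqE negb_and.
  move=> y y1 y2; apply/eqP => y0; move: y1 y2; rewrite y0/= !subr0.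
  by rewrite !lt_max !ltxx orbF /= => h1 h2; have := lt_trans h1 h2; rewrite ltxx.
have /nbhs_boxP[r r0 hr] : nbhs s [set t | Q t -> `|lam - F t| <= e].
  apply: filterS2 n1 n2 => t h t0 Qt; rewrite -Fs; apply: h; split => //.
  by apply/eqP.
have pi0 := pi_gt0 R; have P0 : 0 < 2 * pi + r by rewrite addr_gt0// mulr_gt0.
(* Scaling [s] by [1 - eta] leaves the margin [eta * pi] to the sides of [Q], and this margin is
   also the radius of the window. Displacement and radius are each at most [eta * pi <= r / 2], so
   the window stays within [r] of [s]. *)
pose eta := r / (2 * pi + r).
have eta0 : 0 < eta by rewrite divr_gt0.
have eta1 : eta <= 1 by rewrite ler_pdivrMr// mul1r lerDr mulr_ge0// ltW.
have etapi : eta * pi <= r / 2.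
  rewrite /eta mulrAC ler_pdivrMr// mulrAC -mulrA ler_wpM2l ?(ltW r0)//.
  by rewrite ler_pdivlMr// mulrC lerDl ltW.
exists ((1 - eta) * s.1, (1 - eta) * s.2), (eta * pi).
have [/= ] := Qs; rewrite !in_itv/= -!ler_norml => s1 s2.
have part (x : R) : `|x| <= pi -> `|(1 - eta) * x| + eta * pi <= pi.
  move=> xpi; rewrite normrM ger0_norm ?subr_ge0//.
  rewrite [leRHS](_ : _ = (1 - eta) * pi + eta * pi); last by rewrite mulrBl mul1r subrK.
  by rewrite lerD2r ler_wpM2l// subr_ge0.
have close (x y : R) : `|x| <= pi -> `|y - (1 - eta) * x| < eta * pi -> `|x - y| < r.
  move=> xpi h; rewrite (_ : x - y = eta * x - (y - (1 - eta) * x)); last by ring.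
  apply: le_lt_trans (ler_normB _ _) _.
  have : `|eta * x| <= r / 2.
    by rewrite normrM gtr0_norm// (le_trans _ etapi)// ler_wpM2l// ltW.
  by lra.
split; [by rewrite mulr_gt0|exact: part|exact: part|].
move=> t Qt t1 t2; apply: hr => //; exact: close.
Qed.

(** Outside the window the trivial bound [(2 Lam)^2] is paid for by the cosine weight, which is at
    least [2 - 2 cos dl] there: the margin keeps [|t - tau|] below [2 pi - dl] in each coordinate.
    The weight is [|exp (i s) - 1|^2], chosen to cancel the denominator of a Dirichlet kernel. *)
Lemma symbol_majorant (lam e : R) : - Lam <= lam <= Lam -> lam != 0 -> 0 < e ->
  exists (tau : R * R) (M : R), 0 <= M /\ forall t, Q t ->
    (lam - F t) ^+ 2 <= e ^+ 2 +
      M * ((2 - 2 * cos (t.1 - tau.1)) + (2 - 2 * cos (t.2 - tau.2))).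
Proof.
move=> lamL lam0 e0; have [tau [dl [dl0 tau1 tau2 h]]] := symbol_peak lamL lam0 e0.
exists tau; have dlpi : dl <= pi by apply: le_trans tau1; rewrite lerDr.
have c1 := cos_lt1 dl0 dlpi; have c0 : 0 < 2 - 2 * cos dl by lra.
exists ((2 * Lam) ^+ 2 / (2 - 2 * cos dl)).
have M0 : 0 <= (2 * Lam) ^+ 2 / (2 - 2 * cos dl).
  by rewrite divr_ge0 ?sqr_ge0// ltW.
split => // t Qt.
have a0 (x : R) : 0 <= 2 - 2 * cos x by have := cos_le1 x; lra.
have FL : (lam - F t) ^+ 2 <= (2 * Lam) ^+ 2.
  have := symbol_le hLam Qt; rewrite ler_norml => /andP[f1 f2].
  have /andP[l1 l2] := lamL.
  rewrite -(real_normK (num_real (lam - _))) ler_sqr ?nnegrE ?mulr_ge0 ?(Lam_ge0 hLam)//.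
  by rewrite ler_norml; apply/andP; split; lra.
have [Q1 Q2] := Qt; move: Q1 Q2; rewrite /= !in_itv/= -!ler_norml => Q1 Q2.
have far (x y : R) : `|x| <= pi -> `|y| + dl <= pi -> dl <= `|x - y| ->
    (2 * Lam) ^+ 2 <= (2 * Lam) ^+ 2 / (2 - 2 * cos dl) * (2 - 2 * cos (x - y)).
  move=> xp yp d; rewrite mulrAC ler_pdivlMr// ler_wpM2l ?sqr_ge0//.
  suff : cos (x - y) <= cos dl by lra.
  by apply: cos_far => //; apply: le_trans (ler_normB _ _) _; lra.
have [h1|h1] := ltP `|t.1 - tau.1| dl; last first.
  apply: le_trans FL _; apply: le_trans (far _ _ Q1 tau1 h1) _.
  by rewrite mulrDr; have := mulr_ge0 M0 (a0 (t.2 - tau.2)); have := sqr_ge0 e; lra.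
have [h2|h2] := ltP `|t.2 - tau.2| dl; last first.
  apply: le_trans FL _; apply: le_trans (far _ _ Q2 tau2 h2) _.
  by rewrite mulrDr; have := mulr_ge0 M0 (a0 (t.1 - tau.1)); have := sqr_ge0 e; lra.
apply: (@le_trans _ _ (e ^+ 2)).
  rewrite -(real_normK (num_real (lam - _))) ler_sqr ?nnegrE ?(ltW e0)//.
  exact: h.
by rewrite lerDl mulr_ge0// addr_ge0.
Qed.

End Peak.

(** * Dirichlet kernels and plane waves on blocks *)

Section Dirichlet.
Variable R : realType.
Local Notation plane := (measurableTypeR R * measurableTypeR R)%type.
Local Notation Re := (@complex.Re R).
Local Notation Im := (@complex.Im R).

Lemma expiD (a b : R) : expi (a + b) = expi a * expi b.
Proof. by rewrite /expi cosD sinD; apply/eqP; rewrite eq_complex/= eqxx/= addrC. Qed.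

Lemma expi0 : expi 0 = 1 :> R[i].
Proof. by rewrite /expi cos0 sin0. Qed.

Lemma expiX (n : nat) (s : R) : expi (n%:R * s) = expi s ^+ n.
Proof.
elim: n => [|n IH]; first by rewrite mul0r expi0.
by rewrite -natr1 mulrDl mul1r expiD IH exprSr.
Qed.

Lemma normc_expi (s : R) : normc (expi s) ^+ 2 = 1.
Proof. by rewrite normc_sqr/= cos2Dsin2. Qed.

Lemma normc_expi_sub1 (s : R) : normc (expi s - 1) ^+ 2 = 2 - 2 * cos s.
Proof.
rewrite normc_sqr/= subr0; have := cos2Dsin2 s.
by move: (cos s) (sin s) => x y; rewrite !expr2 => h; lra.
Qed.

Definition dirichlet (L : nat) (s : R) : R[i] := \sum_(a < L) expi (a%:R * s).

(** Summing the geometric series, [|exp (i s) - 1|^2 |D|^2 = |exp (i L s) - 1|^2]. *)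
Lemma dirichlet_le L s : (2 - 2 * cos s) * normc (dirichlet L s) ^+ 2 <= 4.
Proof.
rewrite -normc_expi_sub1 -exprMn -normcM /dirichlet.
under eq_bigr do rewrite expiX.
rewrite -subrX1 -expiX normc_expi_sub1.
by have := cos_geN1 (L%:R * s); lra.
Qed.

(** As a function on the torus this is a trigonometric polynomial with unimodular coefficients on
    the [L] distinct multiples of [p], so Parseval's identity gives its norm. It is used for the two
    unit vectors. *)
Lemma parseval_unimodular L (p : int * int) (tau : R) : p != 0 ->
  bmeas (fun t : plane => normc (dirichlet L (phase p t - tau)) ^+ 2) /\
  torus_int (fun t : plane => normc (dirichlet L (phase p t - tau)) ^+ 2) =
  4 * pi ^+ 2 * L%:R.
Proof.
move=> p0; pose pos (a : 'I_L) := p *+ a.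
pose u (a : 'I_L) := expi (- (a%:R * tau)).
have posinj : injective pos.
  move=> a b ab; apply/val_inj; move: p0 ab; rewrite /pos.
  case: (p) => x y; rewrite xpair_eqE negb_and => /orP[z0|z0] ab.
    apply: (mulrIn z0); have := congr1 fst ab.
    by rewrite !(raddfMn (@fst int int)).
  apply: (mulrIn z0); have := congr1 snd ab.
  by rewrite !(raddfMn (@snd int int)).
have phaseMn (a : nat) t : phase (p *+ a) t = a%:R * phase p t :> R.
  elim: a => [|a IH]; first by rewrite mulr0n mul0r /phase/= !mul0r addr0.
  by rewrite mulrSr phaseD IH -natr1 mulrDl mul1r.
have <- : rdot u u = L%:R.
  rewrite /rdot (eq_bigr (fun=> 1)) ?sumr_const ?card_ord// => a _.
  by rewrite ripii normc_expi.
rewrite -(parseval posinj) (_ : (fun t => _) = (fun t => rip (trig pos u t) (trig pos u t))).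
  by split=> //; exact: bmeas_rip_trig.
apply/funext => t; rewrite ripii; congr (normc _ ^+ 2); apply: eq_bigr => a _.
by rewrite /u /pos phaseMn -expiD; congr expi; ring.
Qed.

Variables (n : nat) (pos : 'I_n -> int * int).
Hypothesis pos_inj : injective pos.
Variables (L : nat) (J : 'I_L * 'I_L -> 'I_n) (m0 : int * int) (tau : R * R).
Hypothesis posJ : forall ab, pos (J ab) = m0 + ((ab.1 : nat)%:Z, (ab.2 : nat)%:Z).

Let coefJ (ab : 'I_L * 'I_L) : R[i] := expi (- (ab.1%:R * tau.1 + ab.2%:R * tau.2)).

(** A sum of point masses over the block, hence 0 outside the image of [J] without inverting [J].
    The signs of the phases place the peak of the transform at [tau]. *)
Definition wave (i : 'I_n) : R[i] := \sum_ab ((i == J ab)%:R : R)%:C * coefJ ab.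

Let J_inj : injective J.
Proof.
move=> [a b] [c d] /(congr1 pos); rewrite !posJ => /addrI /=.
by move=> [] /val_inj -> /val_inj ->.
Qed.

Lemma waveJ ab : wave (J ab) = coefJ ab.
Proof.
rewrite /wave (bigD1 ab)//= eqxx mul1r big1 ?addr0// => cd cdab.
by rewrite (inj_eq J_inj) eq_sym (negbTE cdab) mul0r.
Qed.

Lemma rdot_wave : rdot wave wave = L%:R ^+ 2.
Proof.
transitivity (\sum_i \sum_ab (i == J ab)%:R * rip (coefJ ab) (wave i)).
  by apply: eq_bigr => i _; rewrite {1}/wave rip_suml; apply: eq_bigr => ab _; rewrite ripZl.
rewrite exchange_big/= (eq_bigr (fun=> 1)).
  by rewrite sumr_const card_prod card_ord natrM expr2.
move=> ab _; rewrite (bigD1 (J ab))//= eqxx mul1r big1 ?addr0.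
  by rewrite waveJ ripii normc_expi.
by move=> i /negbTE ->; rewrite mul0r.
Qed.

Lemma trig_wave t : trig pos wave t = expi (phase m0 t) *
  (dirichlet L (t.1 - tau.1) * dirichlet L (t.2 - tau.2)).
Proof.
transitivity (\sum_i \sum_ab ((i == J ab)%:R : R)%:C * (coefJ ab * expi (phase (pos i) t))).
  apply: eq_bigr => i _; rewrite /wave mulr_suml; apply: eq_bigr => ab _.
  by rewrite mulrA.
rewrite exchange_big/= (eq_bigr (fun ab => coefJ ab * expi (phase (pos (J ab)) t))); last first.
  move=> ab _; rewrite (bigD1 (J ab))//= eqxx mul1r big1 ?addr0//.
  by move=> i /negbTE ->; rewrite mul0r.
rewrite /dirichlet big_distrlr/= pair_big/= mulr_sumr; apply: eq_bigr => -[a b] _.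
rewrite posJ phaseD/= -!expiD; congr expi; rewrite /phase/=.
by rewrite !pmulrn; ring.
Qed.

Variable F : R * R -> R.
Hypothesis hF : numerical_symbol cz_kernel F.
Variable Lam : R.
Hypothesis hLam : F @` Q = `[- Lam, Lam]%classic.

(** The transform of the wave is a product of two Dirichlet kernels. In each coordinate the cosine
    weight reduces one squared kernel to at most 4, and the other has mean [L], which gives [8 M L]
    in total; the constant [e^2] meets the full squared norm [L^2]. *)
Lemma wave_bound (lam e M : R) (v : 'I_n -> R[i]) : 0 <= M ->
  (forall t, Q t -> (lam - F t) ^+ 2 <= e ^+ 2 +
      M * ((2 - 2 * cos (t.1 - tau.1)) + (2 - 2 * cos (t.2 - tau.2)))) ->
  v =1 (fun i => lam%:C * wave i - toeplitz pos wave i) ->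
  rdot v v <= e ^+ 2 * L%:R ^+ 2 + 8 * M * L%:R.
Proof.
move=> M0 hM vE.
have P0 : 0 < 4 * pi ^+ 2 :> R by rewrite mulr_gt0// exprn_gt0// pi_gt0.
rewrite -(ler_pM2l P0); apply: le_trans (toeplitz_local pos_inj hF hLam vE) _.
pose d1 (t : plane) := normc (dirichlet L (t.1 - tau.1)) ^+ 2.
pose d2 (t : plane) := normc (dirichlet L (t.2 - tau.2)) ^+ 2.
have [b1 t1] : bmeas d1 /\ torus_int d1 = 4 * pi ^+ 2 * L%:R.
  have := @parseval_unimodular L (1, 0) tau.1 isT.
  rewrite (_ : (fun t => _) = d1)//; apply/funext => t.
  by rewrite /d1 /phase/= mul1r mul0r addr0.
have [b2 t2] : bmeas d2 /\ torus_int d2 = 4 * pi ^+ 2 * L%:R.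
  have := @parseval_unimodular L (0, 1) tau.2 isT.
  rewrite (_ : (fun t => _) = d2)//; apply/funext => t.
  by rewrite /d2 /phase/= mul1r mul0r add0r.
have bw : bmeas (fun t => normc (trig pos wave t) ^+ 2).
  by under eq_fun do rewrite -ripii; exact: bmeas_rip_trig.
have tw : torus_int (fun t => normc (trig pos wave t) ^+ 2) = 4 * pi ^+ 2 * L%:R ^+ 2.
  by rewrite -rdot_wave -(parseval pos_inj); apply: eq_torus_int => t _; rewrite ripii.
rewrite [leRHS](_ : _ = torus_int (fun t => e ^+ 2 * normc (trig pos wave t) ^+ 2 +
    (4 * M) * (d1 t + d2 t))); last first.
  have bc c : bmeas (fun t => c * normc (trig pos wave t) ^+ 2).
    by apply: bmeasM => //; exact: bmeas_cst.
  have bc2 c : bmeas (fun t => c * (d1 t + d2 t)).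
    by apply: bmeasM; [exact: bmeas_cst|exact: bmeasD].
  rewrite torus_intD// !torus_intZ//; last exact: bmeasD.
  rewrite torus_intD// t1 t2 tw.
  by move: (4 * pi ^+ 2) => P; ring.
apply: le_torus_int.
- apply: bmeasM => //; apply: bmeas_sqr; apply: bmeasB; first exact: bmeas_cst.
  by have := symbol_bmeas hF hLam.
- apply: bmeasD; apply: bmeasM => //; try exact: bmeas_cst.
  exact: bmeasD.
- move=> t Qt; rewrite patchE mem_set// trig_wave !normcM !exprMn normc_expi mul1r.
  rewrite -/(d1 t) -/(d2 t).
  have d10 : 0 <= d1 t by exact: sqr_ge0.
  have d20 : 0 <= d2 t by exact: sqr_ge0.
  apply: le_trans (ler_wpM2r (mulr_ge0 d10 d20) (hM t Qt)) _.
  rewrite mulrDl lerD2l -[4 * M]mulrC -mulrA -[leRHS]mulrA ler_wpM2l//.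
  rewrite mulrDl mulrDr [4 * d1 t + _]addrC; apply: lerD.
    by rewrite mulrA ler_wpM2r// dirichlet_le.
  by rewrite [d1 t * _]mulrC mulrA ler_wpM2r// dirichlet_le.
Qed.

End Dirichlet.

(** * The approximation scheme *)

Section OperatorNorm.
Variable R : realType.

Lemma l2normE n (v : 'cV[R[i]]_n) :
  l2norm v = Num.sqrt (rdot (fun i => v i 0) (fun i => v i 0)).
Proof. by congr Num.sqrt; apply: eq_bigr => i _; rewrite ripii. Qed.

Lemma l2norm_ge0 n (v : 'cV[R[i]]_n) : 0 <= l2norm v.
Proof. exact: sqrtr_ge0. Qed.

Lemma l2norm_sqr n (v : 'cV[R[i]]_n) :
  l2norm v ^+ 2 = rdot (fun i => v i 0) (fun i => v i 0).
Proof. by rewrite l2normE sqr_sqrtr// rdot_ge0. Qed.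

Lemma l2norm0 n : l2norm (0 : 'cV[R[i]]_n) = 0.
Proof.
by rewrite /l2norm big1 ?sqrtr0// => i _; rewrite mxE normc0 expr0n.
Qed.

Lemma l2norm_eq0 n (v : 'cV[R[i]]_n) : l2norm v = 0 -> v = 0.
Proof.
move=> v0; have := l2norm_sqr v; rewrite v0 expr0n/= => /esym/eqP.
rewrite psumr_eq0; last by move=> i _; rewrite ripii sqr_ge0.
move=> /allP h; apply/matrixP => i j; rewrite ord1 mxE.
have := h i (mem_index_enum i); rewrite ripii sqrf_eq0 => /eqP.
exact: eq0_normc.
Qed.

Lemma l2normZ n (c : R) (v : 'cV[R[i]]_n) : 0 <= c ->
  l2norm (c%:C *: v) = c * l2norm v.
Proof.
move=> c0; rewrite /l2norm -[c in RHS]ger0_norm// -sqrtr_sqr -sqrtrM ?sqr_ge0//.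
congr Num.sqrt; rewrite mulr_sumr; apply: eq_bigr => i _.
by rewrite mxE normcM exprMn [normc _%:C ^+ 2]normc_sqr/= expr0n addr0.
Qed.

Lemma normc_ge0 (z : R[i]) : 0 <= normc z.
Proof. by case: z => a b; exact: sqrtr_ge0. Qed.

Lemma normc_sum (I : Type) (s : seq I) (z : I -> R[i]) :
  normc (\sum_(i <- s) z i) <= \sum_(i <- s) normc (z i).
Proof.
elim: s => [|i s IH]; first by rewrite !big_nil normc0.
by rewrite !big_cons; apply: le_trans (le_normcD _ _) _; rewrite lerD2l.
Qed.

(** The supremum defining [opnorm] is meaningful only for a bounded set. The crude bound by row sums
    is enough, as every entry of [v] has modulus at most 1. *)
Lemma opnorm_has_ubound n (A : 'M[R[i]]_n) :
  has_ubound [set l2norm (A *m v) | v in [set v : 'cV[R[i]]_n | l2norm v <= 1]].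
Proof.
exists (Num.sqrt (\sum_i (\sum_j normc (A i j)) ^+ 2)) => _ [v /= v1 <-].
apply: ler_wsqrtr; apply: ler_sum => i _.
have s0 : 0 <= \sum_j normc (A i j) by apply: sumr_ge0 => j _; exact: normc_ge0.
rewrite ler_sqr ?nnegrE ?normc_ge0// mxE; apply: le_trans (normc_sum _ _) _.
apply: ler_sum => j _; rewrite normcM ler_piMr ?normc_ge0//.
have : normc (v j 0) ^+ 2 <= 1.
  apply: (@le_trans _ _ (l2norm v ^+ 2)).
    rewrite sqr_sqrtr; last by apply: sumr_ge0 => k _; exact: sqr_ge0.
    by rewrite (bigD1 j)//= lerDl; apply: sumr_ge0 => k _; exact: sqr_ge0.
  by rewrite expr_le1// l2norm_ge0.
by rewrite expr_le1// normc_ge0.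
Qed.

Lemma l2norm_opnorm n (A : 'M[R[i]]_n) (v : 'cV[R[i]]_n) :
  l2norm (A *m v) <= opnorm A * l2norm v.
Proof.
have [v0|v0] := eqVneq (l2norm v) 0.
  by rewrite v0 (l2norm_eq0 v0) mulmx0 l2norm0 mulr0.
have vp : 0 < l2norm v by rewrite lt0r v0 l2norm_ge0.
have vi : 0 <= (l2norm v)^-1 by rewrite invr_ge0 ltW.
rewrite -ler_pdivrMr// mulrC -l2normZ// scalemxAr.
apply: ub_le_sup; first exact: opnorm_has_ubound.
by exists ((l2norm v)^-1%:C *: v) => //=; rewrite l2normZ// mulVf.
Qed.

Lemma opnorm_le n (A : 'M[R[i]]_n) (c : R) : 0 <= c ->
  (forall v : 'cV[R[i]]_n, l2norm (A *m v) <= c * l2norm v) -> opnorm A <= c.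
Proof.
move=> c0 h; apply: ge_sup.
  by exists (l2norm (A *m 0)), 0 => //=; rewrite l2norm0.
move=> _ [v /= v1 <-]; apply: le_trans (h v) _.
by rewrite -[leRHS]mulr1 ler_wpM2l.
Qed.

Lemma unitmx_of_lower_bound n (A : 'M[R[i]]_n) (c : R) : 0 < c ->
  (forall v : 'cV[R[i]]_n, c * l2norm v <= l2norm (A *m v)) ->
  A \in unitmx /\ opnorm (invmx A) <= c^-1.
Proof.
move=> c0 h; have uA : A \in unitmx.
  rewrite -unitmx_tr -row_free_unit; apply: inj_row_free => v vA.
  have Av : A *m v^T = 0 by rewrite -[A]trmxK -trmx_mul vA trmx0.
  apply: trmx_inj; rewrite trmx0; apply: l2norm_eq0.
  have := h v^T; rewrite Av l2norm0 pmulr_rle0// => le0.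
  by apply/eqP; rewrite eq_le le0 l2norm_ge0.
split => //; apply: opnorm_le; first by rewrite invr_ge0 ltW.
move=> v; rewrite mulrC ler_pdivlMr// mulrC.
by apply: le_trans (h _) _; rewrite mulKVmx.
Qed.

Lemma Cdist_le (z : R[i]) (Lam rho : R) : - Lam <= rho <= Lam ->
  Cdist z (Cinterval Lam) <= normc (z - rho%:C).
Proof.
move=> r; apply: ge_inf; last by exists rho%:C => //; exists rho.
by exists 0 => _ [w _ <-]; exact: normc_ge0.
Qed.

(** Explicit lower bounds take the place of compactness: [|b|] when the imaginary part [b] is
    nonzero, and [|a| - Lam] on the real axis. *)
Lemma Cdist_gt0 (z : R[i]) (Lam : R) : 0 <= Lam -> ~ Cinterval Lam z ->
  0 < Cdist z (Cinterval Lam).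
Proof.
move=> L0 zC.
have [c c0 h] : exists2 c : R, 0 < c & forall rho, - Lam <= rho <= Lam ->
    c <= normc (z - rho%:C).
  case: z zC => a b zC.
  have [b0|b0] := eqVneq b 0.
    have aL : Lam < `|a|.
      rewrite ltNge ler_norml; apply/negP => aL; apply: zC; exists a => //.
      by rewrite b0.
    exists (`|a| - Lam); first by rewrite subr_gt0.
    move=> rho; rewrite -ler_norml => r.
    rewrite /= b0 subr0 expr0n addr0 sqrtr_sqr.
    by apply: le_trans (lerB_dist _ _); rewrite lerB.
  exists `|b|; first by rewrite normr_gt0.
  by move=> rho _; rewrite /= subr0 -sqrtr_sqr ler_wsqrtr// lerDr sqr_ge0.
apply: lt_le_trans c0 _; apply: lb_le_inf.
  by exists (normc (z - 0%:C)), 0%:C => //; exists 0 => //=; rewrite in_itv/= oppr_le0 L0.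
by move=> _ [_ [rho r <-] <-]; exact: h.
Qed.

End OperatorNorm.

(** * The matrices of the scheme as finite Toeplitz sections *)

Section FiniteSection.
Variable R : realType.
Variables (Omega : set (R * R)) (a : R * R) (N : nat).
Hypothesis N_gt0 : (0 < N)%N.
Local Notation I := (omega Omega a N).
Local Notation T := (Tmx cz_kernel Omega a N).

Definition node (i : 'I_#|{: I}|) : int * int := val (enum_val i).

Lemma node_inj : injective node.
Proof. by move=> i j /val_inj /enum_val_inj. Qed.

Let N0 : N%:R != 0 :> R.
Proof. by rewrite pnatr_eq0 -lt0n. Qed.

(** Homogeneity of degree -2 cancels the mesh factor, and the differences cancel the origin [a]. *)
Lemma cz_kernel_grid (m k : int * int) :
  N%:R ^- 2 * cz_kernel (gridpt a N m - gridpt a N k) = latt_kernel R (m - k).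
Proof.
rewrite /latt_kernel !cz_kernelE/= !intrB.
have -> : a.1 + m.1%:~R / N%:R - (a.1 + k.1%:~R / N%:R) =
  (m.1%:~R - k.1%:~R) / N%:R by ring.
have -> : a.2 + m.2%:~R / N%:R - (a.2 + k.2%:~R / N%:R) =
  (m.2%:~R - k.2%:~R) / N%:R by ring.
move: (m.1%:~R - _) (m.2%:~R - _) => x y.
rewrite -exprVn; have : (N%:R^-1 : R) != 0 by rewrite invr_eq0.
move: (N%:R^-1) => q q0.
rewrite (_ : ((x * q) ^+ 2 + (y * q) ^+ 2) ^+ 2 = (x ^+ 2 + y ^+ 2) ^+ 2 * q ^+ 4); last by ring.
rewrite (_ : (y * q) ^+ 2 - (x * q) ^+ 2 = (y ^+ 2 - x ^+ 2) * q ^+ 2); last by ring.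
have -> : q ^+ 4 = q ^+ 2 * q ^+ 2 by rewrite -exprD.
have : q ^+ 2 != 0 by rewrite expf_neq0.
move: (q ^+ 2) ((x ^+ 2 + y ^+ 2) ^+ 2) (y ^+ 2 - x ^+ 2) (pi : R) => r D n p r0.
have h : r * r^-1 = 1 by rewrite mulfV.
rewrite !invfM; move: (r^-1) h (D^-1) (2^-1 : R) (p^-1) => s h E d o.
rewrite [LHS](_ : _ = n * (d * o * E) * ((r * s) * (r * s))); last by ring.
by rewrite h !mulr1.
Qed.

Lemma TmxE i j : T i j = (latt_kernel R (node i - node j))%:C.
Proof.
rewrite mxE; case: eqVneq => [->|_]; first by rewrite subrr latt_kernel0.
by rewrite cz_kernel_grid.
Qed.

Lemma TmxM (lam : R[i]) (v : 'cV[R[i]]_#|{: I}|) i :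
  ((lam%:M - T) *m v) i 0 = lam * v i 0 - toeplitz node (fun j => v j 0) i.
Proof.
rewrite mulmxBl mul_scalar_mx !mxE; congr (_ - _).
by apply: eq_bigr => j _; rewrite TmxE.
Qed.

Variable F : R * R -> R.
Hypothesis hF : numerical_symbol cz_kernel F.
Variable Lam : R.
Hypothesis hLam : F @` Q = `[- Lam, Lam]%classic.

Lemma resolvent_lower_bound (lam : R[i]) (v : 'cV[R[i]]_#|{: I}|) :
  Cdist lam (Cinterval Lam) * l2norm v <= l2norm ((lam%:M - T) *m v) \/
  Cdist lam (Cinterval Lam) <= 0.
Proof.
have [d0|d0] := leP (Cdist lam (Cinterval Lam)) 0; [by right|left].
have [rho rL h] := toeplitz_resolvent node_inj hF hLam lam (fun i => v i 0).
rewrite -(@ler_pXn2r _ 2)// ?nnegrE ?mulr_ge0 ?l2norm_ge0 ?(ltW d0)//.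
rewrite exprMn !l2norm_sqr.
rewrite [leRHS](_ : _ = rdot (fun i => lam * v i 0 - toeplitz node (fun j => v j 0) i)
  (fun i => lam * v i 0 - toeplitz node (fun j => v j 0) i)); last first.
  by apply: eq_bigr => i _; rewrite TmxM.
apply: le_trans h; rewrite ler_wpM2r ?rdot_ge0//.
rewrite ler_sqr ?nnegrE ?normc_ge0 ?(ltW d0)//.
exact: Cdist_le.
Qed.

Lemma resolvent_estimate (lam : R[i]) : ~ Cinterval Lam lam ->
  lam%:M - T \in unitmx /\
  opnorm (invmx (lam%:M - T)) <= (Cdist lam (Cinterval Lam))^-1.
Proof.
move=> lamC; have d0 := Cdist_gt0 (Lam_ge0 hLam) lamC.
apply: unitmx_of_lower_bound => // v.
by case: (resolvent_lower_bound lam v) => //; rewrite leNgt d0.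
Qed.

Lemma unique_solution (lam : R[i]) (f : R * R -> R[i]) : lam%:M - T \in unitmx ->
  exists! u : {ffun I -> R[i]}, forall m : I,
    lam * u m - N%:R ^- 2 *
      (\sum_(n : I | n != m)
        (cz_kernel (gridpt a N (val m) - gridpt a N (val n)))%:C * u n)
    = f (gridpt a N (val m)).
Proof.
move=> uM; pose b := \col_(i < #|{: I}|) f (gridpt a N (node i)).
have key (u : {ffun I -> R[i]}) : (forall m : I,
    lam * u m - N%:R ^- 2 *
      (\sum_(n : I | n != m)
        (cz_kernel (gridpt a N (val m) - gridpt a N (val n)))%:C * u n)
    = f (gridpt a N (val m))) <->
    (lam%:M - T) *m (\col_i u (enum_val i)) = b.
  have e i : ((lam%:M - T) *m (\col_i u (enum_val i))) i 0 =
      lam * u (enum_val i) - N%:R ^- 2 *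
      (\sum_(n : I | n != enum_val i)
        (cz_kernel (gridpt a N (node i) - gridpt a N (val n)))%:C * u n).
    rewrite TmxM mxE; congr (_ - _).
    rewrite mulr_sumr (reindex_onto (@enum_val I (mem {: I})) enum_rank) /=; last first.
      by move=> x _; rewrite enum_rankK.
    (* The diagonal term, absent from the system, has coefficient 0 in the Toeplitz sum. *)
    rewrite /toeplitz (bigD1 i)//= subrr latt_kernel0 mul0r add0r.
    apply: eq_big => [j|j ji].
      by rewrite enum_valK eqxx andbT (inj_eq enum_val_inj).
    rewrite mxE mulrA; congr (_ * _).
    rewrite -cz_kernel_grid -[val _]/(node j) rmorphM/= rmorphV/= ?unitfE ?expf_neq0//.
    by rewrite rmorphXn/= rmorph_nat.
  split => h.
    by apply/matrixP => i j; rewrite ord1 e mxE h.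
  move=> m; have := congr1 (fun A : 'cV_ _ => A (enum_rank m) 0) h.
  by rewrite e mxE /node enum_rankK.
pose x := invmx (lam%:M - T) *m b.
exists [ffun m => x (enum_rank m) 0]; split.
  apply/key; rewrite -[RHS](mulKVmx uM b); congr (_ *m _).
  by apply/matrixP => i j; rewrite ord1 mxE ffunE enum_valK.
move=> u /key hu; apply/ffunP => m; rewrite ffunE /x -hu mulKmx// mxE.
by rewrite enum_rankK.
Qed.

End FiniteSection.

(** * Blocks in the grid and instability *)

Section Instability.
Variable R : realType.

Lemma finite_omega (Omega : set (R * R)) (a : R * R) (N : nat) :
  bounded_set Omega -> (0 < N)%N -> finite_set [set m | Omega (gridpt a N m)].
Proof.
move=> /bounded_box[M M0 OM] N_gt0.
have Np : 0 < N%:R :> R by rewrite ltr0n.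
have bnd (b : R) (k : int) : `|b + k%:~R / N%:R| <= M ->
    `|k| <= (Num.bound (N%:R * (M + `|b|)))%:Z.
  move=> h; rewrite -(ler_int R) intr_norm.
  have h0 : 0 <= N%:R * (M + `|b|) by rewrite mulr_ge0 ?addr_ge0// ltW.
  apply: (@le_trans _ _ (N%:R * (M + `|b|))); last exact: ltW (archi_boundP h0).
  rewrite mulrC -ler_pdivrMr// -[X in _ / X](gtr0_norm Np) -normf_div.
  rewrite (_ : k%:~R / _ = b + k%:~R / N%:R - b); last by ring.
  by apply: le_trans (ler_normB _ _) _; rewrite lerD2r.
pose B1 := Num.bound (N%:R * (M + `|a.1|)); pose B2 := Num.bound (N%:R * (M + `|a.2|)).
pose f (p : nat * nat) : int * int := (p.1%:Z - B1%:Z, p.2%:Z - B2%:Z).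
apply: (@sub_finite_set _ _ (f @` (`I_(B1 + B1).+1 `*` `I_(B2 + B2).+1))).
  move=> [m1 m2] /= /OM[/= /bnd h1 /bnd h2].
  exists (absz (m1 + B1%:Z), absz (m2 + B2%:Z)).
    by split => /=; rewrite -/B1 -/B2 in h1 h2 *; lia.
  by rewrite /f/=; congr pair; rewrite -/B1 -/B2 in h1 h2 *; lia.
by apply: finite_image; apply: finite_setX; exact: finite_II.
Qed.

Lemma omegaP (Omega : set (R * R)) (a : R * R) (N : nat) (m : int * int) :
  bounded_set Omega -> (0 < N)%N ->
  (m \in omega Omega a N) <-> Omega (gridpt a N m).
Proof.
move=> bO N0; rewrite /omega in_fset_set; last exact: finite_omega.
by split => [/set_mem|/mem_set].
Qed.

(** The corner is the grid point next to [x] from below in each coordinate. Rounding costs at most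
    [1 / N] and the block extends at most [L / N], so [N r > L + 1] keeps the block in the box of
    radius [r] around [x], whatever the origin [a N] is. *)
Lemma grid_block (Omega : set (R * R)) (a : nat -> R * R) (L : nat) :
  open Omega -> Omega !=set0 -> exists2 N, (0 < N)%N &
  exists m0 : int * int, forall k l : nat, (k < L)%N -> (l < L)%N ->
    Omega (gridpt (a N) N (m0 + (k%:Z, l%:Z))).
Proof.
move=> oO [x Ox].
have /nbhs_boxP[r r0 rO] : nbhs x Omega by exact: open_nbhs_nbhs.
pose N := (Num.bound (L.+1%:R / r)).+1.
have Np : 0 < N%:R :> R by rewrite ltr0n.
have NL : L.+1%:R < N%:R * r.
  rewrite -ltr_pdivrMr//; apply: lt_trans (archi_boundP _) _.
    by rewrite divr_ge0// ltW.
  by rewrite ltr_nat.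
have cl (y b : R) (k : nat) : (k < L)%N ->
    `|y - (b + (Num.floor (N%:R * (y - b)) + k%:Z)%:~R / N%:R)| < r.
  move=> kL; rewrite -(ltr_pM2l Np) -{1}(gtr0_norm Np) -normrM.
  apply: le_lt_trans NL.
  have /andP[f1 f2] := floor_itv (N%:R * (y - b)).
  rewrite intrD in f2; rewrite intrD.
  move: (Num.floor _)%:~R f1 f2 => z f1 f2.
  rewrite (_ : N%:R * _ = N%:R * (y - b) - z - k%:R); last first.
    by rewrite -pmulrn; field; rewrite gt_eqF.
  have kL' : k%:R <= L%:R :> R by rewrite ler_nat ltnW.
  have k0 : 0 <= k%:R :> R by [].
  rewrite -natr1 ler_norml; move: (N%:R * (y - b)) f1 f2 => w f1 f2.
  by apply/andP; split; lra.
exists N => //.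
exists (Num.floor (N%:R * (x.1 - (a N).1)), Num.floor (N%:R * (x.2 - (a N).2))).
by move=> k l kL lL; apply: rO; exact: cl.
Qed.

Lemma not_stable (Omega : set (R * R)) (a : nat -> R * R) (F : R * R -> R)
    (Lam lam : R) : bounded_domain Omega -> numerical_symbol cz_kernel F ->
  F @` Q = `[- Lam, Lam]%classic -> - Lam <= lam <= Lam -> lam != 0 ->
  ~ stable cz_kernel Omega a lam%:C.
Proof.
move=> [ne oO _ bO] hF hLam lamL lam0 [C hC].
pose C' := `|C| + 1.
have C'0 : 0 < C' by rewrite ltr_wpDl.
(* With [e = 1 / (2 C')] and [L > 16 C'^2 M], the two terms of [C'^2 |v|^2] are at most [L^2 / 4]
   and less than [L^2 / 2]. Stability would make their sum at least [|u|^2 = L^2]. *)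
have e0 : 0 < (2 * C')^-1 by rewrite invr_gt0 mulr_gt0.
have [tau [M [M0 hM]]] := symbol_majorant hF hLam lamL lam0 e0.
pose L := (Num.bound (16 * C' ^+ 2 * M)).+1.
have LM : 16 * C' ^+ 2 * M < L%:R.
  apply: lt_trans (archi_boundP _) _; last by rewrite ltr_nat.
  by rewrite !mulr_ge0// ?sqr_ge0 // ltW.
have [N N0 [m0 hm0]] := grid_block a L oO ne.
have mem k l : (k < L)%N -> (l < L)%N -> m0 + (k%:Z, l%:Z) \in omega Omega (a N) N.
  by move=> kL lL; apply/omegaP => //; exact: hm0.
have oN : omega Omega (a N) N != fset0.
  by apply/fset0Pn; exists (m0 + (0%:Z, 0%:Z)); exact: mem.
have [uM opC] := hC N N0 oN.
pose J (kl : 'I_L * 'I_L) : 'I_#|{: omega Omega (a N) N}| :=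
  enum_rank (FSetSub (mem kl.1 kl.2 (ltn_ord _) (ltn_ord _))).
have posJ kl : node (J kl) = m0 + ((kl.1 : nat)%:Z, (kl.2 : nat)%:Z).
  by rewrite /node enum_rankK.
pose pos := @node R Omega (a N) N.
pose w := wave J tau.
pose u : 'cV[R[i]]_#|{: omega Omega (a N) N}| := \col_i w i.
have wu : (fun i => u i 0) = w by apply/funext => i; rewrite mxE.
pose v := (lam%:C%:M - Tmx cz_kernel Omega (a N) N) *m u.
have vb : l2norm v ^+ 2 <= (2 * C')^-1 ^+ 2 * L%:R ^+ 2 + 8 * M * L%:R.
  rewrite l2norm_sqr; apply: (wave_bound (@node_inj _ _ _ _) posJ hF hLam M0 hM).
  by move=> i; rewrite TmxM// wu mxE.
have ub : l2norm u <= C' * l2norm v.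
  rewrite -[u](mulKmx uM) -/v; apply: le_trans (l2norm_opnorm _ _) _.
  apply: ler_wpM2r; first exact: l2norm_ge0.
  by apply: le_trans opC _; rewrite /C' ler_wpDr// ler_norm.
have uL : l2norm u ^+ 2 = L%:R ^+ 2 by rewrite l2norm_sqr wu (rdot_wave _ posJ).
have : L%:R ^+ 2 <= C' ^+ 2 * ((2 * C')^-1 ^+ 2 * L%:R ^+ 2 + 8 * M * L%:R).
  rewrite -uL; apply: le_trans (_ : _ <= C' ^+ 2 * l2norm v ^+ 2) _.
    by rewrite -exprMn ler_sqr ?nnegrE ?mulr_ge0 ?l2norm_ge0// ltW.
  by rewrite uL ler_wpM2l// sqr_ge0.
have L0 : 0 < L%:R :> R by rewrite ltr0n.
rewrite (_ : C' ^+ 2 * _ = L%:R ^+ 2 / 4 + (16 * C' ^+ 2 * M) * L%:R / 2); last first.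
  by field; rewrite gt_eqF.
have : (16 * C' ^+ 2 * M) * L%:R < L%:R ^+ 2 by rewrite expr2 ltr_pM2r.
have : 0 < L%:R ^+ 2 :> R by rewrite exprn_gt0.
move: (16 * C' ^+ 2 * M * L%:R) (L%:R ^+ 2) => x y; lra.
Qed.

End Instability.

Theorem corollary3p13 (R : realType) (Omega : set (R * R))
    (hOmega : bounded_domain Omega) (a : nat -> R * R)
    (F : R * R -> R) (hF : numerical_symbol cz_kernel F)
    (Lam : R) (hLam : F @` Q = `[- Lam, Lam]%classic) :
  (forall lam : R[i], ~ Cinterval Lam lam ->
    forall N : nat, (0 < N)%N -> omega Omega (a N) N != fset0 ->
      (forall f : R * R -> R[i],
        exists! u : {ffun omega Omega (a N) N -> R[i]},
          forall m : omega Omega (a N) N,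
            lam * u m - N%:R ^- 2 *
              (\sum_(n : omega Omega (a N) N | n != m)
                 (cz_kernel (gridpt (a N) N (val m) - gridpt (a N) N (val n)))%:C
                   * u n)
            = f (gridpt (a N) N (val m))) /\
      lam%:M - Tmx cz_kernel Omega (a N) N \in unitmx /\
      opnorm (invmx (lam%:M - Tmx cz_kernel Omega (a N) N))
        <= (Cdist lam (Cinterval Lam))^-1) /\
  (forall lam : R, (- Lam <= lam < - 2^-1) || (2^-1 < lam <= Lam) ->
    (forall A : (R * R -> R[i]) -> (R * R -> R[i]),
      pv_operator cz_kernel Omega A ->
      boundedly_invertible Omega (fun u x => lam%:C * u x - A u x)) /\
    ~ stable cz_kernel Omega a lam%:C).
Proof.
have [_ oOmega _ bOmega] := hOmega; split=> [lam lamC N N0 _|lam lamI].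
  have [uM opM] := resolvent_estimate Omega (a N) N0 hF hLam lamC.
  by split=> [f|//]; exact: unique_solution.
have lam2 : 2^-1 < `|lam|.
  by rewrite ltr_normr; case/orP: lamI => /andP[? ?]; apply/orP; [right|left]; lra.
have lamL : - Lam <= lam <= Lam.
  by case/orP: lamI => /andP[? ?]; apply/andP; split; lra.
split=> [A hA|]; first exact: well_posed.
apply: (not_stable hOmega hF hLam lamL).
by rewrite -normr_gt0; apply: lt_trans lam2; rewrite invr_gt0.
Qed.
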